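(* Let $Tx=x+\alpha$ on $\mathbb T=[0,1)$, where $\alpha$ is irrational with bounded partial quotients, and let $\varphi(x)=\{x\}-\frac12$. Let $\mathcal S=(S_t)_{t\in\mathbb R}$ be an ergodic measure-preserving flow on a standard probability space $(Y,\mathcal C,\nu)$ such that no rational number is an eigenvalue of $\mathcal S$ on $L^2_0(Y,\nu)$ (i.e. there is no $t\in\mathbb Q$ and $0\ne h\in L^2_0(Y,\nu)$ with $h\circ S_u=e^{2\pi i tu}h$ for all $u\in\mathbb R$). Then the automorphism $T_{\varphi,\mathcal S}(x,y)=(x+\alpha,S_{\varphi(x)}y)$ of $(\mathbb T\times Y,\lambda_{\mathbb T}\otimes\nu)$ has the AOP property.
   Context: AOP: for all zero-mean $L^2$ functions $F,G$, $\limsup_{r\ne s \text{ prime},\ r,s\to\infty}\sup_{\kappa\in J^e(R^r,R^s)}|\int F\otimes G\,d\kappa|=0$, where $J^e(R^r,R^s)$ is the set of ergodic $R^r\times R^s$-invariant probability measures on the product with both marginals equal to the invariant measure. *)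

(* Defs.v *)
From HB Require Import structures.
From mathcomp Require Import all_boot all_order all_algebra.
From mathcomp Require Import all_classical all_reals all_analysis.
Set Implicit Arguments. Unset Strict Implicit. Unset Printing Implicit Defensive.
Import Order.TTheory GRing.Theory Num.Theory.
Import numFieldNormedType.Exports.
Local Open Scope classical_set_scope.
Local Open Scope ring_scope.

Section Defs.
Context {R : realType}.

Definition frac (x : R) : R := x - (Num.floor x)%:~R.

Fixpoint cf_rem (a : R) (n : nat) : R :=
  match n with 0%N => a | n'.+1 => (frac (cf_rem a n'))^-1 end.
Definition partial_quotient (a : R) (n : nat) : int := Num.floor (cf_rem a n).
Definition bounded_partial_quotients (a : R) : Prop :=
  exists M : int, forall n : nat, partial_quotient a n <= M.

Definition standard_borel d (Y : measurableType d) : Prop :=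
  exists f : Y -> R, [/\ injective f, measurable_fun setT f,
    measurable (range f) & forall A, measurable A -> measurable (f @` A)].

Definition measure_preserving_flow d (Y : measurableType d)
    (nu : set Y -> \bar R) (S : R -> Y -> Y) : Prop :=
  [/\ measurable_fun setT (fun p : (R * Y)%type => S p.1 p.2),
      (forall y, S 0 y = y),
      (forall s t y, S (s + t) y = S s (S t y)) &
      (forall t A, measurable A -> nu (S t @^-1` A) = nu A)].

Definition ergodic_flow d (Y : measurableType d)
    (nu : set Y -> \bar R) (S : R -> Y -> Y) : Prop :=
  forall A, measurable A -> (forall t, S t @^-1` A = A) ->
    nu A = 0%E \/ nu A = 1%E.

Definition L2_0 d (X : measurableType d) (mu : set X -> \bar R) (f : X -> R) : Prop :=
  [/\ measurable_fun setT f,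
      mu.-integrable setT (fun x => (f x ^+ 2)%:E) &
      (\int[mu]_x (f x)%:E = 0)%E].

(** a complex number t (here: a rational) is an eigenvalue of the flow on
    L^2_0: h = f + i g in L^2_0, h <> 0, h o S_u = e^{2 pi i t u} h for all u *)
Definition flow_eigenvalue d (Y : measurableType d)
    (nu : set Y -> \bar R) (S : R -> Y -> Y) (t : R) : Prop :=
  exists f g : Y -> R, [/\ L2_0 nu f, L2_0 nu g,
    ~ {ae nu, forall y, f y = 0 /\ g y = 0} &
    forall u : R, {ae nu, forall y,
      f (S u y) = cos (2 * pi * t * u) * f y - sin (2 * pi * t * u) * g y /\
      g (S u y) = sin (2 * pi * t * u) * f y + cos (2 * pi * t * u) * g y}].

Definition is_joining d (X : measurableType d) (mu : set X -> \bar R)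
    (kappa : set (X * X)%type -> \bar R) (P Q : X -> X) : Prop :=
  [/\ forall A, measurable A -> kappa (A `*` setT) = mu A,
      forall A, measurable A -> kappa (setT `*` A) = mu A &
      forall B, measurable B ->
        kappa ((fun z : (X * X)%type => (P z.1, Q z.2)) @^-1` B) = kappa B].

Definition ergodic_measure d (Z : measurableType d) (kappa : set Z -> \bar R)
    (Phi : Z -> Z) : Prop :=
  forall B, measurable B -> Phi @^-1` B = B -> kappa B = 0%E \/ kappa B = 1%E.

(** |int F (x) G dkappa| for complex F = F1 + i F2, G = G1 + i G2 *)
Definition cplx_cross_abs d (X : measurableType d)
    (kappa : probability (X * X)%type R) (F1 F2 G1 G2 : X -> R) : R :=
  let re := Rintegral kappa setT
              (fun z => F1 z.1 * G1 z.2 - F2 z.1 * G2 z.2) in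
  let im := Rintegral kappa setT
              (fun z => F1 z.1 * G2 z.2 + F2 z.1 * G1 z.2) in
  Num.sqrt (re ^+ 2 + im ^+ 2).

Definition AOP d (X : measurableType d) (mu : set X -> \bar R) (Rm : X -> X) : Prop :=
  forall F1 F2 G1 G2 : X -> R,
    L2_0 mu F1 -> L2_0 mu F2 -> L2_0 mu G1 -> L2_0 mu G2 ->
    forall eps : R, 0 < eps -> exists N : nat,
      forall r s : nat, prime r -> prime s -> r <> s -> (N <= r)%N -> (N <= s)%N ->
      forall kappa : probability (X * X)%type R,
        is_joining mu kappa (iter r Rm) (iter s Rm) ->
        ergodic_measure kappa (fun z : (X * X)%type => (iter r Rm z.1, iter s Rm z.2)) ->
        cplx_cross_abs kappa F1 F2 G1 G2 <= eps.

Lemma measurable_unit_itv : measurable (`[0%R, 1%R[ : set R).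
Proof. exact: measurable_itv. Qed.

Definition lebesgue_T : set R -> \bar R :=
  mrestr (@lebesgue_measure R) measurable_unit_itv.

Definition sawtooth (x : R) : R := frac x - 2^-1.

Definition skew_flow d (Y : measurableType d) (alpha : R) (S : R -> Y -> Y)
    (p : (R * Y)%type) : (R * Y)%type :=
  (frac (p.1 + alpha), S (sawtooth p.1) p.2).

End Defs.

(* Main.v *)
(** Let kappa be an ergodic joining of the r-th and s-th powers of the skew product.
    Its projection to the two circle coordinates is invariant under the translations
    tau_t (x1, x2) = (x1 + r t, x2 + s t).  Choose coprime q, p with |q alpha - p| < 1/q;
    the Birkhoff sums of the sawtooth at times q r and q s are then bounded
    (Denjoy-Koksma), and tau_(delta/q) changes them by delta r^2 - N1 and delta s^2 - N2,
    where N1 and N2 count the discontinuities crossed.  As alpha is badly approximable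
    and delta small, N1 and N2 are 0 or 1, with means delta r^2 and delta s^2.  The event
    (N1, N2) = (a, b) is almost invariant, so by ergodicity of kappa it is asymptotically
    independent of everything; if its probability does not tend to 0, then kappa is
    invariant under the flow shift (S_(delta r^2 - a), S_(delta s^2 - b)) on Y x Y.
    Comparing the four events with r <> s makes kappa invariant under (S_1, id) and
    (id, S_1).  Integer times are ergodic, since a nonconstant S_1-invariant function would
    produce an integer eigenvalue; hence integrals of F (x) G against kappa only see the
    fibre averages of F and G.  On the circle coordinates kappa is invariant under
    (id, rotation by 1/r), so as r grows these averages decorrelate. *)
From HB Require Import structures.
From mathcomp Require Import all_boot all_order all_algebra.
From mathcomp Require Import all_classical all_reals all_analysis.
From mathcomp Require Import measurable_realfun ring lra zify.
Require Import Defs.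
Import Order.TTheory GRing.Theory Num.Theory.
Import numFieldNormedType.Exports.
Set Implicit Arguments.
Unset Strict Implicit.
Unset Printing Implicit Defensive.
Local Open Scope classical_set_scope.
Local Open Scope ring_scope.

(** * Bounded measurable functions on a probability space *)

Section BoundedMeasurable.
Context {R : realType} d (T : measurableType d).
Implicit Types f g : T -> R.

(** Base translations preserve only the projection of [kappa] to the two circles, not [kappa]
    itself, so translating the base point while keeping the fibre points fixed is not measure
    preserving. For small translations this is harmless, uniformly over all base functions bounded
    by 1: such a function meets a fixed weight through the conditional density of that weight, and a
    density is L1-continuous under the base flow. The weights that occur contain Birkhoff sums, and
    uniformity needs these to stay in a fixed interval; hence the times q r and q s. Jumps survive
    in the limit because the translation delta / q becomes small while q r points are tested, with
    r^2 delta crossings expected. Keeping (r^2 + s^2) delta below 1/2 gives the event (0, 0) mass at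
    least 1/2; subtracting its shift from that of (a, b) cancels delta and leaves the integer shift
    (a, b). The analysis is carried out for bounded measurable functions, whose integrability is
    automatic; square-integrable ones are reached by truncation at the end. *)

Definition bmf f := measurable_fun setT f /\ exists M : R, forall x, `|f x| <= M.

Lemma bmf_bound f : bmf f -> exists2 M : R, 0 < M & forall x, `|f x| <= M.
Proof.
move=> [_ [M hM]]; exists (`|M| + 1); first by rewrite ltr_wpDl.
by move=> x; rewrite (le_trans (hM x))// (le_trans (ler_norm M))// lerDl.
Qed.

Lemma bmf_cst (c : R) : bmf (fun=> c).
Proof. by split => //; exists `|c|. Qed.

Lemma bmfD f g : bmf f -> bmf g -> bmf (fun x => f x + g x).
Proof.
move=> [mf [M hM]] [mg [N hN]]; split; first exact: measurable_funD.
by exists (M + N) => x; rewrite (le_trans (ler_normD _ _))// lerD.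
Qed.

Lemma bmfN f : bmf f -> bmf (fun x => - f x).
Proof.
move=> [mf [M hM]]; split; first exact: measurableT_comp.
by exists M => x; rewrite normrN.
Qed.

Lemma bmfB f g : bmf f -> bmf g -> bmf (fun x => f x - g x).
Proof. by move=> hf hg; apply: bmfD => //; exact: bmfN. Qed.

Lemma bmfM f g : bmf f -> bmf g -> bmf (fun x => f x * g x).
Proof.
move=> [mf [M hM]] [mg [N hN]]; split; first exact: measurable_funM.
by exists (M * N) => x; rewrite normrM ler_pM.
Qed.

Lemma bmf_norm f : bmf f -> bmf (fun x => `|f x|).
Proof.
move=> [mf [M hM]]; split; first exact: measurableT_comp.
by exists M => x; rewrite normr_id.
Qed.

Lemma bmf_sum I (s : seq I) (P : pred I) (F : I -> T -> R) :
  (forall i, bmf (F i)) -> bmf (fun x => \sum_(i <- s | P i) F i x).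
Proof.
move=> hF; rewrite (_ : (fun x => _) =
   (fun x => \sum_(i <- [seq i <- s | P i]) F i x)); last first.
  by apply/funext => x; rewrite big_filter.
elim: [seq i <- s | P i] => [|i r IH].
  by under eq_fun do rewrite big_nil; exact: bmf_cst.
by under eq_fun do rewrite big_cons; exact: bmfD.
Qed.

Lemma bmf_indic (A : set T) : measurable A -> bmf (\1_A : T -> R).
Proof.
move=> mA; split; first exact: measurable_indic.
by exists 1 => x; rewrite indicE; case: (x \in A); rewrite /= ?normr1 ?normr0.
Qed.

End BoundedMeasurable.

Lemma bmf_comp {R : realType} d d' (T : measurableType d) (U : measurableType d')
    (f : U -> R) (h : T -> U) :
  bmf f -> measurable_fun setT h -> bmf (fun x => f (h x)).
Proof.
move=> [mf [M hM]] mh; split; first exact: (measurableT_comp mf mh).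
by exists M => x; exact: hM.
Qed.

Section Expectation.
Context {R : realType} d (T : measurableType d) (P : probability T R).
Implicit Types f g : T -> R.

Local Notation E f := (Rintegral P setT f).

Lemma bmf_integrable f : bmf f -> P.-integrable setT (EFin \o f).
Proof.
move=> [mf [M hM]]; apply: measurable_bounded_integrable => //.
  by rewrite (le_lt_trans (probability_le1 P _))// ltry.
exists M; split; first exact: num_real.
by move=> x Mx y _ /=; rewrite (le_trans (hM y))// ltW.
Qed.

Lemma probT : P [set: T] = 1%E. Proof. exact: probability_setT. Qed.

Lemma ED f g : bmf f -> bmf g -> E (fun x => f x + g x) = E f + E g.
Proof. by move=> hf hg; rewrite RintegralD//; exact: bmf_integrable. Qed.

Lemma EB f g : bmf f -> bmf g -> E (fun x => f x - g x) = E f - E g.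
Proof. by move=> hf hg; rewrite RintegralB//; exact: bmf_integrable. Qed.

Lemma EZl c f : bmf f -> E (fun x => c * f x) = c * E f.
Proof. by move=> hf; rewrite RintegralZl //; exact: bmf_integrable. Qed.

Lemma EZr c f : bmf f -> E (fun x => f x * c) = E f * c.
Proof. by move=> hf; rewrite RintegralZr//; exact: bmf_integrable. Qed.

Lemma Ecst c : E (fun=> c) = c.
Proof. by rewrite Rintegral_cst// [X in fine X]probT /= mulr1. Qed.

Lemma Ele f g : bmf f -> bmf g -> (forall x, f x <= g x) -> E f <= E g.
Proof. by move=> hf hg fg; apply: le_Rintegral => //; exact: bmf_integrable. Qed.

Lemma Ege0 f : (forall x, 0 <= f x) -> 0 <= E f.
Proof. by move=> f0; exact: Rintegral_ge0. Qed.

Lemma Enorm f : bmf f -> `|E f| <= E (fun x => `|f x|).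
Proof. by move=> hf; apply: le_normr_Rintegral => //; exact: bmf_integrable. Qed.

Lemma Enorm_le f (M : R) : bmf f -> (forall x, `|f x| <= M) -> `|E f| <= M.
Proof.
move=> hf hM; apply: le_trans (Enorm hf) _.
by rewrite -[leRHS]Ecst; apply: Ele => //; [exact: bmf_norm|exact: bmf_cst].
Qed.

Lemma Enorm_dist f g h : bmf f -> bmf g -> bmf h ->
  (forall x, `|f x - g x| <= h x) -> `|E f - E g| <= E h.
Proof.
move=> hf hg hh hM; rewrite -EB//.
apply: le_trans (Enorm (bmfB hf hg)) _.
by apply: Ele => //; exact/bmf_norm/bmfB.
Qed.

Lemma Esum I (s : seq I) (F : I -> T -> R) : (forall i, bmf (F i)) ->
  E (fun x => \sum_(i <- s) F i x) = \sum_(i <- s) E (F i).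
Proof.
move=> hF; elim: s => [|i s IH].
  by under eq_Rintegral do rewrite big_nil; rewrite Ecst big_nil.
under eq_Rintegral do rewrite big_cons.
by rewrite ED// ?big_cons ?IH//; exact: bmf_sum.
Qed.

Lemma Eindic (A : set T) : measurable A -> E \1_A = fine (P A).
Proof. by move=> mA; rewrite /Rintegral integral_indic// setIT. Qed.

Lemma Efin f : bmf f -> (\int[P]_x (f x)%:E)%E = (E f)%:E.
Proof.
by move=> hf; rewrite fineK//; apply: integrable_fin_num => //; exact: bmf_integrable.
Qed.

Lemma E_ae_eq f g : bmf f -> bmf g -> {ae P, forall x, f x = g x} -> E f = E g.
Proof.
move=> hf hg fg; congr fine; apply: ae_eq_integral => //.
- by apply/measurable_EFinP; case: hf.
- by apply/measurable_EFinP; case: hg.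
- by apply: filterS fg => x -> .
Qed.

Lemma E_cvg (f_ : nat -> T -> R) f (M : R) : (forall n, bmf (f_ n)) -> bmf f ->
  (forall n x, `|f_ n x| <= M) -> {ae P, forall x, f_ ^~ x @ \oo --> f x} ->
  (fun n => E (f_ n)) @ \oo --> E f.
Proof.
move=> hf_ hf hM cf.
have [] := @dominated_convergence _ _ _ P setT measurableT
   (fun n x => (f_ n x)%:E) (EFin \o f) (fun=> M%:E).
- by move=> n; apply/measurable_EFinP; case: (hf_ n).
- by apply/measurable_EFinP; case: hf.
- apply: filterS cf => x cx _; by apply: cvg_EFin; [exact: nearW|exact: cx].
- exact: (@bmf_integrable (fun=> M) (bmf_cst T M)).
- by apply: aeW => x n _ /=; rewrite lee_fin.
move=> _ _ h.
have h' : (fun n => \int[P]_x (f_ n x)%:E)%E @ \oo --> (E f)%:E.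
  by rewrite -Efin.
exact: (fine_cvg h').
Qed.

End Expectation.

Lemma E_comp {R : realType} d d' (T : measurableType d) (U : measurableType d')
    (P : probability T R) (Q : probability U R) (h : T -> U) (f : U -> R) :
  measurable_fun setT h -> (forall A, measurable A -> P (h @^-1` A) = Q A) ->
  bmf f -> Rintegral P setT (fun x => f (h x)) = Rintegral Q setT f.
Proof.
move=> mh PQ hf; rewrite /Rintegral; congr fine.
have mf : measurable_fun setT (EFin \o f) by apply/measurable_EFinP; case: hf.
transitivity (\int[pushforward P h]_y (EFin \o f) y)%E.
  rewrite integral_pushforward//.
  exact: (@bmf_integrable _ _ _ _ (f \o h) (bmf_comp hf mh)).
by apply: eq_measure_integral => A mA _ /=; rewrite /pushforward PQ.
Qed.

Section Fubini.
Context {R : realType} d1 d2 (T1 : measurableType d1) (T2 : measurableType d2).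
Context (P : probability T1 R) (Q : probability T2 R).

Lemma bmf_pair1 (f : T1 * T2 -> R) x : bmf f -> bmf (fun y => f (x, y)).
Proof. by move=> hf; apply: (bmf_comp hf); exact: measurable_pair1. Qed.

Lemma bmf_pair2 (f : T1 * T2 -> R) y : bmf f -> bmf (fun x => f (x, y)).
Proof. by move=> hf; apply: (bmf_comp hf); exact: measurable_pair2. Qed.

Let PQ := (product_measure1 P Q : {measure set (T1 * T2) -> \bar R}).

Lemma PQ_integrable (f : T1 * T2 -> R) : bmf f -> PQ.-integrable setT (EFin \o f).
Proof.
move=> [mf [M hM]]; apply: measurable_bounded_integrable => //.
  rewrite -setXTT [X in (X < _)%E]product_measure1E//.
  by rewrite [X in (X * _)%E]probability_setT [X in (_ * X)%E]probability_setT mule1 ltry.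
exists M; split; first exact: num_real.
by move=> x Mx y _ /=; rewrite (le_trans (hM y))// ltW.
Qed.

Lemma bmf_E2 (f : T1 * T2 -> R) : bmf f -> bmf (fun x => Rintegral Q setT (fun y => f (x, y))).
Proof.
move=> hf; split; last first.
  have [M M0 hM] := bmf_bound hf; exists M => x.
  by apply: Enorm_le => //; exact: bmf_pair1.
apply: measurableT_comp => //.
exact: (@measurable_fubini_F _ _ _ _ _ P Q (EFin \o f) (PQ_integrable hf)).
Qed.

Lemma bmf_E1 (f : T1 * T2 -> R) : bmf f -> bmf (fun y => Rintegral P setT (fun x => f (x, y))).
Proof.
move=> hf; split; last first.
  have [M M0 hM] := bmf_bound hf; exists M => x.
  by apply: Enorm_le => //; exact: bmf_pair2.
apply: measurableT_comp => //.
exact: (@measurable_fubini_G _ _ _ _ _ P Q (EFin \o f) (PQ_integrable hf)).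
Qed.

Lemma E_prod12 (f : T1 * T2 -> R) : bmf f ->
  Rintegral PQ setT f = Rintegral P setT (fun x => Rintegral Q setT (fun y => f (x, y))).
Proof.
move=> hf; congr fine.
rewrite -(integral12_prod_meas1 (PQ_integrable hf)).
by apply: eq_integral => x _; rewrite -Efin//; exact: bmf_pair1.
Qed.

Lemma E_prod21 (f : T1 * T2 -> R) : bmf f ->
  Rintegral PQ setT f = Rintegral Q setT (fun y => Rintegral P setT (fun x => f (x, y))).
Proof.
move=> hf; congr fine.
rewrite -(integral21_prod_meas1 (PQ_integrable hf)).
by apply: eq_integral => x _; rewrite -Efin//; exact: bmf_pair2.
Qed.

Lemma E_fubini (f : T1 * T2 -> R) : bmf f ->
  Rintegral P setT (fun x => Rintegral Q setT (fun y => f (x, y))) =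
  Rintegral Q setT (fun y => Rintegral P setT (fun x => f (x, y))).
Proof. by move=> hf; rewrite -E_prod12// E_prod21. Qed.

End Fubini.

(** * Diophantine approximation *)

Section Frac.
Context {R : realType}.
Implicit Types x y : R.

Lemma frac_ge0 x : 0 <= frac x.
Proof. by rewrite subr_ge0 floor_le. Qed.

Lemma frac_lt1 x : frac x < 1.
Proof. by rewrite ltrBlDl -(intrD1 (Num.floor x)) floorD1_gt. Qed.

Lemma frac_add_int x (m : int) : frac (x + m%:~R) = frac x.
Proof.
by rewrite /frac floorDrz ?intr_int// intrKfloor rmorphD /= opprD addrACA subrr addr0.
Qed.

Lemma frac_id x : 0 <= x < 1 -> frac x = x.
Proof.
by move=> hx; rewrite /frac (_ : Num.floor x = 0) ?subr0//; apply: floor_def; rewrite add0r.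
Qed.

Lemma frac_addl x y : frac (frac x + y) = frac (x + y).
Proof.
by rewrite {2}/frac addrAC -(rmorphN (intmul 1 : int -> R)) frac_add_int.
Qed.

Lemma frac_addr x y : frac (x + frac y) = frac (x + y).
Proof. by rewrite addrC frac_addl addrC. Qed.

Lemma sawtooth_frac x : sawtooth (frac x) = sawtooth x.
Proof. by rewrite /sawtooth -{1}[frac x]addr0 frac_addl addr0. Qed.

Lemma sawtooth_frac_add x y : sawtooth (frac x + y) = sawtooth (x + y).
Proof. by rewrite -sawtooth_frac frac_addl sawtooth_frac. Qed.

Lemma sawtooth_bound x : `|sawtooth x| <= 1.
Proof.
rewrite ler_norml /sawtooth; have := frac_ge0 x; have := frac_lt1 x; lra.
Qed.

Lemma irrational_frac x : irrational x -> irrational (frac x).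
Proof.
move=> hx [q _ hq]; apply: hx; exists (q + (Num.floor x)%:~R) => //.
by rewrite rmorphD/= hq ratr_int /frac subrK.
Qed.

Lemma irrational_inv x : irrational x -> irrational x^-1.
Proof.
move=> hx [q _ hq]; apply: hx; exists q^-1 => //.
by rewrite fmorphV/= hq invrK.
Qed.

Lemma irrational_neq0 x : irrational x -> x != 0.
Proof. by move=> hx; apply/eqP => x0; apply: hx; exists 0 => //; rewrite rmorph0. Qed.

End Frac.

Section Diophantine.
Context {R : realType}.

(* |n x - p| (n + y p) / (1 + x y) is invariant under the Gauss map
   (n, p, x, y) -> (p, n - a p, 1/x - a, 1/(a + y)). *)
Lemma gauss_lower_bound (K : R) (x : nat -> R) (a : nat -> nat) : 2 <= K ->
  (forall i, K^-1 <= x i < 1) -> (forall i, (0 < a i)%N) ->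
  (forall i, (x i)^-1 = (a i)%:R + x i.+1) ->
  forall (n : nat) i (p : nat) (y : R), (0 < n)%N -> 0 <= y <= 1 ->
  (2 * K ^+ 2)^-1 * (1 + x i * y) <= `|n%:R * x i - p%:R| * (n%:R + y * p%:R).
Proof.
move=> K2 hx a0 hinv n; set c := (2 * K ^+ 2)^-1.
have K0 : 0 < K by lra.
have Ki : K^-1 <= 1 by rewrite invf_le1//; lra.
have Ki0 : 0 < K^-1 by rewrite invr_gt0.
have cE : 2 * c = K^-1 ^+ 2.
  by rewrite /c invfM exprVn mulrA divff// mul1r.
have c0 : 0 < c by rewrite /c invr_gt0 mulr_gt0// exprn_gt0.
have cK : 2 * c <= K^-1 by rewrite cE; nra.
elim/ltn_ind: n => n IH i p y n0 /andP[y0 y1].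
have n1 : 1 <= n%:R :> R by rewrite ler1n.
have /andP[xK x1] := hx i; have /andP[xK' x1'] := hx i.+1.
have xp : 0 < x i by lra.
have p0 : 0 <= p%:R :> R by [].
have bnd : c * (1 + x i * y) <= 2 * c.
  have : x i * y <= 1 by nra.
  by nra.
have far (L : R) : 2 * c <= L -> L <= `|n%:R * x i - p%:R| ->
    c * (1 + x i * y) <= `|n%:R * x i - p%:R| * (n%:R + y * p%:R).
  move=> cL Lh; apply: (le_trans bnd); apply: (le_trans cL); apply: (le_trans Lh).
  by rewrite ler_peMr// (le_trans n1)// lerDl mulr_ge0.
have a1 : 1 <= (a i)%:R :> R by rewrite ler1n.
have xE : x i * ((a i)%:R + x i.+1) = 1 by rewrite -hinv divff// gt_eqF.
have pE : p%:R = x i * ((a i)%:R + x i.+1) * p%:R by rewrite xE mul1r.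
(* If p = 0, n <= p or n < p a, then [n * x i] is far from p by itself. Otherwise p < n and p a <=
   n, and the Gauss step applies and lowers n to p. *)
have [pE0|pN0] := eqVneq p 0%N.
  by apply: (far K^-1) => //; rewrite pE0 subr0 ger0_norm; nra.
have [np|pn] := leqP n p.
  (* As [a i >= 1] and [x i.+1 >= K^-1], the distance [1 - x i] is at least 1 / (K + 1), hence at
     least [K^-1 ^+ 2]. The factor 2 in the constant pays for [1 + x i * y <= 2]. *)
  apply: (far (K^-1 ^+ 2)); first by rewrite cE.
  have np' : n%:R <= p%:R :> R by rewrite ler_nat.
  rewrite ler0_norm; last by nra.
  have : K^-1 ^+ 2 <= 1 - x i by nra.
  by nra.
have [nap|apn] := ltnP n (p * a i).
  apply: (far K^-1) => //.
  have nap' : n%:R + 1 <= p%:R * (a i)%:R :> R by rewrite natr1 -natrM ler_nat.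
  have E : p%:R - n%:R * x i = x i * (p%:R * (a i)%:R - n%:R + p%:R * x i.+1).
    by rewrite {1}pE; ring.
  have : x i * 1 <= p%:R - n%:R * x i.
    rewrite E ler_pM2l//; have : 0 <= p%:R * x i.+1 by apply: mulr_ge0 => //; lra.
    by lra.
  by rewrite distrC => h; rewrite (le_trans _ (ler_norm _))//; lra.
have p1 : (0 < p)%N by rewrite lt0n.
have ay : 0 < (a i)%:R + y by lra.
have := IH p pn i.+1 (n - p * a i)%N ((a i)%:R + y)^-1 p1.
rewrite invr_ge0 (ltW ay) invf_le1// (_ : 1 <= _) ?andbT; last by lra.
move=> /(_ isT); rewrite natrB// natrM.
have -> : n%:R * x i - p%:R = - x i * (p%:R * x i.+1 - (n%:R - p%:R * (a i)%:R)).
  by rewrite {1}pE; ring.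
rewrite normrM normrN (gtr0_norm xp).
set L := `|_|; set D := n%:R - _.
have -> : n%:R + y * p%:R = ((a i)%:R + y) * (p%:R + ((a i)%:R + y)^-1 * D).
  by rewrite /D; field; rewrite gt_eqF.
have -> : 1 + x i * y = x i * ((a i)%:R + y) * (1 + x i.+1 * ((a i)%:R + y)^-1).
  by rewrite -[1 in LHS]xE; field; rewrite gt_eqF.
move=> h; rewrite mulrACA [L * _]mulrC.
rewrite [leRHS](_ : _ = x i * ((a i)%:R + y) * (L * (p%:R + ((a i)%:R + y)^-1 * D))); last by ring.
rewrite mulrCA ler_pM2l//; exact: mulr_gt0.
Qed.

Definition badly_approximable (alpha : R) := exists2 c : R, 0 < c &
  forall (n : nat) (p : int), (0 < n)%N -> c <= n%:R * `|n%:R * alpha - p%:~R|.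

(** At y = 0 the Gauss invariant is n |n x - p|. [K] bounds the inverses of all Gauss iterates,
    which are at most M + 1; the absolute value and the 2 in it also ensure [2 <= K]. *)
Lemma badly_approximable_bpq (alpha : R) :
  irrational alpha -> bounded_partial_quotients alpha -> badly_approximable alpha.
Proof.
move=> irr [M hM].
pose x i := frac (cf_rem alpha i).
have irri i : irrational (cf_rem alpha i).
  by elim: i => //= i IH; exact/irrational_inv/irrational_frac.
have xgt0 i : 0 < x i.
  by rewrite lt0r frac_ge0 andbT; exact/irrational_neq0/irrational_frac.
have xlt1 i : x i < 1 := frac_lt1 _.
(* The index is shifted because quotient 0 is the integer part, which [frac] removes. *)
pose a i := `|partial_quotient alpha i.+1|%N.
have xi1 i : 1 < (x i)^-1 by rewrite invf_gt1.
have aE i : (a i)%:R = (partial_quotient alpha i.+1)%:~R :> R.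
  rewrite /a natr_absz ger0_norm// floor_ge0 /=.
  by rewrite ltW//; have := xi1 i; rewrite /x; lra.
have a0 i : (0 < a i)%N.
  by rewrite -(ltr0n R) aE ltr0z floor_gt0 /= -/(x i) ltW.
have inv i : (x i)^-1 = (a i)%:R + x i.+1.
  by rewrite aE {2}/x /frac /partial_quotient /= addrC subrK.
pose K : R := `|M|%:~R + 2.
have MK : M%:~R + 1 <= K.
  have : M%:~R <= `|M|%:~R :> R by rewrite ler_int ler_norm.
  by rewrite /K; lra.
have K2 : 2 <= K.
  have : 0 <= `|M|%:~R :> R by rewrite ler0z.
  by rewrite /K; lra.
have hx i : K^-1 <= x i < 1.
  rewrite xlt1 andbT -[x i]invrK lef_pV2 ?posrE ?invr_gt0//; last by lra.
  rewrite inv (le_trans _ MK)//; apply: lerD; last exact: ltW.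
  by rewrite aE ler_int.
exists ((2 * K ^+ 2)^-1); first by rewrite invr_gt0 mulr_gt0// exprn_gt0//; lra.
move=> n p n0.
pose p' : int := p - n%:Z * Num.floor alpha.
have -> : n%:R * alpha - p%:~R = n%:R * x 0%N - p'%:~R.
  rewrite /p' /x /= /frac intrD rmorphN rmorphM /=; ring.
case: p' => [k|k].
  have h01 : 0 <= (0 : R) <= 1 by rewrite lexx ler01.
  have := gauss_lower_bound K2 hx a0 inv 0 k n0 h01.
  by rewrite mulr0 addr0 mulr1 mul0r addr0 [leRHS]mulrC.
have n1 : 1 <= n%:R :> R by rewrite ler1n.
rewrite NegzE rmorphN /= opprK.
have xpos := xgt0 0%N.
rewrite ger0_norm; last by rewrite addr_ge0// mulr_ge0// ltW.
have : (2 * K ^+ 2)^-1 <= 1.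
  rewrite invf_le1; nra.
have : 1 <= (k.+1%:~R : R) by rewrite (ler_nat R 1 k.+1).
have := hx 0%N; nra.
Qed.

(** Pigeonhole for Q + 1 multiples of [alpha] in Q boxes. Dividing q and p by their gcd shrinks both
    the denominator and the error, so neither bound is lost. *)
Lemma dirichlet_coprime (alpha : R) (Q : nat) : (0 < Q)%N ->
  exists (q : nat) (p : int), [/\ (0 < q <= Q)%N, coprimez q p &
    `|q%:R * alpha - p%:~R| < Q%:R^-1].
Proof.
move=> Q0.
have Qp : 0 < Q%:R :> R by rewrite ltr0n.
pose b (j : nat) := `|Num.floor (Q%:R * frac (j%:R * alpha))|%N.
have bE j : (b j)%:Z = Num.floor (Q%:R * frac (j%:R * alpha)).
  by rewrite gez0_abs// floor_ge0 mulr_ge0// frac_ge0.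
have bQ j : (b j < Q)%N.
  rewrite -ltz_nat bE floor_lt_int -[ltRHS]mulr1 ltr_pM2l//; exact: frac_lt1.
pose f (j : 'I_Q.+1) : 'I_Q := Ordinal (bQ j).
have [j1 [j2 [j12 fj]]] : exists j1 j2 : 'I_Q.+1, (j1 < j2)%N /\ b j1 = b j2.
  have : ~ injective f.
    by move=> /leq_card; rewrite !card_ord ltnn.
  move=> /existsNP[u /existsNP[v /not_implyP[fuv /eqP uv]]].
  have bb : b u = b v by case: fuv.
  have [lt|lt|/val_inj e] := ltngtP u v.
  - by exists u, v.
  - by exists v, u.
  - by rewrite e eqxx in uv.
have [q [p [/andP[q0 qQ] hq]]] : exists (q : nat) (p : int), (0 < q <= Q)%N /\
    `|q%:R * alpha - p%:~R| < Q%:R^-1.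
  exists (j2 - j1)%N, (Num.floor (j2%:R * alpha) - Num.floor (j1%:R * alpha)).
  split; first by have := ltn_ord j2; lia.
  rewrite natrB; last exact: ltnW.
  rewrite intrB (_ : _ - _ = frac (j2%:R * alpha) - frac (j1%:R * alpha)); last first.
    by rewrite /frac; ring.
  rewrite -(ltr_pM2l Qp) divff ?gt_eqF// -{1}(gtr0_norm Qp) -normrM mulrBr.
  have := floor_itv (Q%:R * frac (j1%:R * alpha)).
  have := floor_itv (Q%:R * frac (j2%:R * alpha)).
  rewrite -!bE fj !intrD !mulr1z.
  by rewrite ltr_norml => /andP[? ?] /andP[? ?]; lra.
pose g := gcdn q `|p|%N.
have g0 : (0 < g)%N by rewrite gcdn_gt0 q0.
have [q' qE] : exists q', q = (q' * g)%N by apply/dvdnP/dvdn_gcdl.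
have [p' pE] : exists p', `|p|%N = (p' * g)%N by apply/dvdnP/dvdn_gcdr.
have q'0 : (0 < q')%N by move: q0; rewrite qE muln_gt0 => /andP[].
have pE' : p = (sgz p * p'%:Z) * g%:Z.
  by rewrite -mulrA -PoszM -pE -intEsg.
exists q', (sgz p * p'%:Z); split.
- by rewrite q'0 /= (leq_trans _ qQ)// qE leq_pmulr.
- rewrite /coprimez /gcdz abszM.
  have cop : coprime q' p'.
    have : gcdn (q' * g) (p' * g) = g by rewrite -qE -pE.
    rewrite -muln_gcdl => /eqP; rewrite -{2}[g]mul1n eqn_pmul2r//.
  (* [sgz 0] is 0, so p = 0 is treated apart; coprimality then forces q' = 1. *)
  have [p0|pN0] := eqVneq p 0.
    move: pE; rewrite p0 /= => /esym/eqP; rewrite muln_eq0 (gtn_eqF g0) orbF => /eqP p'0.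
    by move: cop; rewrite p'0 /coprime muln0 => /eqP ->.
  rewrite (_ : `|sgz p|%N = 1%N) ?mul1n; last by case: (p) pN0 => [[]|].
  by move: cop => /eqP ->.
- apply: le_lt_trans hq; rewrite {2}pE' qE natrM.
  rewrite [X in _ <= `|X|](_ : _ = g%:R * (q'%:R * alpha - (sgz p * p'%:Z)%:~R)); last first.
    by rewrite (intrM _ (sgz p * p'%:Z)) -[g%:Z%:~R]/(g%:R); ring.
  rewrite normrM normr_nat ler_peMl// ler1n//.
Qed.

(** The numbers j p + k run through every residue modulo q once, so their remainders add up to the
    sum of all j < q, whatever k is. *)
Lemma sum_div_residues (q : nat) (p k : int) : (0 < q)%N -> coprimez q p ->
  q%:Z * \sum_(j < q) ((j%:Z * p + k) %/ q)%Z =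
  (p - 1) * (\sum_(j < q) j)%N%:Z + q%:Z * k.
Proof.
move=> q0 cop.
have qN0 : q%:Z != 0 by rewrite eqz_nat -lt0n.
pose r (j : nat) := ((j%:Z * p + k) %% q)%Z.
have r0 j : 0 <= r j by exact: modz_ge0.
have rq j : (`|r j| < q)%N by rewrite -ltz_nat gez0_abs// ltz_pmod.
pose h (j : 'I_q) : 'I_q := Ordinal (rq j).
have hinj : injective h.
  move=> i j /(congr1 val) /= /(congr1 Posz); rewrite !gez0_abs// => rij.
  have : (q %| (i%:Z - j%:Z) * p)%Z.
    have -> : (i%:Z - j%:Z) * p = (i%:Z * p + k) - (j%:Z * p + k) by ring.
    by rewrite -eqz_mod_dvd; apply/eqP.
  rewrite Gauss_dvdzl// => /dvdzP[m hm].
  apply/val_inj => /=; have := ltn_ord i; have := ltn_ord j.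
  have {}hm : i%:Z - j%:Z = (m : int) * q%:Z := hm.
  have [m0|[m0|m0]] : (m : int) <= -1 \/ (m : int) = 0 \/ 1 <= (m : int) by lia.
  - nia.
  - by rewrite m0 mul0r in hm; lia.
  - nia.
have -> : (\sum_(j < q) j)%N%:Z = \sum_(j < q) r j.
  rewrite (reindex_inj hinj) /= -natz natr_sum.
  by apply: eq_bigr => j _; rewrite natz gez0_abs.
have -> : q%:Z * \sum_(j < q) ((j%:Z * p + k) %/ q)%Z = \sum_(j < q) (j%:Z * p + k - r j).
  by rewrite mulr_sumr; apply: eq_bigr => j _; rewrite {2}(divz_eq (j%:Z * p + k) q) addrK mulrC.
rewrite big_split /= sumrN big_split /= -mulr_suml sumr_const card_ord.
rewrite -[in LHS](_ : (\sum_(j < q) j)%N%:Z = \sum_(i < q) i%:Z); last first.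
  by rewrite -natz natr_sum; apply: eq_bigr => j _; rewrite natz.
rewrite -[k *+ q]mulr_natl natz.
have <- : (\sum_(j < q) j)%N%:Z = \sum_(j < q) r j.
  rewrite (reindex_inj hinj) /= -natz natr_sum.
  by apply: eq_bigr => j _; rewrite natz gez0_abs.
ring.
Qed.

Definition birk (alpha : R) (n : nat) (x : R) : R :=
  \sum_(j < n) sawtooth (x + j%:R * alpha).

(* The Denjoy-Koksma inequality for the rotation by alpha. *)
Lemma birk_bound (alpha : R) (q : nat) (p : int) : (0 < q)%N -> coprimez q p ->
  `|q%:R * alpha - p%:~R| <= q%:R^-1 -> forall x, `|birk alpha q x| <= 3.
Proof.
move=> q0 cop hq x.
have qp : 0 < q%:R :> R by rewrite ltr0n.
have qN0 : q%:R != 0 :> R by rewrite gt_eqF.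
pose k := Num.floor (q%:R * x).
pose S : R := (\sum_(j < q) j)%N%:R.
pose D (k : int) : R := \sum_(j < q) ((j%:Z * p + k) %/ q)%Z%:~R.
have SE : S = q%:R * ((q%:R - 1) / 2).
  have : (\sum_(j < q) j)%N = 'C(q, 2) by rewrite -bin2_sum big_mkord.
  have := mul_bin_diag q 1; rewrite bin1 => E.
  move=> SE; apply: (mulfI (_ : 2 != 0 :> R)) => //.
  rewrite /S SE -natrM -E; case: (q) q0 => // m _.
  by rewrite succnK natrM -natr1; field.
have DE m : D m = (p%:~R - 1) * ((q%:R - 1) / 2) + m%:~R.
  apply: (mulfI qN0); have := sum_div_residues m q0 cop.
  move=> /(congr1 (fun z : int => z%:~R : R)); rewrite !(intrM, intrD) rmorph_sum /= => E.
  rewrite -/(D m) in E; rewrite pmulrn {}E -!pmulrn -/S SE; ring.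
have eps j : (j < q)%N -> `|j%:R * alpha - j%:R * p%:~R / q%:R| <= q%:R^-1.
  move=> jq; rewrite (_ : _ - _ = j%:R / q%:R * (q%:R * alpha - p%:~R)); last by field.
  rewrite normrM -[leRHS]mul1r ler_pM// ger0_norm ?divr_ge0//.
  by rewrite ler_pdivrMr// mul1r ler_nat ltnW.
(* As k is the floor of q x, the number q (x + j alpha) lies in [j p + k - 1, j p + k + 2). The sum
   of integer parts is thus squeezed between [D (k - 1)] and [D (k + 2)], which differ by exactly
   3. *)
pose F : R := \sum_(j < q) (Num.floor (x + j%:R * alpha))%:~R.
have kx : k%:~R <= q%:R * x by exact: floor_le.
have kx1 : q%:R * x < k%:~R + 1 by have := floorD1_gt (q%:R * x); rewrite intrD.
have FD : D (k - 1) <= F.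
  apply: ler_sum => j _; rewrite ler_int floor_ge_int.
  have := lez_floor (j%:Z * p + (k - 1)) (_ : q%:Z != 0).
  rewrite eqz_nat -lt0n q0 => /(_ isT); rewrite -(ler_int R) !(intrM,intrD,intrB) -!pmulrn => h.
  have := eps j (ltn_ord j); rewrite ler_norml => /andP[h1 _].
  have h2 : - 1 <= q%:R * (j%:R * alpha) - j%:R * p%:~R.
    have := ler_wpM2l (ltW qp) h1; rewrite mulrN divff// mulrBr.
    by rewrite [X in _ - X](_ : _ = j%:R * p%:~R)//; field.
  by rewrite -(ler_pM2l qp) mulrDr mulrC; lra.
have DF : F <= D (k + 2).
  apply: ler_sum => j _; rewrite ler_int lez_divRL; last by rewrite ltz_nat.
  rewrite -ltzD1 -(ltr_int R) !(intrM,intrD) -!pmulrn.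
  have h := floor_le (x + j%:R * alpha).
  have := eps j (ltn_ord j); rewrite ler_norml => /andP[_ h1].
  have h2 : q%:R * (j%:R * alpha) - j%:R * p%:~R <= 1.
    have := ler_wpM2l (ltW qp) h1; rewrite divff// mulrBr.
    by rewrite [X in _ - X](_ : _ = j%:R * p%:~R)//; field.
  have := ler_wpM2l (ltW qp) h; rewrite mulrDr mulrC; lra.
have -> : birk alpha q x = q%:R * x + alpha * S - F - q%:R / 2.
  rewrite /birk /F /sawtooth /frac !big_split /= !sumrN !sumr_const !card_ord.
  rewrite -[x *+ q]mulr_natl -[2^-1 *+ q]mulr_natl /S natr_sum mulr_sumr.
  by congr (_ + _ - _ - _); apply: eq_bigr => j _; rewrite mulrC.
have e : `|alpha * S - p%:~R * ((q%:R - 1) / 2)| <= 2^-1.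
  rewrite SE (_ : _ - _ = (q%:R * alpha - p%:~R) * ((q%:R - 1) / 2)); last by ring.
  have q1 : 1 <= q%:R :> R by rewrite ler1n.
  rewrite normrM [X in _ * X]ger0_norm; last by lra.
  apply: le_trans (_ : q%:R^-1 * (q%:R / 2) <= _).
    by apply: ler_pM => //; lra.
  by rewrite mulrA mulVf// mul1r.
move: FD DF e; rewrite !DE !intrD !rmorphN /= !ler_norml => h1 h2 /andP[h3 h4].
by apply/andP; split; lra.
Qed.

End Diophantine.

(** * The mean ergodic theorem *)

Lemma measurable_gt_set {R : realType} d (T : measurableType d) (f : T -> R) (c : R) :
  measurable_fun setT f -> measurable [set x | c < f x].
Proof.
move=> mf; rewrite (_ : [set x | _] = setT `&` f @^-1` `]c, +oo[).
  exact: mf.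
by rewrite setTI; apply/seteqP; split => x /=; rewrite in_itv /= andbT.
Qed.

Lemma measurable_iter d (T : measurableType d) (V : T -> T) n :
  measurable_fun setT V -> measurable_fun setT (iter n V).
Proof.
move=> mV; elim: n => [|n IH]; first exact: measurable_id.
exact: (measurableT_comp mV IH).
Qed.

Section Birkhoff.
Context {R : realType} d (T : measurableType d) (P : probability T R) (V : T -> T).
Hypothesis mV : measurable_fun setT V.
Hypothesis PV : forall A, measurable A -> P (V @^-1` A) = P A.

Lemma preserving_iter n A : measurable A -> P (iter n V @^-1` A) = P A.
Proof.
elim: n A => // n IH A mA.
have -> : iter n.+1 V @^-1` A = iter n V @^-1` (V @^-1` A) by [].
rewrite IH ?PV// -[X in measurable X]setTI; exact: mV.
Qed.

Lemma E_iter n (f : T -> R) : bmf f ->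
  Rintegral P setT (fun x => f (iter n V x)) = Rintegral P setT f.
Proof.
by move=> hf; apply: E_comp => //; [exact: measurable_iter|exact: preserving_iter].
Qed.

Definition bsum (H : T -> R) n x := \sum_(i < n) H (iter i V x).

Lemma bsumS H n x : bsum H n.+1 x = H x + bsum H n (V x).
Proof.
by rewrite /bsum big_ord_recl /=; congr (_ + _); apply: eq_bigr => i _; rewrite -iterSr.
Qed.

Lemma bmf_bsum H n : bmf H -> bmf (bsum H n).
Proof. by move=> hH; apply: bmf_sum => i; apply: bmf_comp => //; exact: measurable_iter. Qed.

(** The maximum of the Birkhoff sums of lengths 0 to n, in the recursive form that Garsia's argument
    uses. *)
Fixpoint maxsum (H : T -> R) n x : R :=
  if n is n'.+1 then Num.max 0 (H x + maxsum H n' (V x)) else 0.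

Lemma maxsum_ge0 H n x : 0 <= maxsum H n x.
Proof. by case: n => //= n; rewrite le_max lexx. Qed.

Lemma maxsum_le H n x : maxsum H n x <= maxsum H n.+1 x.
Proof.
elim: n x => [|n IH] x; first exact: maxsum_ge0.
rewrite [leRHS]/= [leLHS]/= ge_max le_max lexx /= le_max; apply/orP; right.
by rewrite lerD2l; exact: IH.
Qed.

Lemma maxsum_mono H m n x : (m <= n)%N -> maxsum H m x <= maxsum H n x.
Proof.
elim: n => [|n IH]; first by rewrite leqn0 => /eqP ->.
rewrite leq_eqVlt => /predU1P[->//|mn].
by apply: le_trans (IH mn) _; exact: maxsum_le.
Qed.

Lemma bsum_le_maxsum H n x : bsum H n x <= maxsum H n x.
Proof.
elim: n x => [|n IH] x; first by rewrite /bsum big_ord0.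
by rewrite bsumS /= le_max; apply/orP; right; rewrite lerD2l.
Qed.

Lemma bmf_maxsum H n : bmf H -> bmf (maxsum H n).
Proof.
move=> hH; elim: n => [|n IH] /=; first exact: bmf_cst.
have [m1 [M hM]] := bmfD hH (bmf_comp IH mV).
split; first exact: measurable_maxr.
exists M => x; rewrite ger0_norm ?le_max ?lexx//.
rewrite ge_max (le_trans _ (hM x))//=.
by rewrite (le_trans _ (hM x))// ler_norm.
Qed.

(** Garsia: where the maximum m is positive it is at most H + m o V, and elsewhere it is 0, hence at
    most m o V. Integrating, the two integrals of m cancel by invariance. *)
Lemma maximal_ineq H n : bmf H ->
  0 <= Rintegral P setT (fun x => \1_[set x | 0 < maxsum H n.+1 x] x * H x).
Proof.
move=> hH; have hm := bmf_maxsum n.+1 hH; set A := [set x | _].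
have mA : measurable A by apply: measurable_gt_set; case: hm.
have hA := bmf_indic mA (R := R).
have hmV := bmf_comp hm mV.
rewrite -(lerD2r (Rintegral P setT (maxsum H n.+1))) add0r.
rewrite -[X in _ <= _ + X](E_iter 1 hm) -ED//; last exact: bmfM.
apply: Ele => //; first by apply: bmfD => //; exact: bmfM.
move=> x; rewrite indicE; have [xA|xA] := boolP (x \in A).
  rewrite mul1r; move: xA; rewrite inE /A /= lt_max ltxx /= => h.
  by rewrite [leLHS]max_r; [rewrite lerD2l; exact: (maxsum_le H n (V x))|exact: ltW].
rewrite mul0r add0r; move: xA; rewrite notin_setE /A /= => /negP.
by rewrite -leNgt => /le_trans; apply; rewrite le_max lexx.
Qed.

Lemma maximal_ergodic H : bmf H -> {ae P, forall x, exists n, 0 < bsum H n x} ->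
  0 <= Rintegral P setT H.
Proof.
move=> hH hae.
pose f_ n x := \1_[set x | 0 < maxsum H n.+1 x] x * H x.
have hA n : bmf (\1_[set x | 0 < maxsum H n.+1 x] : T -> R).
  by apply: bmf_indic; apply: measurable_gt_set; case: (bmf_maxsum n.+1 hH).
have hf n : bmf (f_ n) by apply: bmfM.
have [M M0 hM] := bmf_bound hH.
have cv : (fun n => Rintegral P setT (f_ n)) @ \oo --> Rintegral P setT H.
  apply: (@E_cvg _ _ _ _ _ _ M) => //.
    move=> n x; rewrite normrM indicE; case: (_ \in _).
      by rewrite normr1 mul1r.
    by rewrite normr0 mul0r ltW.
  apply: filterS hae => x [n hn].
  apply: cvg_near_cst; near=> m.
  have nm : (n <= m)%N by near: m; exact: nbhs_infty_ge.
  rewrite /f_ indicE mem_set ?mul1r//=.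
  apply: lt_le_trans hn _; apply: le_trans (bsum_le_maxsum _ _ _) _.
  by apply: (@maxsum_mono H n m.+1); exact: leqW.
rewrite -(cvg_lim _ cv)//; apply: limr_ge; first by apply/cvg_ex; exists (Rintegral P setT H).
by apply: nearW => n; exact: maximal_ineq.
Unshelve. all: end_near. Qed.

(** Averages exceed c at arbitrarily large times: this follows from limsup > c and implies limsup >=
    c. *)
Definition bsum_often (H : T -> R) (c : R) (x : T) :=
  forall N, exists2 n, (N <= n)%N & c * n%:R < bsum H n x.

(** Passing between x and [V x] adds or drops one bounded term, which the gap n (c - c') absorbs for
    large n. *)
Lemma bsum_often_shift H c c' x : bmf H -> c' < c ->
  (bsum_often H c x -> bsum_often H c' (V x)) /\
  (bsum_often H c (V x) -> bsum_often H c' x).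
Proof.
move=> hH cc; have [M M0 hM] := bmf_bound hH.
have [K hK] : exists K : nat, M + `|c'| <= K%:R * (c - c').
  exists (Num.truncn ((M + `|c'|) / (c - c'))).+1.
  rewrite -ler_pdivrMr ?subr_gt0// ltW// truncnS_gt//.
have big n : (K <= n)%N -> M + `|c'| <= n%:R * (c - c').
  by move=> Kn; rewrite (le_trans hK)// ler_pM2r ?subr_gt0// ler_nat.
have hx := hM x; move: hx; rewrite ler_norml => /andP[h1 h2].
have c1 := ler_norm c'; have c2 := ler_norm (- c'); rewrite normrN in c2.
split=> h N.
  have [n] := h (maxn N K).+1; case: n => // n; rewrite ltnS geq_max => /andP[Nn Kn].
  rewrite bsumS -natr1 => hn; exists n => //.
  have := big n Kn; nra.
have [n] := h (maxn N K); rewrite geq_max => /andP[Nn Kn] hn.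
exists n.+1; first exact: leqW.
by rewrite bsumS -natr1; have := big n Kn; nra.
Qed.

Hypothesis erg : forall B, measurable B -> V @^-1` B = B -> P B = 0%E \/ P B = 1%E.

(** The bad set is invariant. If it had full measure, [H - a] would have a positive Birkhoff sum
    almost everywhere, and the maximal ergodic theorem would make its mean nonnegative. *)
Lemma bsum_upper H a : bmf H -> Rintegral P setT H < a ->
  {ae P, forall x, forall c, a < c -> exists N, forall n, (N <= n)%N -> bsum H n x <= c * n%:R}.
Proof.
move=> hH aH.
(* The union over j absorbs the loss of [bsum_often_shift], so [B] is exactly invariant, as [erg]
   demands. *)
pose B := \bigcup_j [set x | bsum_often H (a + j.+1%:R^-1) x].
have mB : measurable B.
  apply: bigcupT_measurable => j.
  rewrite (_ : [set x | _] = \bigcap_N \bigcup_(n in [set n | (N <= n)%N])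
     [set x | (a + j.+1%:R^-1) * n%:R < bsum H n x]).
    apply: bigcapT_measurable => N; apply: bigcup_measurable => n _.
    by apply: measurable_gt_set; case: (bmf_bsum n hH).
  apply/seteqP; split => [x hx N _|x hx N]; first by have [n Nn h] := hx N; exists n.
  by have [n Nn h] := hx N I; exists n.
have lt12 j : a + j.+2%:R^-1 < a + j.+1%:R^-1.
  by rewrite ltrD2l ltf_pV2 ?posrE ?ltr0n// ltr_nat.
have VB : V @^-1` B = B.
  apply/seteqP; split => x /= [j _ hj]; exists j.+1 => //=;
  by have [h1 h2] := bsum_often_shift x hH (lt12 j); auto.
have PB : P B = 0%E.
  have [//|PB1] := erg mB VB; exfalso.
  have hH' : bmf (fun x => H x - a) by apply: bmfB => //; exact: bmf_cst.
  have : 0 <= Rintegral P setT (fun x => H x - a).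
    apply: maximal_ergodic => //; exists (~` B); split.
    - exact: measurableC.
    - by rewrite probability_setC// PB1 subee.
    - apply: subsetC => x [j _ /= /(_ 0%N)[n _ hn]]; exists n.
      rewrite /bsum sumrB sumr_const card_ord subr_gt0 -mulr_natr.
      apply: le_lt_trans hn; rewrite ler_wpM2r// lerDl invr_ge0//.
  rewrite EB//; last exact: bmf_cst.
  by rewrite Ecst; lra.
exists B; split => // x; apply: contra_notP => xB c ac.
have [j hj] : exists j : nat, a + j.+1%:R^-1 <= c.
  exists (Num.truncn (c - a)^-1).
  rewrite -lerBrDl -[leRHS]invrK lef_pV2 ?posrE ?ltr0n ?invr_gt0 ?subr_gt0//.
  by rewrite ltW// truncnS_gt//.
apply: contrapT => hN; apply: xB; exists j => // N.
apply: contrapT => hn; apply: hN; exists N => n Nn.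
rewrite leNgt; apply/negP => hc; apply: hn; exists n => //.
by apply: le_lt_trans hc; rewrite ler_wpM2r.
Qed.

(** Upper bounds for [H] and for [- H] give pointwise convergence; dominated convergence turns it
    into the L1 form used later. *)
Theorem birkhoff H : bmf H ->
  (fun n => Rintegral P setT (fun x => `|n.+1%:R^-1 * bsum H n.+1 x - Rintegral P setT H|))
    @ \oo --> (0 : R).
Proof.
move=> hH; set h := Rintegral P setT H.
have [M M0 hM] := bmf_bound hH.
have hHN : bmf (fun x => - H x) by exact: bmfN.
have EN : Rintegral P setT (fun x => - H x) = - h.
  under eq_Rintegral do rewrite -mulN1r.
  by rewrite EZl// mulN1r.
have up k : {ae P, forall x, forall c, h + k.+1%:R^-1 < c ->
    exists N, forall n, (N <= n)%N -> bsum H n x <= c * n%:R}.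
  by apply: bsum_upper => //; rewrite ltrDl invr_gt0.
have dn k : {ae P, forall x, forall c, - h + k.+1%:R^-1 < c ->
    exists N, forall n, (N <= n)%N -> bsum (fun x => - H x) n x <= c * n%:R}.
  by apply: bsum_upper => //; rewrite EN ltrDl invr_gt0.
have lim : {ae P, forall x, (fun n => n.+1%:R^-1 * bsum H n.+1 x) @ \oo --> h}.
  have ae1 := ae_foralln up; have ae2 := ae_foralln dn.
  apply: filterS2 ae1 ae2 => x h1 h2.
  apply/cvgrPdist_le => e e0.
  have [k hk] : exists k : nat, k.+1%:R^-1 < e.
    exists (Num.truncn e^-1); rewrite -[ltRHS]invrK ltf_pV2 ?posrE ?ltr0n ?invr_gt0//.
    by rewrite truncnS_gt.
  have [N1 hN1] : exists N, forall n, (N <= n)%N -> bsum H n x <= (h + e) * n%:R.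
    by apply: (h1 k); rewrite ltrD2l.
  have [N2 hN2] : exists N, forall n, (N <= n)%N ->
      bsum (fun x => - H x) n x <= (- h + e) * n%:R.
    by apply: (h2 k); rewrite ltrD2l.
  near=> n.
  have n1 : (N1 <= n.+1)%N by apply: leqW; near: n; exact: nbhs_infty_ge.
  have n2 : (N2 <= n.+1)%N by apply: leqW; near: n; exact: nbhs_infty_ge.
  have := hN1 _ n1; have := hN2 _ n2; rewrite /bsum sumrN -/(bsum H n.+1 x).
  have n0 : 0 < n.+1%:R :> R by rewrite ltr0n.
  rewrite -!ler_pdivrMr// mulNr [_ / _]mulrC => h3 h4.
  move: h3 h4; set u := n.+1%:R^-1 * bsum H n.+1 x => h3 h4.
  by rewrite ler_norml; apply/andP; split; lra.
rewrite -[0 in X in _ --> X](@Ecst _ _ _ P).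
have hb n : bmf (fun x => n.+1%:R^-1 * bsum H n.+1 x - h).
  by apply: bmfB; [apply: bmfM; [exact: bmf_cst|exact: bmf_bsum]|exact: bmf_cst].
apply: (@E_cvg _ _ _ _ _ _ (M + M)).
- by move=> n; exact: bmf_norm.
- exact: bmf_cst.
- move=> n x; rewrite normr_id; apply: le_trans (ler_normB _ _) _; apply: lerD.
    rewrite normrM ger0_norm ?invr_ge0// mulrC ler_pdivrMr ?ltr0n//.
    rewrite /bsum (le_trans (ler_norm_sum _ _ _))//.
    apply: le_trans (ler_sum _ (fun i _ => hM _)) _.
    by rewrite sumr_const card_ord mulr_natr.
  exact: Enorm_le.
- apply: filterS lim => x /cvgrPdist_le hx; apply/cvgrPdist_le => e /hx.
  by apply: filterS => n; rewrite sub0r normrN normr_id distrC.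
Unshelve. all: end_near. Qed.

(* Almost invariance of e lets one replace H by its Birkhoff averages. *)
Lemma almost_invariant_mixing H : bmf H -> forall eta, 0 < eta ->
  exists2 eta', 0 < eta' & forall (e : T -> R) q, bmf e -> (forall x, `|e x| <= 1) ->
    Rintegral P setT (fun x => `|e (V x) - e x|) <= eta' ->
    `|Rintegral P setT (fun x => e x * H (iter q V x)) -
      Rintegral P setT e * Rintegral P setT H| <= eta.
Proof.
move=> hH eta eta0; set h := Rintegral P setT H.
have [M M0 hM] := bmf_bound hH.
have [n hn] : exists n, Rintegral P setT (fun x => `|n.+1%:R^-1 * bsum H n.+1 x - h|) <= eta / 2.
  have /cvgrPdist_le/(_ (eta / 2)) := birkhoff hH; rewrite divr_gt0// => /(_ isT)[n _ /(_ n)].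
  rewrite /= leqnn sub0r normrN => /(_ isT) hn; exists n.
  by apply: le_trans hn; exact: ler_norm.
(* Averaging [H] over n + 1 times moves [e] by at most n steps, each costing [eta'] times the bound
   [M]: this spends half of [eta]. The other half is the error of the ergodic average. *)
exists (eta / 2 / M / n.+1%:R).
  by rewrite !divr_gt0// ?ltr0n.
move=> e q he e1 hinv.
have hHq i : bmf (fun x => H (iter (q + i) V x)) by apply: (bmf_comp hH); exact: measurable_iter.
have hei i : bmf (fun x => e (iter i V x)) by apply: (bmf_comp he); exact: measurable_iter.
have drift i : Rintegral P setT (fun x => `|e (iter i V x) - e x|) <=
    i%:R * (eta / 2 / M / n.+1%:R).
  elim: i => [|i IH].
    by rewrite mul0r /=; under eq_Rintegral do rewrite subrr normr0; rewrite Ecst.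
  have hs := bmf_norm (bmfB (hei i) he).
  have hs1 : bmf (fun x => `|e (V x) - e x|) := bmf_norm (bmfB (hei 1%N) he).
  have hs1i : bmf (fun x => `|e (V (iter i V x)) - e (iter i V x)|).
    by apply: (bmf_comp hs1); exact: measurable_iter.
  apply: (@le_trans _ _ (Rintegral P setT (fun x => `|e (V (iter i V x)) - e (iter i V x)| +
     `|e (iter i V x) - e x|))).
    apply: Ele; [exact: (bmf_norm (bmfB (hei i.+1) he))|exact: bmfD|].
    move=> x; rewrite /= (le_trans _ (ler_normD _ _))//.
    by rewrite addrA subrK.
  rewrite ED// -natr1 mulrDl mul1r addrC lerD//.
  by rewrite (E_iter i hs1).
have shift i : `|Rintegral P setT (fun x => e x * H (iter q V x)) -
     Rintegral P setT (fun x => e x * H (iter (q + i) V x))| <=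
     i%:R * (eta / 2 / M / n.+1%:R) * M.
  have hH0 : bmf (fun x => e x * H (iter q V x)).
    by apply: bmfM => //; have := hHq 0%N; rewrite addn0.
  rewrite -(E_iter i hH0).
  apply: (@le_trans _ _ (Rintegral P setT (fun x => `|e (iter i V x) - e x| * M))).
    apply: Enorm_dist.
    - by apply: (bmf_comp hH0); exact: measurable_iter.
    - exact: bmfM.
    - by apply: bmfM; [exact: (bmf_norm (bmfB (hei i) he))|exact: bmf_cst].
    - by move=> x; rewrite -iterD -mulrBl normrM ler_wpM2l.
  rewrite EZr; last exact: (bmf_norm (bmfB (hei i) he)).
  by rewrite ler_pM2r.
have hb : bmf (fun x => n.+1%:R^-1 * bsum H n.+1 x - h).
  by apply: bmfB; [apply: bmfM; [exact: bmf_cst|exact: bmf_bsum]|exact: bmf_cst].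
set I0 := Rintegral P setT (fun x => e x * H (iter q V x)).
have avg : Rintegral P setT (fun x => e x * (n.+1%:R^-1 * bsum H n.+1 (iter q V x))) =
   n.+1%:R^-1 * \sum_(i < n.+1) Rintegral P setT (fun x => e x * H (iter (q + i) V x)).
  rewrite -Esum; last by move=> i; exact: bmfM.
  rewrite -EZl; last by apply: bmf_sum => i; exact: bmfM.
  apply: eq_Rintegral => x _; rewrite mulrCA; congr (_ * _).
  by rewrite /bsum mulr_sumr; apply: eq_bigr => i _; rewrite -iterD addnC.
have n0 : 0 < n.+1%:R :> R by rewrite ltr0n.
have part1 : `|I0 - Rintegral P setT (fun x => e x * (n.+1%:R^-1 * bsum H n.+1 (iter q V x)))|
    <= eta / 2.
  rewrite avg [X in `|X - _|](_ : I0 = n.+1%:R^-1 * \sum_(i < n.+1) I0); last first.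
    by rewrite sumr_const card_ord -[I0 *+ _]mulr_natl mulrA mulVf ?mul1r// gt_eqF.
  rewrite -mulrBr -sumrB normrM ger0_norm ?invr_ge0// mulrC ler_pdivrMr//.
  apply: le_trans (ler_norm_sum _ _ _) _.
  apply: (@le_trans _ _ (\sum_(i < n.+1) (eta / 2))).
    apply: ler_sum => i _; apply: le_trans (shift i) _.
    rewrite [leLHS](_ : _ = i%:R / n.+1%:R * (eta / 2)); last first.
      by field; rewrite ?gt_eqF// addrC natr1.
    apply: ler_piMl; first by rewrite divr_ge0// ltW.
    by rewrite ler_pdivrMr// mul1r ler_nat ltnW.
  by rewrite sumr_const card_ord mulr_natr.
(* Uniformity in q comes from here: composing with [iter q V] does not change the L1 distance of the
   averages from the mean. *)
have part2 : `|Rintegral P setT (fun x => e x * (n.+1%:R^-1 * bsum H n.+1 (iter q V x))) -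
    Rintegral P setT e * h| <= eta / 2.
  rewrite -EZr//; apply: le_trans hn.
  rewrite -(E_iter q (bmf_norm hb)); apply: Enorm_dist.
  - apply: bmfM => //; apply: bmfM; first exact: bmf_cst.
    by apply: (bmf_comp (bmf_bsum n.+1 hH)); exact: measurable_iter.
  - by apply: bmfM => //; exact: bmf_cst.
  - by apply: (bmf_comp (bmf_norm hb)); exact: measurable_iter.
  - by move=> x; rewrite -mulrBr normrM ler_piMl.
by rewrite (splitr eta) (le_trans (ler_distD _ _ _) (lerD part1 part2)).
Qed.

End Birkhoff.

(** * Rotations and flows *)

Section LebesgueT.
Context {R : realType}.

(* [R] and [measurableTypeR R] carry the same sigma-algebra, but their measurable
   structures are not convertible. *)
Local Definition lebTR : set (measurableTypeR R) -> \bar R := @lebesgue_T R.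

HB.instance Definition _ := Measure.copy lebTR
  (mrestr (@lebesgue_measure R) (@measurable_unit_itv R)).

HB.instance Definition _ := isMeasure.Build _ R _ (@lebesgue_T R)
  (measure0 lebTR) (measure_ge0 lebTR) (@measure_semi_sigma_additive _ _ _ lebTR).

Lemma lebesgue_T_setT : @lebesgue_T R setT = 1%E.
Proof.
rewrite /lebesgue_T /mrestr setTI lebesgue_measure_itv /= lte_fin ltr01.
by rewrite -EFinB subr0.
Qed.

HB.instance Definition _ :=
  Measure_isProbability.Build _ _ _ (@lebesgue_T R) lebesgue_T_setT.

Definition lebT : probability R R := @lebesgue_T R.

HB.instance Definition _ :=
  Measure_isProbability.Build _ _ _ lebTR lebesgue_T_setT.

Local Lemma E_lebTR (f : R -> R) : bmf f ->
  Rintegral lebT setT f = Rintegral lebTR setT f.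
Proof.
move=> hf; apply: (@E_comp _ _ _ R (measurableTypeR R) lebT lebTR (fun x => x) f) => //.
Qed.

Lemma lebT_ae_unit : {ae lebT, forall x, 0 < x < 1}.
Proof.
exists (~` `]0, 1[%classic); split.
- by apply: measurableC; exact: measurable_itv.
- rewrite /= /lebesgue_T /mrestr.
  rewrite (_ : _ `&` _ = [set 0]); first exact: lebesgue_measure_set1.
  apply/seteqP; split => [x [/=]|x -> /=]; rewrite !in_itv /=; last first.
    by rewrite ltxx lexx ltr01.
  move=> /negP h /andP[x0 x1]; apply/eqP; rewrite eq_le x0 andbT leNgt.
  by apply/negP => xp; move: h; rewrite xp x1.
- by move=> x; apply: contra_not; rewrite /= in_itv.
Qed.

Lemma lebesgue_measure_translation (t : R) (A : set R) : measurable A ->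
  lebesgue_measure ((fun x => x + t) @^-1` A) = lebesgue_measure A.
Proof.
move=> mA.
have mt : measurable_fun setT (fun x : R => x + t) by apply: measurable_funD.
pose pf : {measure set (measurableTypeR R) -> \bar R} :=
  @pushforward _ _ (measurableTypeR R) (measurableTypeR R) R (@lebesgue_measure R) (fun x : R => x + t).
rewrite [RHS](@lebesgue_measure_unique _ (pf mt))//.
move=> X [[a b] _ <-]; rewrite /pf /= /pushforward /=.
have -> : (fun x => x + t) @^-1` `]a, b]%classic = `]a - t, b - t]%classic.
  by apply/seteqP; split => x /=; rewrite !in_itv /= ltrBlDr lerBrDr.
rewrite !lebesgue_measure_itv /= !lte_fin ltrD2r; case: ifP => // _.
by rewrite -!EFinB; congr (_%:E); lra.
Qed.

Lemma measurable_frac : measurable_fun setT (@frac R).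
Proof.
apply: measurable_funB => //.
have mf : measurable_fun setT (fun x : R => (Num.floor x)%:~R : R).
  apply: nondecreasing_measurable => // x y xy.
  by rewrite ler_int le_floor.
exact: mf.
Qed.

Lemma measurable_rot (t : R) : measurable_fun setT (fun x : R => frac (x + t)).
Proof. by apply: (measurableT_comp measurable_frac); apply: measurable_funD. Qed.

(** Cut at [1 - t0]: the rotation is the translation by [t0] on the left arc and by [t0 - 1] on the
    right one. *)
Lemma lebT_rot (t : R) (A : set R) : measurable A ->
  lebT ((fun x => frac (x + t)) @^-1` A) = lebT A.
Proof.
move=> mA; rewrite /= /lebesgue_T /mrestr.
pose t0 := frac t; have t00 : 0 <= t0 := frac_ge0 t; have t01 : t0 < 1 := frac_lt1 t.
have mAu (u v w : R) : measurable ((fun x => x + w) @^-1` A `&` `[u, v[%classic).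
  apply: measurableI; last exact: measurable_itv.
  rewrite -[X in measurable X]setTI.
  have mt : measurable_fun setT (fun x : R => x + w) by apply: measurable_funD.
  exact: mt.
have fE x : frac (x + t) = frac (x + t0) by rewrite /t0 frac_addr.
have -> : (fun x => frac (x + t)) @^-1` A `&` `[0, 1[%classic =
   ((fun x => x + t0) @^-1` A `&` `[0, 1 - t0[%classic) `|`
   ((fun x => x + (t0 - 1)) @^-1` A `&` `[1 - t0, 1[%classic).
  have f1 x : 0 <= x < 1 - t0 -> frac (x + t) = x + t0.
    by move=> /andP[? ?]; rewrite fE frac_id//; apply/andP; split; lra.
  have f2 x : 1 - t0 <= x < 1 -> frac (x + t) = x + (t0 - 1).
    move=> /andP[? ?]; rewrite fE -(frac_add_int _ (-1)) frac_id; first by ring.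
    by apply/andP; split; lra.
  apply/seteqP; split => [x /= [Ax]|x /=]; rewrite !in_itv /=.
    move=> /andP[x0 x1]; have [h|h] := ltP x (1 - t0); [left|right].
      by rewrite -f1 ?x0 ?h.
    by rewrite -f2 ?x1 ?h.
  case=> -[Ax h]; have /andP[h1 h2] := h.
    by split; [rewrite (f1 _ h)|apply/andP; split; lra].
  by split; [rewrite (f2 _ h)|apply/andP; split; lra].
have -> : A `&` `[0, 1[%classic = (A `&` `[t0, 1[%classic) `|` (A `&` `[0, t0[%classic).
  rewrite -setIUr; congr (_ `&` _); apply/seteqP; split => x /=; rewrite !in_itv /=.
    by move=> /andP[x0 x1]; have [h|h] := leP t0 x; [left|right]; apply/andP.
  by case=> /andP[h1 h2]; apply/andP; split; lra.
rewrite !measureU//=;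
  try exact: mAu;
  try (by apply: measurableI => //; exact: measurable_itv);
  try (by apply/seteqP; split => x //= -[[_ +] [_ +]]; rewrite !in_itv /= =>
    /andP[? ?] /andP[? ?]; lra).
congr (_ + _)%E.
  rewrite -[RHS](lebesgue_measure_translation t0); last first.
    by apply: measurableI => //; exact: measurable_itv.
  congr (lebesgue_measure _); rewrite preimage_setI; congr (_ `&` _).
  by apply/seteqP; split => x /=; rewrite !in_itv /= => /andP[? ?]; apply/andP; split; lra.
rewrite -[RHS](lebesgue_measure_translation (t0 - 1)); last first.
  by apply: measurableI => //; exact: measurable_itv.
congr (lebesgue_measure _); rewrite preimage_setI; congr (_ `&` _).
by apply/seteqP; split => x /=; rewrite !in_itv /= => /andP[? ?]; apply/andP; split; lra.
Qed.

Lemma E_rot (t : R) (u : R -> R) : bmf u ->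
  Rintegral lebT setT (fun x => u (frac (x + t))) = Rintegral lebT setT u.
Proof. by move=> hu; apply: E_comp => //; [exact: measurable_rot|exact: lebT_rot]. Qed.

Lemma bmf_dense_continuous (u : R -> R) (e : R) : bmf u -> 0 < e ->
  exists h : R -> R, [/\ bmf h, continuous h &
    Rintegral lebT setT (fun x => `|u x - h x|) <= e].
Proof.
move=> hu e0; have [M M0 hM] := bmf_bound hu.
have [mu _] := hu.
pose E := `[(0:R), 1[%classic.
have mE : measurable E by exact: measurable_itv.
have Ey : (lebesgue_measure E < +oo)%E.
  by rewrite lebesgue_measure_itv /= lte_fin ltr01 -EFinB ltry.
have intu : (@lebesgue_measure R).-integrable E (EFin \o u).
  apply: measurable_bounded_integrable => //; first exact: measurable_funTS.
  exists M; split; first exact: num_real.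
  by move=> x Mx y _ /=; rewrite (le_trans (hM y))// ltW.
have [g_ [cg ig /fine_cvgP[_ /cvgrPdist_le/(_ e e0)[n _ /(_ n (leqnn n)) /= hn]]]] :=
  approximation_continuous_integrable mE Ey intu.
(* Clipping bounds the approximant and never moves it away from [u], whose values lie in [-M, M]. *)
pose h x := Num.max (- M) (Num.min M (g_ n x)).
have ch : continuous h.
  move=> x; apply: (@continuous_max _ _ (fun=> - M) (fun x => Num.min M (g_ n x))).
    exact: cvg_cst.
  by apply: (@continuous_min _ _ (fun=> M) (g_ n)); [exact: cvg_cst|exact: cg].
have mh : measurable_fun setT h by exact: continuous_measurable_fun.
have hb : bmf h.
  split => //; exists M => x; rewrite /h ler_norml le_max lexx /= ge_max ge_min lexx /=.
  by rewrite andbT; lra.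
exists h; split => //.
move: hn; rewrite sub0r normrN => hn; apply: le_trans hn.
apply: le_trans (ler_norm _).
have mdiff : measurable_fun setT (fun z : R => `|u z - g_ n z|).
  apply: measurableT_comp => //; apply: measurable_funB => //.
  exact: continuous_measurable_fun.
have hb' : bmf (fun x => `|u x - h x|) := bmf_norm (bmfB hu hb).
rewrite (E_lebTR hb') /Rintegral fine_le//.
- by rewrite Efin.
- have iB : (@lebesgue_measure R).-integrable E (fun z => (u z)%:E - (g_ n z)%:E)%E.
    exact: (@integrableB _ (measurableTypeR R) R lebesgue_measure E mE _ _ intu (ig n)).
  have iA := integrable_abse iB.
  exact: (@integrable_fin_num _ (measurableTypeR R) R lebesgue_measure E mE _ iA).
have -> : (\int[lebTR]_x (`|u x - h x|)%:E)%E =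
    (\int[lebTR]_(x in E) (`|u x - h x|)%:E)%E.
  rewrite [RHS]integral_mkcond; apply: ae_eq_integral => //.
  - by apply/measurable_EFinP; case: hb'.
  - apply/measurable_restrict => //; rewrite setTI; apply: measurable_funTS.
    by apply/measurable_EFinP; case: hb'.
  - apply: filterS lebT_ae_unit => x /andP[x0 x1] _.
    by rewrite /restrict mem_set// /E /= in_itv /= (ltW x0).
have -> : (\int[lebTR]_(x in E) (`|u x - h x|)%:E)%E =
    (\int[@lebesgue_measure R]_(x in E) (`|u x - h x|)%:E)%E.
  apply: eq_measure_integral => A mA AE.
  by rewrite /= /lebTR /lebesgue_T /mrestr setIidl.
apply: ge0_le_integral => //.
- by apply: measurable_funTS; apply/measurable_EFinP; case: hb'.
- by apply: measurable_funTS; apply/measurable_EFinP; exact: mdiff.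
- move=> x _; rewrite lee_fin /h.
  have := hM x; rewrite ler_norml => /andP[u1 u2].
  have [g1|g1] := leP M (g_ n x).
    rewrite max_r; last by lra.
    by rewrite !ler0_norm; lra.
  have [g2|g2] := leP (- M) (g_ n x) => //.
  by rewrite !ger0_norm; lra.
Qed.

End LebesgueT.

(** * L1-continuity of rotations, translations and measurable flows *)

Section FlowContinuity.
Context {R : realType}.

(** Dominated convergence works along sequences; this turns its outcome into the form with eta and
    delta. *)
Lemma cvg0_seq_eps (f : R -> R) :
  (forall t_ : nat -> R, t_ @ \oo --> (0 : R) -> (f \o t_) @ \oo --> (0 : R)) ->
  forall eta, 0 < eta -> exists2 delta, 0 < delta & forall t, `|t| < delta -> `|f t| <= eta.
Proof.
move=> hf eta eta0; apply: contrapT => hN.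
have : forall n : nat, exists t, `|t| < n.+1%:R^-1 /\ eta < `|f t|.
  move=> n; apply: contrapT => hn; apply: hN; exists n.+1%:R^-1; first by rewrite invr_gt0.
  move=> t tn; rewrite leNgt; apply/negP => h; apply: hn; by exists t.
move=> /choice[t_ ht].
have t0 : t_ @ \oo --> (0 : R).
  apply/cvgrPdist_lt => e e0; near=> n; rewrite sub0r normrN.
  apply: lt_trans (ht n).1 _.
  by near: n; exact: near_infty_natSinv_lt (PosNum e0).
have /cvgrPdist_le/(_ eta eta0)[n _ /(_ n (leqnn n))] := hf _ t0.
by rewrite sub0r normrN /= leNgt (ht n).2.
Unshelve. all: end_near. Qed.

Lemma frac_cvg (t_ : nat -> R) x : 0 < x < 1 -> t_ @ \oo --> (0 : R) ->
  \forall n \near \oo, frac (x + t_ n) = x + t_ n.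
Proof.
move=> /andP[x0 x1] /cvgrPdist_lt ht.
have e0 : 0 < Num.min x (1 - x) by rewrite lt_min x0 subr_gt0.
have := ht _ e0; apply: filterS => n; rewrite sub0r normrN lt_min.
move=> /andP[h1 h2]; apply: frac_id.
have := ler_norm (t_ n); have := ler_norm (- t_ n); rewrite normrN => *.
by apply/andP; split; lra.
Qed.

Lemma rot_continuous (u : R -> R) (t_ : nat -> R) : bmf u -> t_ @ \oo --> (0 : R) ->
  (fun n => Rintegral lebT setT (fun x => `|u (frac (x + t_ n)) - u (frac x)|))
    @ \oo --> (0 : R).
Proof.
move=> hu ht; apply/cvgrPdist_le => e e0.
have hur t : bmf (fun x : R => u (frac (x + t))) by apply: (bmf_comp hu); exact: measurable_rot.
have hu0 : bmf (fun x : R => u (frac x)) by apply: (bmf_comp hu); exact: measurable_frac.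
have e3 : 0 < e / 3 by lra.
have [h [hh ch hE]] := bmf_dense_continuous hu e3.
have hhr t : bmf (fun x : R => h (frac (x + t))) by apply: (bmf_comp hh); exact: measurable_rot.
have hh0 : bmf (fun x : R => h (frac x)) by apply: (bmf_comp hh); exact: measurable_frac.
have [M M0 hM] := bmf_bound hh.
have close t : Rintegral lebT setT (fun x => `|u (frac (x + t)) - h (frac (x + t))|) <= e / 3.
  by rewrite (E_rot t (bmf_norm (bmfB hu hh))).
have close0 : Rintegral lebT setT (fun x => `|u (frac x) - h (frac x)|) <= e / 3.
  by have := close 0; under eq_Rintegral do rewrite addr0.
have hcv : (fun n => Rintegral lebT setT (fun x => `|h (frac (x + t_ n)) - h (frac x)|))
    @ \oo --> (0 : R).
  rewrite -[0 in X in _ --> X](@Ecst _ _ _ (@lebT R)).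
  apply: (@E_cvg _ _ _ _ _ _ (M + M)).
  - by move=> n; exact: bmf_norm (bmfB (hhr _) hh0).
  - exact: bmf_cst.
  - by move=> n x; rewrite normr_id (le_trans (ler_normB _ _))// lerD.
  - apply: filterS lebT_ae_unit => x hx.
    have -> : frac x = x by apply: frac_id; lra.
    have cx : (fun n => `|h (x + t_ n) - h x|) @ \oo --> (0 : R).
      have c0 : (fun n => h (x + t_ n) - h x) @ \oo --> h x - h x.
        apply: cvgB; last exact: cvg_cst.
        apply: continuous_cvg; first exact: ch.
        by rewrite -[X in _ --> X]addr0; apply: cvgD => //; exact: cvg_cst.
      apply/cvgrPdist_le => r r0; have /cvgrPdist_le/(_ r r0) := c0.
      by apply: filterS => n; rewrite subrr !sub0r !normrN normr_id.
    apply: cvg_trans cx; apply: near_eq_cvg.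
    by apply: filterS (frac_cvg hx ht) => n ->.
have /cvgrPdist_le/(_ _ e3) := hcv.
apply: filterS => n; rewrite !sub0r !normrN => hn.
have {}hn := le_trans (ler_norm _) hn.
rewrite ger0_norm; last exact: Ege0.
have b1 := bmf_norm (bmfB (hur (t_ n)) (hhr (t_ n))).
have b2 := bmf_norm (bmfB (hhr (t_ n)) hh0).
have b3 := bmf_norm (bmfB hu0 hh0).
apply: (@le_trans _ _ (Rintegral lebT setT (fun x =>
   (`|u (frac (x + t_ n)) - h (frac (x + t_ n))| +
    `|h (frac (x + t_ n)) - h (frac x)|) + `|u (frac x) - h (frac x)|))).
  apply: Ele; [exact: bmf_norm (bmfB (hur _) hu0)|exact: bmfD (bmfD b1 b2) b3|].
  move=> x; rewrite [X in _ <= _ + X]distrC.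
  by rewrite (le_trans (ler_distD (h (frac x)) _ _))// lerD2r ler_distD.
rewrite ED//; last exact: bmfD.
by rewrite ED//; have := close (t_ n); lra.
Qed.

(** [g] need not be periodic, but from an interior point a small translation does not wrap, so
    translation and rotation eventually agree there. *)
Lemma line_translation_continuous (g : R -> R) (t_ : nat -> R) : bmf g -> t_ @ \oo --> (0 : R) ->
  (fun n => Rintegral lebT setT (fun s => `|g (s + t_ n) - g s|)) @ \oo --> (0 : R).
Proof.
move=> hg ht; have [M M0 hM] := bmf_bound hg.
have hgt t : bmf (fun s : R => g (s + t)).
  by apply: (bmf_comp hg); apply: measurable_funD.
have hgr t : bmf (fun x : R => g (frac (x + t))) by apply: (bmf_comp hg); exact: measurable_rot.
have hg0 : bmf (fun x : R => g (frac x)) by apply: (bmf_comp hg); exact: measurable_frac.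
have c1 : (fun n => Rintegral lebT setT (fun s => `|g (s + t_ n) - g (frac (s + t_ n))|))
    @ \oo --> (0 : R).
  rewrite -[0 in X in _ --> X](@Ecst _ _ _ (@lebT R)).
  apply: (@E_cvg _ _ _ _ _ _ (M + M)).
  - by move=> n; exact: bmf_norm (bmfB (hgt _) (hgr _)).
  - exact: bmf_cst.
  - by move=> n x; rewrite normr_id (le_trans (ler_normB _ _))// lerD.
  - apply: filterS lebT_ae_unit => x hx; apply: cvg_near_cst.
    by apply: filterS (frac_cvg hx ht) => n ->; rewrite subrr normr0.
have c2 := rot_continuous hg ht.
have e3 : Rintegral lebT setT (fun s => `|g (frac s) - g s|) = 0.
  rewrite -[RHS](@Ecst _ _ _ (@lebT R)); apply: E_ae_eq.
  - exact: bmf_norm (bmfB hg0 hg).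
  - exact: bmf_cst.
  - by apply: filterS lebT_ae_unit => x hx; rewrite frac_id ?subrr ?normr0//; lra.
have c12 : (fun n => Rintegral lebT setT (fun s => `|g (s + t_ n) - g (frac (s + t_ n))|) +
    Rintegral lebT setT (fun x => `|g (frac (x + t_ n)) - g (frac x)|)) @ \oo --> (0 : R).
  by rewrite -[0 in X in _ --> X]addr0; apply: cvgD.
apply: (squeeze_cvgr _ (cvg_cst 0) c12); apply: nearW => n.
rewrite Ege0//=.
rewrite -[X in _ <= _ + X]addr0 -e3 -!ED.
- apply: Ele.
  + exact: bmf_norm (bmfB (hgt _) hg).
  + by apply: bmfD; [|apply: bmfD]; apply: bmf_norm; apply: bmfB.
  + move=> x; rewrite (le_trans (ler_distD (g (frac (x + t_ n))) _ _))// lerD2l.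
    exact: ler_distD.
- by apply: bmf_norm; apply: bmfB.
- by apply: bmfD; apply: bmf_norm; apply: bmfB.
- by apply: bmf_norm; apply: bmfB.
- by apply: bmf_norm; apply: bmfB.
Qed.

(** By invariance the integral may be averaged over a unit of time. After Fubini, each orbit
    function s |-> u (S s x) is only translated on the line. [S 0] is kept in the statement because
    for rotations of the real line the time-0 map is [frac], not the identity. *)
Lemma flow_continuous d (X : measurableType d) (P : probability X R) (S : R -> X -> X)
    (u : X -> R) :
  measurable_fun setT (fun p : R * X => S p.1 p.2) ->
  (forall s t x, S (s + t) x = S s (S t x)) ->
  (forall t A, measurable A -> P (S t @^-1` A) = P A) ->
  bmf u -> forall eta, 0 < eta -> exists2 delta, 0 < delta &
    forall t, `|t| < delta -> Rintegral P setT (fun x => `|u (S t x) - u (S 0 x)|) <= eta.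
Proof.
move=> mS SD PS hu eta eta0; have [M M0 hM] := bmf_bound hu.
have mSt t : measurable_fun setT (S t) by exact: (measurableT_comp mS (pair1_measurable t)).
have hut t : bmf (fun x => u (S t x)) by exact: bmf_comp.
have hb t := bmf_norm (bmfB (hut t) (hut 0)).
have [|delta d0 hd] := @cvg0_seq_eps
    (fun t => Rintegral P setT (fun x => `|u (S t x) - u (S 0 x)|)) _ eta eta0; last first.
  by exists delta => // t /hd; apply: le_trans; exact: ler_norm.
move=> t_ ht.
have mS2 (t : R) : measurable_fun setT (fun p : R * X => S (p.1 + t) p.2).
  apply: (measurableT_comp mS (g := fun p : R * X => (p.1 + t, p.2))).
  apply/measurable_fun_pairP; split; last exact: measurable_snd.
  by apply: measurable_funD => //; exact: measurable_fst.
pose F (t : R) (p : R * X) := `|u (S (p.1 + t) p.2) - u (S p.1 p.2)|.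
have hF t : bmf (F t).
  by apply: bmf_norm; apply: bmfB; apply: (bmf_comp hu).
have EF t : Rintegral P setT (fun x => `|u (S t x) - u (S 0 x)|) =
    Rintegral P setT (fun x => Rintegral lebT setT (fun s => F t (s, x))).
  rewrite -(E_fubini _ _ (hF t)) -[LHS](@Ecst _ _ _ (@lebT R)).
  apply: eq_Rintegral => s _.
  rewrite -(E_comp (mSt s) (PS s) (hb t)).
  by apply: eq_Rintegral => x _; rewrite /F /= -!SD add0r [t + s]addrC.
rewrite (_ : _ \o t_ = fun n => Rintegral P setT (fun x =>
   Rintegral lebT setT (fun s => F (t_ n) (s, x)))); last first.
  by apply/funext => n /=; exact: EF.
rewrite -[0 in X in _ --> X](@Ecst _ _ _ P).
apply: (@E_cvg _ _ _ _ _ _ (M + M)).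
- by move=> n; exact: bmf_E1 (hF _).
- exact: bmf_cst.
- move=> n x; apply: Enorm_le; first exact: bmf_pair2 (hF _).
  by move=> s; rewrite /F normr_id (le_trans (ler_normB _ _))// lerD.
- apply: aeW => x.
  apply: (@line_translation_continuous (fun s => u (S s x))) => //.
  by apply: (bmf_comp hu); exact: (measurableT_comp mS (pair2_measurable x)).
Qed.

End FlowContinuity.

(** * Ergodicity of the time-one map *)

Section Fourier.
Context {R : realType}.

Lemma periodic1_int (g : R -> R) : (forall t, g (t + 1) = g t) ->
  forall (m : int) t, g (t + m%:~R) = g t.
Proof.
move=> hg; have hn (n : nat) t : g (t + n%:R) = g t.
  elim: n => [|n IH]; first by rewrite addr0.
  by rewrite -natr1 addrA hg.
case=> [n|n] t; first exact: hn.
by rewrite NegzE rmorphN /= -[in RHS](subrK (n.+1%:R) t) hn.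
Qed.

Lemma periodic1_frac (g : R -> R) : (forall t, g (t + 1) = g t) ->
  forall t, g (frac t) = g t.
Proof. by move=> hg t; rewrite /frac -rmorphN /= periodic1_int. Qed.

Lemma E_lebT_periodic (g : R -> R) u : bmf g -> (forall t, g (t + 1) = g t) ->
  Rintegral lebT setT (fun t => g (t + u)) = Rintegral lebT setT g.
Proof.
move=> hg hp; rewrite -(E_rot u hg).
by apply: eq_Rintegral => t _; rewrite periodic1_frac.
Qed.

Lemma Ele_unit (f g : R -> R) : bmf f -> bmf g ->
  (forall t, 0 <= t < 1 -> f t <= g t) -> Rintegral lebT setT f <= Rintegral lebT setT g.
Proof.
move=> hf hg fg; rewrite -(E_rot 0 hf) -(E_rot 0 hg).
have hr h : bmf h -> bmf (fun x : R => h (frac (x + 0))).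
  by move=> hh; apply: (bmf_comp hh); exact: measurable_rot.
apply: Ele; [exact: hr|exact: hr|] => t.
by apply: fg; rewrite frac_ge0 frac_lt1.
Qed.

Lemma bmf_cos (c : R) : bmf (fun t : R => cos (c * t)).
Proof.
split; last by exists 1 => t; exact: cos_max.
apply: measurableT_comp; last exact: mulrl_measurable.
by apply: continuous_measurable_fun; exact: continuous_cos.
Qed.

Lemma bmf_sin (c : R) : bmf (fun t : R => sin (c * t)).
Proof.
split; last by exists 1 => t; exact: sin_max.
apply: measurableT_comp; last exact: mulrl_measurable.
by apply: continuous_measurable_fun; exact: continuous_sin.
Qed.

Lemma cos_shift_nat (k : nat) (x : R) : cos (x + 2 * pi * k%:R) = cos x.
Proof.
have -> : 2 * pi * k%:R = pi *+ 2 *+ k :> R by rewrite mulr_natr mulr_natl.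
by rewrite (periodicn (@cosD2pi R)).
Qed.

Lemma sin_shift_nat (k : nat) (x : R) : sin (x + 2 * pi * k%:R) = sin x.
Proof.
have -> : 2 * pi * k%:R = pi *+ 2 *+ k :> R by rewrite mulr_natr mulr_natl.
by rewrite (periodicn (@sinD2pi R)).
Qed.

(* (1 + cos 2 pi t)^n is a trigonometric polynomial concentrating at 0. *)
Lemma cosine_coefficients_zero (rho : R -> R) : bmf rho ->
  (forall t, rho (t + 1) = rho t) -> (forall t, `|rho t| <= rho 0) ->
  (forall eta, 0 < eta -> exists2 delta, 0 < delta &
     forall t, `|t| < delta -> `|rho t - rho 0| <= eta) ->
  (forall k : nat, Rintegral lebT setT (fun t => rho t * cos (2 * pi * k%:R * t)) = 0) ->
  rho 0 <= 0.
Proof.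
move=> hr per bnd cont coef; rewrite leNgt; apply/negP => r0.
pose w (t : R) := 1 + cos (2 * pi * 1%:R * t).
have hw : bmf w by apply: bmfD; [exact: bmf_cst|exact: bmf_cos].
have hwn n : bmf (fun t => w t ^+ n).
  elim: n => [|n IH]; first by under eq_fun do rewrite expr0; exact: bmf_cst.
  by under eq_fun do rewrite exprS; exact: bmfM.
have hk (k : nat) n : bmf (fun t => rho t * cos (2 * pi * k%:R * t) * w t ^+ n).
  by apply: bmfM => //; apply: bmfM => //; exact: bmf_cos.
(* [w ^+ n] expands into cosines by the product formula; k = 0 is treated apart, since the formula
   involves the frequency k - 1. *)
have A n : forall k : nat,
    Rintegral lebT setT (fun t => rho t * cos (2 * pi * k%:R * t) * w t ^+ n) = 0.
  elim: n => [|n IH] k.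
    by under eq_Rintegral do rewrite expr0 mulr1; exact: coef.
  case: k => [|k].
    transitivity (Rintegral lebT setT (fun t =>
       rho t * cos (2 * pi * 0%:R * t) * w t ^+ n + rho t * cos (2 * pi * 1%:R * t) * w t ^+ n)).
      apply: eq_Rintegral => t _.
      by rewrite mulr0 mul0r cos0 exprS {1}/w; ring.
    by rewrite ED// !IH addr0.
  transitivity (Rintegral lebT setT (fun t =>
     rho t * cos (2 * pi * k.+1%:R * t) * w t ^+ n +
     2^-1 * (rho t * cos (2 * pi * k.+2%:R * t) * w t ^+ n +
             rho t * cos (2 * pi * k%:R * t) * w t ^+ n))).
    apply: eq_Rintegral => t _; rewrite exprS {1}/w.
    have -> : 2 * pi * k.+2%:R * t = 2 * pi * k.+1%:R * t + 2 * pi * 1%:R * t.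
      by rewrite -[k.+2%:R]natr1; ring.
    have -> : 2 * pi * k%:R * t = 2 * pi * k.+1%:R * t - 2 * pi * 1%:R * t.
      by rewrite -[k.+1%:R]natr1; ring.
    by rewrite cosD cosB; field.
  have h2 := bmfD (hk k.+2 n) (hk k n).
  rewrite ED//; last by apply: bmfM; [exact: bmf_cst|exact: h2].
  by rewrite (EZl _ _ h2) (ED _ (hk k.+2 n) (hk k n)) !IH addr0 mulr0 addr0.
have [|dl dl0 hd] := cont (rho 0 / 2); first by rewrite divr_gt0.
pose e := Num.min dl 2^-1.
have e0 : 0 < e by rewrite lt_min dl0 /=; lra.
have e12 : e <= 2^-1 by rewrite ge_min lexx orbT.
have edl : e <= dl by rewrite ge_min lexx.
have pi0 := @pi_gt0 R.
(* [a] bounds [w] from above at distance at least e from the integers, and [b] bounds it from below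
   on [0, e / 2). *)
pose a := 1 + cos (2 * pi * e); pose b := 1 + cos (pi * e).
have mono (x y : R) : 0 <= x -> x <= y -> y <= pi -> cos y <= cos x.
  move=> x0 xy yp; have xp := le_trans xy yp; have y0 := le_trans x0 xy.
  move: xy; rewrite le_eqVlt => /predU1P[->//|xy].
  by rewrite ltW// ltr_cos// in_itv /= ?x0 ?y0.
have ab : a < b.
  rewrite ltrD2l ltr_cos; first by nra.
    by rewrite in_itv /=; apply/andP; split; nra.
  by rewrite in_itv /=; apply/andP; split; nra.
have a0 : 0 <= a by have := cos_geN1 (2 * pi * e); rewrite /a; lra.
have b0 : 0 < b by exact: le_lt_trans ab.
have w0 t : 0 <= w t by have := cos_geN1 (2 * pi * 1%:R * t); rewrite /w; lra.
have far (t : R) : e <= t <= 1 - e -> w t <= a.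
  move=> /andP[t1 t2]; rewrite lerD2l mulr1.
  have [th|th] := leP t 2^-1; first by apply: mono; nra.
  rewrite -(cosN (2 * pi * t)) -(cos_shift_nat 1).
  by apply: mono; nra.
have near (t : R) : 0 <= t < e / 2 -> b <= w t.
  by move=> /andP[t1 t2]; rewrite lerD2l mulr1; apply: mono; nra.
have hI : bmf (\1_(`[0, e / 2[%classic) : R -> R).
  by apply: bmf_indic; exact: measurable_itv.
(* The integral of [rho * w ^+ n] is 0, yet [0, e / 2) contributes at least [rho 0 / 2 * b ^+ n]
   times its length and the negative part at most [rho 0 * a ^+ n]. As a < b, this fails for large
   n. *)
have key n : e / 4 * b ^+ n <= a ^+ n.
  have := A n 0%N.
  under eq_Rintegral do rewrite mulr0 mul0r cos0 mulr1.
  move=> EA.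
  have : Rintegral lebT setT (fun t => rho 0 / 2 * b ^+ n * \1_(`[0, e / 2[%classic) t -
      rho 0 * a ^+ n) <= Rintegral lebT setT (fun t => rho t * w t ^+ n).
    apply: Ele_unit.
    - by apply: bmfB; [apply: bmfM => //; exact: bmf_cst|exact: bmf_cst].
    - exact: bmfM.
    move=> t /andP[t0 t1].
    have ra : 0 <= rho 0 * a ^+ n by rewrite mulr_ge0 ?exprn_ge0// ltW.
    have pos : e <= t <= 1 - e \/ rho 0 / 2 <= rho t.
      have [te|et] := ltP t e.
        right; have := hd t; rewrite ger0_norm// => /(_ (lt_le_trans te edl)).
        by rewrite ler_norml => /andP[]; lra.
      have [te|te] := leP t (1 - e); first by left.
      right; have := hd (t - 1); rewrite ler0_norm; last by lra.
      have -> : rho (t - 1) = rho t by rewrite -per subrK.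
      have t1e : - (t - 1) < dl by lra.
      by move=> /(_ t1e); rewrite ler_norml => /andP[]; lra.
    rewrite indicE; have [|tn] := boolP (t \in _).
      rewrite inE /= in_itv /= => tn; have bw := near t tn.
      case: pos => [/andP[? ?]|hp]; first by move: tn => /andP[? ?]; lra.
      rewrite mulr1; have : rho 0 / 2 * b ^+ n <= rho t * w t ^+ n.
        by apply: ler_pM => //; rewrite ?divr_ge0 ?exprn_ge0 ?lerXn2r ?nnegrE// ltW.
      by lra.
    rewrite mulr0 sub0r; case: pos => [hf|hp]; last first.
      have : 0 <= rho t * w t ^+ n by rewrite mulr_ge0 ?exprn_ge0//; lra.
      by lra.
    have : `|rho t * w t ^+ n| <= rho 0 * a ^+ n.
      rewrite normrM ler_pM ?bnd// ger0_norm ?exprn_ge0//.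
      by rewrite lerXn2r ?nnegrE ?far.
    by rewrite ler_norml => /andP[].
  rewrite EA EB; last 2 first.
    by apply: bmfM => //; exact: bmf_cst.
    exact: bmf_cst.
  rewrite EZl// Ecst Eindic; last exact: measurable_itv.
  have -> : fine (lebT `[0, e / 2[%classic) = e / 2.
    rewrite /= /lebesgue_T /mrestr setIidl; last first.
      move=> t /=; rewrite !in_itv /= => /andP[-> te] /=; lra.
    by rewrite lebesgue_measure_itv /= lte_fin divr_gt0//= subr0.
  move=> h; have : rho 0 * (e / 4 * b ^+ n) <= rho 0 * a ^+ n by lra.
  by rewrite ler_pM2l.
have ab1 : `|a / b| < 1 by rewrite ger0_norm ?divr_ge0 ?(ltW b0)// ltr_pdivrMr// mul1r.
have e4 : 0 < e / 4 by rewrite divr_gt0.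
have /cvgrPdist_lt/(_ _ e4)[n _ /(_ n (leqnn n))] := cvg_expr ab1.
rewrite /= sub0r normrN ger0_norm ?exprn_ge0 ?divr_ge0 ?(ltW b0)//.
by rewrite ltNge expr_div_n ler_pdivlMr ?exprn_gt0// key.
Qed.

End Fourier.

Section TimeOne.
Context {R : realType} d (Y : measurableType d) (nu : probability Y R) (S : R -> Y -> Y).
Hypothesis mS : measurable_fun setT (fun p : R * Y => S p.1 p.2).
Hypothesis S0 : forall y, S 0 y = y.
Hypothesis SD : forall s t y, S (s + t) y = S s (S t y).
Hypothesis nuS : forall t A, measurable A -> nu (S t @^-1` A) = nu A.

Lemma measurable_flow_time t : measurable_fun setT (S t).
Proof. exact: (measurableT_comp mS (pair1_measurable t)). Qed.

Lemma measurable_flow_orbit y : measurable_fun setT (fun t => S t y).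
Proof. exact: (measurableT_comp mS (pair2_measurable y)). Qed.

Hypothesis noev : forall k : nat, ~ flow_eigenvalue nu S k%:R.

(* The Fourier coefficients of t |-> 1_A (S t y), for an S 1-invariant set A,
   are eigenfunctions of the flow with integer eigenvalues. *)
Lemma time_one_ergodic A : measurable A -> S 1 @^-1` A = A -> nu A = 0%E \/ nu A = 1%E.
Proof.
move=> mA SA; pose p := fine (nu A); pose f y := \1_A y - p.
have hA := bmf_indic mA (R := R).
have hf : bmf f by apply: bmfB => //; exact: bmf_cst.
have Ef : Rintegral nu setT f = 0.
  by rewrite EB ?Ecst ?Eindic ?subrr//; exact: bmf_cst.
have fper y t : f (S (t + 1) y) = f (S t y).
  rewrite addrC SD /f !indicE; congr ((nat_of_bool _)%:R - _).
  by rewrite -[in RHS]SA; apply/idP/idP => /set_mem h; exact/mem_set.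
have hfS : bmf (fun q : R * Y => f (S q.1 q.2)) by exact: bmf_comp.
have hfSt t : bmf (fun y => f (S t y)).
  by apply: (bmf_comp hf); exact: measurable_flow_time.
have hfSy y : bmf (fun t => f (S t y)).
  by apply: (bmf_comp hf); exact: measurable_flow_orbit.
pose c (k : nat) (t : R) := cos (2 * pi * k%:R * t).
pose s (k : nat) (t : R) := sin (2 * pi * k%:R * t).
have hc k : bmf (c k) by exact: bmf_cos.
have hs k : bmf (s k) by exact: bmf_sin.
have cper k t u : c k (t + 1 - u) = c k (t - u).
  by rewrite /c -(cos_shift_nat k (2 * pi * k%:R * (t - u))); congr cos; ring.
have sper k t u : s k (t + 1 - u) = s k (t - u).
  by rewrite /s -(sin_shift_nat k (2 * pi * k%:R * (t - u))); congr sin; ring.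
have joint (g : R -> R) : bmf g -> bmf (fun q : R * Y => f (S q.1 q.2) * g q.1).
  by move=> hg; apply: bmfM => //; exact: (bmf_comp hg measurable_fst).
pose C k y := Rintegral lebT setT (fun t => f (S t y) * c k t).
pose D k y := Rintegral lebT setT (fun t => f (S t y) * s k t).
have hC k : bmf (C k) by exact: (bmf_E1 lebT nu (joint _ (hc k))).
have hD k : bmf (D k) by exact: (bmf_E1 lebT nu (joint _ (hs k))).
(* Substituting t - u for t on the unit interval is legitimate because both factors have period 1 in
   t; for [f] this is the invariance of A under [S 1]. *)
have shift (g : R -> R) u y : bmf g -> (forall t u, g (t + 1 - u) = g (t - u)) ->
    Rintegral lebT setT (fun t => f (S t (S u y)) * g t) =
    Rintegral lebT setT (fun t => f (S t y) * g (t - u)).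
  move=> hg gper.
  have hG : bmf (fun t => f (S t y) * g (t - u)).
    by apply: bmfM => //; apply: (bmf_comp hg); apply: measurable_funB.
  rewrite -(E_lebT_periodic u hG); last by move=> t; rewrite fper gper.
  by apply: eq_Rintegral => t _; rewrite SD addrK.
have CS k u y : C k (S u y) = cos (2 * pi * k%:R * u) * C k y + sin (2 * pi * k%:R * u) * D k y.
  rewrite {1}/C (shift (c k) u y (hc k) (cper k)).
  rewrite -!EZl; [|by apply: bmfM|by apply: bmfM].
  rewrite -ED; [|by apply: bmfM; [exact: bmf_cst|apply: bmfM]..].
  apply: eq_Rintegral => t _; rewrite /c /s mulrBr cosB; ring.
have DS k u y : D k (S u y) = cos (2 * pi * k%:R * u) * D k y - sin (2 * pi * k%:R * u) * C k y.
  rewrite {1}/D (shift (s k) u y (hs k) (sper k)).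
  rewrite -!EZl; [|by apply: bmfM|by apply: bmfM].
  rewrite -EB; [|by apply: bmfM; [exact: bmf_cst|apply: bmfM]..].
  apply: eq_Rintegral => t _; rewrite /c /s mulrBr sinB; ring.
have EZ (g : R -> R) : bmf g ->
    Rintegral nu setT (fun y => Rintegral lebT setT (fun t => f (S t y) * g t)) = 0.
  move=> hg; rewrite -(E_fubini lebT nu (joint _ hg)).
  rewrite -[RHS](Ecst (@lebT R)); apply: eq_Rintegral => t _ /=.
  by rewrite EZr// (E_comp (measurable_flow_time t) (nuS t) hf) Ef mul0r.
have L20 h : bmf h -> Rintegral nu setT h = 0 -> L2_0 nu h.
  move=> hh Eh; split; first by case: hh.
    exact: (bmf_integrable nu (bmfM hh hh)).
  by rewrite Efin// Eh.
have C0 k : {ae nu, forall y, C k y = 0}.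
  have : {ae nu, forall y, C k y = 0 /\ - D k y = 0}; last by apply: filterS => y [].
  apply: contrapT => hN; apply: (noev (k := k)).
  (* The eigenfunction is the integral of f (S t y) against exp(- 2 pi i k t), hence the sign of the
     sine part. *)
  exists (C k), (fun y => - D k y); split.
  - by apply: L20 => //; exact: EZ.
  - apply: L20; first exact: bmfN.
    under eq_Rintegral do rewrite -mulN1r.
    by rewrite EZl// [X in _ * X]EZ// mulr0.
  - exact: hN.
  - by move=> u; apply: aeW => y; rewrite CS DS; split; ring.
(* The autocorrelation of [f]. Its cosine coefficients are integrals of [C k * f], which vanish, so
   [rho 0], the variance p - p^2 of the indicator of A, cannot be positive. *)
pose rho t := Rintegral nu setT (fun y => f (S t y) * f y).
have hff : bmf (fun q : R * Y => f (S q.1 q.2) * f q.2).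
  by apply: bmfM => //; exact: (bmf_comp hf measurable_snd).
have hrho : bmf rho by exact: (bmf_E2 lebT nu hff).
have rho0E : rho 0 = Rintegral nu setT (fun y => f y * f y).
  by apply: eq_Rintegral => y _; rewrite S0.
have [M M0 hM] := bmf_bound hf.
have : rho 0 <= 0.
  apply: cosine_coefficients_zero => //.
  - by move=> t; apply: eq_Rintegral => y _; rewrite fper.
  - move=> t; rewrite rho0E.
    have hff0 : bmf (fun y => f y * f y) by exact: bmfM.
    have hfft : bmf (fun y => f (S t y) * f (S t y)) by exact: bmfM.
    apply: le_trans (Enorm nu _) _; first exact: bmfM.
    apply: (@le_trans _ _ (Rintegral nu setT (fun y => 2^-1 * (f (S t y) * f (S t y) + f y * f y)))).
      apply: Ele; [by apply: bmf_norm; exact: bmfM|by apply: bmfM; [exact: bmf_cst|exact: bmfD]|].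
      move=> y; move: (f (S t y)) (f y) => u v.
      have := sqr_ge0 (u - v); have := sqr_ge0 (u + v).
      by rewrite ler_norml => h1 h2; apply/andP; split; nra.
    rewrite EZl ?ED//; last exact: bmfD.
    rewrite (E_comp (measurable_flow_time t) (nuS t) hff0); lra.
  - move=> eta eta0; have eM : 0 < eta / M by rewrite divr_gt0.
    have [dl dl0 hd] := flow_continuous mS SD nuS hf eM.
    exists dl => // t /hd; rewrite ler_pdivlMr// => ht; apply: le_trans ht.
    rewrite -EZr; last exact: (bmf_norm (bmfB (hfSt t) (hfSt 0))).
    apply: Enorm_dist; [exact: bmfM|exact: bmfM| |].
      by apply: bmfM; [exact: (bmf_norm (bmfB (hfSt t) (hfSt 0)))|exact: bmf_cst].
    by move=> y; rewrite -mulrBl normrM ler_wpM2l.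
  - move=> k; have hj : bmf (fun q : R * Y => f (S q.1 q.2) * f q.2 * c k q.1).
      by apply: bmfM => //; exact: (bmf_comp (hc k) measurable_fst).
    transitivity (Rintegral lebT setT (fun t => Rintegral nu setT (fun y => f (S t y) * f y * c k t))).
      by apply: eq_Rintegral => t _; rewrite /rho -EZr//; exact: bmfM.
    rewrite (E_fubini lebT nu hj).
    transitivity (Rintegral nu setT (fun y => C k y * f y)).
      apply: eq_Rintegral => y _; rewrite /C -EZr; last exact: bmfM.
      by apply: eq_Rintegral => t _ /=; ring.
    rewrite -[RHS](Ecst nu); apply: E_ae_eq; [exact: bmfM|exact: bmf_cst|].
    by apply: filterS (C0 k) => y ->; rewrite mul0r.
rewrite rho0E.
have -> : Rintegral nu setT (fun y => f y * f y) = p - p ^+ 2.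
  transitivity (Rintegral nu setT (fun y => (1 - 2 * p) * \1_A y + p ^+ 2)).
    apply: eq_Rintegral => y _; rewrite /f indicE; case: (_ \in _) => /=; ring.
  rewrite ED; [|by apply: bmfM => //; exact: bmf_cst|exact: bmf_cst].
  by rewrite (EZl _ _ hA) Ecst Eindic// -/p; ring.
have nuE : nu A = p%:E by rewrite fineK// fin_num_measure.
have p01 : 0 <= p <= 1.
  by rewrite -!lee_fin -nuE measure_ge0 probability_le1.
move: p01 => /andP[p0 p1] h.
have /eqP : p * (1 - p) = 0 by nra.
rewrite mulf_eq0 => /orP[/eqP pz|/eqP pz]; [left|right]; rewrite nuE; first by rewrite pz.
by congr (_%:E); lra.
Qed.

End TimeOne.

(** * Stability under translations of the base *)

Lemma measurable_preimage d d' (T : measurableType d) (U : measurableType d')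
    (h : T -> U) A : measurable_fun setT h -> measurable A -> measurable (h @^-1` A).
Proof. by move=> mh mA; rewrite -[X in measurable X]setTI; exact: mh. Qed.

Section Uniqueness.
Context {R : realType} d1 d2 (T1 : measurableType d1) (T2 : measurableType d2).

Lemma measure_eq_rectangles (m1 m2 : {measure set (T1 * T2) -> \bar R}) :
  (m1 setT < +oo)%E ->
  (forall A B, measurable A -> measurable B -> m1 (A `*` B) = m2 (A `*` B)) ->
  forall X, measurable X -> m1 X = m2 X.
Proof.
move=> fin h X mX.
pose C : set (set (T1 * T2)) :=
  [set C | exists A, measurable A /\ exists B, measurable B /\ C = A `*` B].
apply: (measure_unique C (fun=> setT)) => //.
- rewrite measurable_prod_measurableType //; congr (<<s _ >>).
  rewrite predeqE; split => [[A mA [B mB <-]]|[A [mA [B [mB ->]]]]].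
    by exists A; split => //; exists B.
  by exists A => //; exists B.
- move=> /= _ _ [X1 [mX1 [X2 [mX2 ->]]]] [Y1 [mY1 [Y2 [mY2 ->]]]].
  rewrite -setXI; exists (X1 `&` Y1); split; first exact: measurableI.
  by exists (X2 `&` Y2); split => //; exact: measurableI.
- by move=> _; exists setT; split => //; exists setT; split => //; rewrite setXTT.
- by rewrite bigcup_const//; exists 0%N.
- by move=> _ [A [mA [B [mB ->]]]]; exact: h.
Qed.

End Uniqueness.

Section Pushforward.
Context {R : realType} d d' (T : measurableType d) (U : measurableType d').

Lemma pushforward_measure_exists (m : {measure set T -> \bar R}) (h : T -> U) :
  measurable_fun setT h ->
  exists m' : {measure set U -> \bar R}, forall A, m' A = m (h @^-1` A).
Proof.
move=> mh.
pose pf : {measure set U -> \bar R} := pushforward m h.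
by exists (pf mh).
Qed.

Lemma pushforward_probability_exists (P : probability T R) (h : T -> U) :
  measurable_fun setT h ->
  exists Q : probability U R, forall A, Q A = P (h @^-1` A).
Proof.
move=> mh; pose X : {mfun T >-> U} := HB.pack h (isMeasurableFun.Build _ _ _ _ h mh).
by exists (distribution P X).
Qed.

End Pushforward.

Section Grid.
Context {R : realType} d (T : measurableType d).

Lemma floor_grid (C eta x : R) : 0 < eta -> `|x| <= C ->
  exists2 k : 'I_(Num.truncn (2 * C / eta)).+1,
    Num.floor ((x + C) / eta) = (k : nat)%:Z & `|x - (k%:R * eta - C)| <= eta.
Proof.
move=> e0; rewrite ler_norml => /andP[x1 x2].
set a := (x + C) / eta; have a0 : 0 <= a by apply: divr_ge0; [lra|exact: ltW].
have fa : (`|Num.floor a|%N)%:Z = Num.floor a by rewrite gez0_abs// floor_ge0.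
have ka : (`|Num.floor a| < (Num.truncn (2 * C / eta)).+1)%N.
  rewrite -ltz_nat fa floor_lt_int.
  apply: le_lt_trans (truncnS_gt _); rewrite ler_pM2r ?invr_gt0//; lra.
exists (Ordinal ka) => //=.
have -> : (`|Num.floor a|%N)%:R = (Num.floor a)%:~R :> R by rewrite -{2}fa.
have := floor_itv a; rewrite intrD => /andP[f1 f2].
have xE : x = a * eta - C by rewrite /a divfK ?gt_eqF// addrK.
rewrite {1}xE opprB addrA subrK -mulrBl normrM (gtr0_norm e0) ler_piMl ?(ltW e0)//.
by rewrite ger0_norm; lra.
Qed.

Definition cell (f : T -> R) (C eta : R) (k : nat) : set T :=
  [set x | Num.floor ((f x + C) / eta) = k%:Z].

Lemma measurable_cell f C eta k : measurable_fun setT f -> measurable (cell f C eta k).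
Proof.
move=> mf.
have mg : measurable_fun setT (fun x => (f x + C) / eta).
  by apply: measurable_funM => //; apply: measurable_funD.
rewrite (_ : cell f C eta k = setT `&` (fun x => (f x + C) / eta) @^-1` `[k%:R, k.+1%:R[).
  exact: mg.
rewrite setTI; apply/seteqP; split => x /=; rewrite in_itv /=.
  by move=> h; have := floor_itv ((f x + C) / eta); rewrite h intrD -natr1.
by move=> h; apply: floor_def; rewrite intrD; move: h; rewrite -natr1.
Qed.

(** Exactly one cell contains x, so a sum weighted by the cell indicators selects one value of
    [h]. *)
Lemma sum_cell (f : T -> R) C eta (h : nat -> R) x : 0 < eta -> `|f x| <= C ->
  exists2 k0 : 'I_(Num.truncn (2 * C / eta)).+1, cell f C eta k0 x /\ `|f x - (k0%:R * eta - C)| <= eta &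
  \sum_(k < (Num.truncn (2 * C / eta)).+1) \1_(cell f C eta k) x * h k = h k0.
Proof.
move=> e0 fC; have [k0 hk0 close] := floor_grid e0 fC; exists k0 => //.
rewrite (bigD1 k0)//= indicE mem_set// mul1r big1 ?addr0// => k kk0.
rewrite indicE memNset ?mul0r// /cell /= hk0 => -[e].
by move: kk0; rewrite -val_eqE /= e eqxx.
Qed.

Lemma bmf_simple (f : T -> R) eta : bmf f -> 0 < eta ->
  exists n (A : nat -> set T) (h : nat -> R), (forall k, measurable (A k)) /\
    forall x, `|f x - \sum_(k < n) \1_(A k) x * h k| <= eta.
Proof.
move=> hf e0; have [C C0 hC] := bmf_bound hf.
exists (Num.truncn (2 * C / eta)).+1, (cell f C eta), (fun k => k%:R * eta - C); split.
  by move=> k; apply: measurable_cell; case: hf.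
by move=> x; have [k0 [_ h1] ->] := sum_cell (fun k => k%:R * eta - C) e0 (hC x).
Qed.

End Grid.

(** * Conditional densities over a factor *)

Section ConditionalExpectation.
Context {R : realType} d d' (T : measurableType d) (U : measurableType d').
Context (P : probability T R) (Q : probability U R) (b : T -> U).
Hypothesis mb : measurable_fun setT b.
Hypothesis PQ : forall A, measurable A -> P (b @^-1` A) = Q A.

(** The measure B |-> P (b in B, and W) lies below [Q], so its Radon-Nikodym density is at most 1
    almost everywhere; cutting it at 1 makes it bounded everywhere without changing integrals. *)
Lemma conditional_density (W : set T) : measurable W ->
  exists2 u : U -> R, bmf u & forall B, measurable B ->
    fine (P (b @^-1` B `&` W)) = Rintegral Q setT (fun x => \1_B x * u x).
Proof.
move=> mW.
have [m mE] := pushforward_measure_exists (mrestr P mW) mb.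
have mEW A : m A = P (b @^-1` A `&` W) by rewrite mE.
have mPb A : measurable A -> measurable (b @^-1` A `&` W).
  by move=> mA; apply: measurableI => //; exact: measurable_preimage.
have mle A : measurable A -> (m A <= Q A)%E.
  move=> mA; rewrite mEW -PQ//; apply: le_measure; rewrite ?inE//.
  - exact: mPb.
  - exact: measurable_preimage.
have fm : fin_num_fun m.
  by move=> A mA; rewrite mEW fin_num_measure//; exact: mPb.
have mTy : (m setT < +oo)%E by rewrite ltey_eq fm.
pose m_fin : {finite_measure set U -> \bar R} := mfrestr measurableT mTy.
have m_finE A : m_fin A = m A by rewrite /m_fin /= /mfrestr /mrestr setIT.
have dom : m_fin `<< Q.
  apply/null_content_dominatesP => A mA QA0.
  by apply/eqP; rewrite eq_le measure_ge0 andbT -QA0 m_finE; exact: mle.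
have [f [f0 ffin fint fE]] := radon_nikodym_sigma_finite dom.
pose u0 x := fine (f x).
have u0E x : (u0 x)%:E = f x by rewrite fineK.
have u00 x : 0 <= u0 x by rewrite fine_ge0.
have mu0 : measurable_fun setT u0.
  by apply: measurableT_comp => //; case/integrableP : fint.
have ae1 : {ae Q, forall x, u0 x <= 1}.
  have aen n : {ae Q, forall x, u0 x <= 1 + n.+1%:R^-1}.
    have n0 : 0 < n.+1%:R^-1 :> R by rewrite invr_gt0.
    pose B := [set x | 1 + n.+1%:R^-1 < u0 x].
    have mB : measurable B by exact: measurable_gt_set.
    have h1 : ((1 + n.+1%:R^-1)%:E * Q B <= Q B)%E.
      apply: le_trans (mle B mB).
      rewrite -(integral_cst Q mB) -m_finE [leRHS]fE//.
      apply: ge0_le_integral => //.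
      - by move=> x _ /=; rewrite lee_fin addr_ge0//; exact: ltW.
      - by apply: measurable_funTS; case/integrableP : fint.
      - by move=> x Bx; rewrite -u0E lee_fin ltW.
    exists B; split => //.
      have QB : Q B = (fine (Q B))%:E by rewrite fineK// fin_num_measure.
      move: h1; rewrite QB -EFinM lee_fin => h1.
      have q0 : 0 <= fine (Q B) by rewrite fine_ge0.
      have q1 : fine (Q B) = 0.
        apply/eqP; rewrite eq_le q0 andbT leNgt; apply/negP => q1.
        by move: h1; rewrite mulrDl mul1r gerDl leNgt mulr_gt0.
      by rewrite q1.
    by move=> x /= /negP; rewrite -ltNge.
  apply: filterS (ae_foralln aen) => x hx.
  rewrite leNgt; apply/negP => h.
  have h' : 0 < u0 x - 1 by rewrite subr_gt0.
  have := hx (Num.truncn (u0 x - 1)^-1).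
  rewrite leNgt => /negP; apply.
  rewrite -ltrBrDl -[ltRHS]invrK ltf_pV2 ?posrE ?ltr0n ?invr_gt0//.
  by rewrite truncnS_gt.
pose u x := Num.min (u0 x) 1.
have mu : measurable_fun setT u by exact: measurable_minr.
exists u.
  split => //; exists 1 => x; rewrite ger0_norm ?ge_min ?lexx ?orbT//.
  by rewrite le_min u00 ler01.
move=> B mB; rewrite -mEW -m_finE fE//.
rewrite -[RHS](@eq_Rintegral _ _ _ Q setT (fun x => \1_B x * u x) (u \_ B)); last first.
  move=> x _; rewrite /restrict indicE; case: (_ \in _); first by rewrite mul1r.
  by rewrite mul0r.
rewrite -Rintegral_mkcond /Rintegral; congr fine.
apply: ae_eq_integral => //.
- by apply: measurable_funTS; case/integrableP : fint.
- by apply: measurable_funTS; apply/measurable_EFinP.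
- by apply: filterS ae1 => x hx _; rewrite -u0E /u min_l.
Qed.

Lemma E_conditional (W : set T) (u : U -> R) (c : U -> R) : measurable W -> bmf u -> bmf c ->
  (forall B, measurable B -> fine (P (b @^-1` B `&` W)) = Rintegral Q setT (fun x => \1_B x * u x)) ->
  Rintegral P setT (fun z => c (b z) * \1_W z) = Rintegral Q setT (fun x => c x * u x).
Proof.
move=> mW hu hc hB; have [M M0 hM] := bmf_bound hu.
have hW := bmf_indic mW (R := R).
have hcb : bmf (fun z => c (b z)) by exact: bmf_comp.
apply/eqP; rewrite -subr_eq0 -normr_le0; apply/ler_addgt0Pr => e e0; rewrite add0r.
(* The simple approximation of [c] is used twice, against the indicator of [W], bounded by 1, and
   against [u], bounded by [M]. *)
have eM : 0 < e / (1 + M) by rewrite divr_gt0//; lra.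
have [n [A [h [mA hA]]]] := bmf_simple hc eM.
pose g x := \sum_(k < n) \1_(A k) x * h k.
have hAk k : bmf (\1_(A k) : U -> R) by exact: bmf_indic.
have hAh k : bmf (fun x => \1_(A k) x * h k) by apply: bmfM => //; exact: bmf_cst.
have hg : bmf g by apply: bmf_sum => k.
have hgb : bmf (fun z => g (b z)) by exact: bmf_comp.
have gE : Rintegral P setT (fun z => g (b z) * \1_W z) = Rintegral Q setT (fun x => g x * u x).
  transitivity (\sum_(k < n) Rintegral P setT (fun z => \1_(b @^-1` A k `&` W) z * h k)).
    rewrite -Esum; last first.
      move=> k; apply: bmfM; last exact: bmf_cst.
      by apply: bmf_indic; apply: measurableI => //; exact: measurable_preimage.
    apply: eq_Rintegral => z _; rewrite /g mulr_suml; apply: eq_bigr => k _.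
    by rewrite indicI /= mulrAC; congr (_ * _ * _); rewrite !indicE.
  transitivity (\sum_(k < n) Rintegral Q setT (fun x => \1_(A k) x * u x * h k)); last first.
    rewrite -Esum; last by move=> k; apply: bmfM; [apply: bmfM|exact: bmf_cst].
    by apply: eq_Rintegral => x _; rewrite /g mulr_suml; apply: eq_bigr => k _; rewrite mulrAC.
  apply: eq_bigr => k _.
  have mAW : measurable (b @^-1` A k `&` W).
    by apply: measurableI => //; exact: measurable_preimage.
  rewrite EZr; last exact: bmf_indic.
  by rewrite Eindic// hB// EZr//; exact: bmfM.
apply: (@le_trans _ _ (e / (1 + M) + e / (1 + M) * M)); last first.
  by rewrite -[X in X + _]mulr1 -mulrDr divfK// gt_eqF//; lra.
rewrite -(subrK (Rintegral P setT (fun z => g (b z) * \1_W z)) (Rintegral P setT (fun z => c (b z) * \1_W z))).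
rewrite [X in _ + X - _]gE -addrA; apply: le_trans (ler_normD _ _) _; apply: lerD.
  rewrite -EB; [|exact: bmfM|exact: bmfM].
  apply: Enorm_le; first by apply: bmfB; exact: bmfM.
  move=> z; rewrite -mulrBl normrM; apply: le_trans (hA (b z)).
  rewrite ler_piMr// indicE; case: (_ \in _); by rewrite ?normr1 ?normr0.
rewrite -EB; [|exact: bmfM|exact: bmfM].
apply: Enorm_le; first by apply: bmfB; exact: bmfM.
by move=> x; rewrite -mulrBl normrM distrC ler_pM.
Qed.

End ConditionalExpectation.

Section TranslationStability.
Context {R : realType} d d' (T : measurableType d) (U : measurableType d').
Context (P : probability T R) (Q : probability U R) (b : T -> U).
Hypothesis mb : measurable_fun setT b.
Hypothesis PQ : forall A, measurable A -> P (b @^-1` A) = Q A.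
Context (tau : R -> U -> U).
Hypothesis mtau : measurable_fun setT (fun p : R * U => tau p.1 p.2).
Hypothesis tauD : forall s t x, tau (s + t) x = tau s (tau t x).
Hypothesis Qtau : forall t A, measurable A -> Q (tau t @^-1` A) = Q A.

Let mtau_t t : measurable_fun setT (tau t).
Proof. exact: (measurableT_comp mtau (pair1_measurable t)). Qed.

Let E_tau t (f : U -> R) : bmf f ->
  Rintegral Q setT (fun x => f (tau t x)) = Rintegral Q setT f.
Proof. by move=> hf; apply: E_comp => //; exact: Qtau. Qed.

(** Invariance of [Q] moves the translation from [c] to the conditional density of [W], where
    L1-continuity applies; therefore [delta] depends on [W] only and not on [c]. *)
Lemma translation_stable_set (W : set T) : measurable W -> forall eta, 0 < eta ->
  exists2 delta, 0 < delta & forall t (c : U -> R), `|t| < delta -> bmf c ->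
    (forall x, `|c x| <= 1) ->
    `|Rintegral P setT (fun z => c (tau t (b z)) * \1_W z) -
      Rintegral P setT (fun z => c (b z) * \1_W z)| <= eta.
Proof.
move=> mW eta eta0; have [u hu uE] := conditional_density mb PQ mW.
have [dl dl0 hd] := flow_continuous mtau tauD Qtau hu eta0.
exists dl => // t c tdl hc c1.
have hct s : bmf (fun x => c (tau s x)) by exact: bmf_comp.
have hut s : bmf (fun x => u (tau s x)) by exact: bmf_comp.
rewrite (E_conditional mb mW hu (hct t) uE) (E_conditional mb mW hu hc uE).
(* The second integral is translated by 0 so that [c] is composed with [tau 0] on both sides;
   [tau 0] may differ from the identity. *)
rewrite -(E_tau (- t) (bmfM (hct t) hu)) -(E_tau 0 (bmfM hc hu)).
have tN : `|- t| < dl by rewrite normrN.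
apply: le_trans (hd _ tN); apply: Enorm_dist.
- apply: (bmf_comp (bmfM (hct t) hu)); exact: mtau_t.
- apply: (bmf_comp (bmfM hc hu)); exact: mtau_t.
- exact: bmf_norm (bmfB (hut _) (hut _)).
- by move=> x; rewrite -tauD subrr -mulrBr normrM ler_piMl.
Qed.

Lemma translation_stable (w : T -> R) : bmf w -> forall eta, 0 < eta ->
  exists2 delta, 0 < delta & forall t (c : U -> R), `|t| < delta -> bmf c ->
    (forall x, `|c x| <= 1) ->
    `|Rintegral P setT (fun z => c (tau t (b z)) * w z) -
      Rintegral P setT (fun z => c (b z) * w z)| <= eta.
Proof.
move=> hw eta eta0; have e3 : 0 < eta / 3 by rewrite divr_gt0.
have [n [A [h [mA hA]]]] := bmf_simple hw e3.
pose B := 1 + \sum_(k < n) `|h k|.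
have B0 : 0 < B by rewrite /B ltr_wpDr// sumr_ge0.
have eB : 0 < eta / 3 / B by rewrite divr_gt0.
have /choice[dl hdl] : forall k, exists delta, 0 < delta /\
    forall t (c : U -> R), `|t| < delta -> bmf c -> (forall x, `|c x| <= 1) ->
    `|Rintegral P setT (fun z => c (tau t (b z)) * \1_(A k) z) -
      Rintegral P setT (fun z => c (b z) * \1_(A k) z)| <= eta / 3 / B.
  by move=> k; have [x x0 hx] := translation_stable_set (mA k) eB; exists x.
have [D D0 hD] : exists2 D, 0 < D & forall k, (k < n)%N -> D <= dl k.
  elim: (n) => [|m [D D0 hD]]; first by exists 1.
  exists (Num.min D (dl m)); first by rewrite lt_min D0; case: (hdl m).
  move=> k; rewrite ltnS leq_eqVlt => /predU1P[->|km]; first by rewrite ge_min lexx orbT.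
  by rewrite ge_min hD.
exists D => // t c tD hc c1.
pose g z := \sum_(k < n) \1_(A k) z * h k.
have hAk k : bmf (\1_(A k) : T -> R) by exact: bmf_indic.
have hg : bmf g by apply: bmf_sum => k; apply: bmfM => //; exact: bmf_cst.
have hcb : bmf (fun z => c (b z)) by exact: bmf_comp.
have hctb : bmf (fun z => c (tau t (b z))).
  by apply: (bmf_comp hc); exact: (measurableT_comp (mtau_t t) mb).
have near (f : T -> R) : bmf f -> (forall z, `|f z| <= 1) ->
    `|Rintegral P setT (fun z => f z * w z) - Rintegral P setT (fun z => f z * g z)| <= eta / 3.
  move=> hf f1; rewrite -EB; [|exact: bmfM|exact: bmfM].
  apply: Enorm_le; first by apply: bmfB; exact: bmfM.
  by move=> z; rewrite -mulrBr normrM; apply: le_trans (hA z); rewrite ler_piMl.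
have sumE (f : T -> R) : bmf f -> Rintegral P setT (fun z => f z * g z) =
    \sum_(k < n) Rintegral P setT (fun z => f z * \1_(A k) z) * h k.
  move=> hf; transitivity (\sum_(k < n) Rintegral P setT (fun z => f z * \1_(A k) z * h k)).
    rewrite -Esum; last by move=> k; apply: bmfM; [exact: bmfM|exact: bmf_cst].
    by apply: eq_Rintegral => z _; rewrite /g mulr_sumr; apply: eq_bigr => k _; rewrite mulrA.
  by apply: eq_bigr => k _; rewrite EZr//; exact: bmfM.
have mid : `|Rintegral P setT (fun z => c (tau t (b z)) * g z) -
    Rintegral P setT (fun z => c (b z) * g z)| <= eta / 3.
  rewrite !sumE// -sumrB; apply: le_trans (ler_norm_sum _ _ _) _.
  apply: (@le_trans _ _ (\sum_(k < n) eta / 3 / B * `|h k|)).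
    apply: ler_sum => k _; rewrite -mulrBl normrM ler_wpM2r//.
    have [_ hk] := hdl k; apply: hk => //; apply: lt_le_trans tD _; exact: hD.
  rewrite -mulr_sumr -[leRHS]mulr1 -mulrA; apply: ler_wpM2l; first exact: ltW.
  by rewrite mulrC ler_pdivrMr// mul1r /B; lra.
have n1 := near _ hctb (fun z => c1 _).
have n2 := near _ hcb (fun z => c1 _).
move: n1 n2 mid; rewrite !ler_norml => /andP[? ?] /andP[? ?] /andP[? ?].
by apply/andP; split; lra.
Qed.

End TranslationStability.

(** * Essential values of the cocycle *)

Lemma prod_norm_le1 {R : realType} (x y : R) : `|x| <= 1 -> `|y| <= 1 -> `|x * y| <= 1.
Proof. by move=> hx hy; rewrite normrM -[leRHS]mulr1 ler_pM. Qed.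

Lemma prod_dist_le {R : realType} (x y x' y' : R) : `|y| <= 1 -> `|x'| <= 1 ->
  `|x * y - x' * y'| <= `|x - x'| + `|y - y'|.
Proof.
move=> hy hx'; rewrite (_ : _ - _ = (x - x') * y + x' * (y - y')); last by ring.
by rewrite (le_trans (ler_normD _ _))// !normrM lerD ?ler_piMr ?ler_piMl.
Qed.

Lemma quadrangle_dist {R : realType} (x1 x2 x3 y1 y2 eta c c' : R) :
  `|x1 - y1| <= eta -> `|x2 - y2| <= eta -> `|x3 - x2| <= eta -> `|x1 - x3| <= eta ->
  4 * eta = c -> c <= c' -> `|y1 - y2| <= c'.
Proof.
rewrite !ler_norml => /andP[? ?] /andP[? ?] /andP[? ?] /andP[? ?] ? ?.
by apply/andP; split; lra.
Qed.

Lemma lebT_overflow {R : realType} (t : R) : 0 <= t ->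
  fine (lebT [set x : R | 0 <= x < 1 /\ 1 <= x + t]) <= t.
Proof.
move=> t0; rewrite -lee_fin.
set A := [set x | _].
have mA : measurable A.
  have -> : A = `[0, 1[%classic `&` `[1 - t, +oo[%classic.
    by apply/seteqP; split=> x; rewrite /A /= !in_itv/= andbT lerBlDr.
  by apply: measurableI; exact: measurable_itv.
rewrite fineK ?fin_num_measure//.
apply: (@le_trans _ _ (@lebesgue_measure R `[1 - t, 1]%classic)).
  rewrite /lebT/= /lebesgue_T /mrestr; apply: le_measure; rewrite ?inE.
  - exact: (measurableI _ _ mA measurable_unit_itv).
  - exact: measurable_itv.
  - move=> x [[_ xt]]; rewrite /= !in_itv/= => /andP[_ /ltW ->].
    by rewrite lerBlDr xt.
rewrite lebesgue_measure_itv/= lte_fin; case: ifP => _; last by rewrite lee_fin.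
by rewrite lee_fin; lra.
Qed.

(** Translation differs from rotation only where x + t leaves the unit interval, on a set of measure
    at most t, and there by at most 2. A negative t is reduced to a positive one by replacing [g]
    with its translate. *)
Lemma E_unit_translation {R : realType} (g : R -> R) : bmf g -> (forall x, `|g x| <= 1) ->
  forall t, `|Rintegral lebT setT (fun x => g (x + t)) - Rintegral lebT setT g| <= 2 * `|t|.
Proof.
move=> hg g1 t; wlog t0 : g hg g1 t / 0 <= t.
  move=> hw; have [/hw|t0] := leP 0 t; first exact.
  have hgt : bmf (fun x : R => g (x + t)) by apply: bmf_comp => //; exact: measurable_funD.
  have := hw (fun x : R => g (x + t)) hgt (fun x => g1 _) (- t).
  rewrite oppr_ge0 ltW// normrN distrC => /(_ isT).
  by have -> : (fun x => g (x - t + t)) = g by apply/funext => x; rewrite subrK.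
pose A := [set x : R | 0 <= x < 1 /\ 1 <= x + t].
have mA : measurable A.
  have -> : A = `[0, 1[%classic `&` `[1 - t, +oo[%classic.
    by apply/seteqP; split=> x; rewrite /A /= !in_itv/= andbT lerBlDr.
  by apply: measurableI; exact: measurable_itv.
rewrite -(E_rot t hg); have -> : `|t| = t by rewrite ger0_norm.
have hA : bmf (\1_A : R -> R) by exact: bmf_indic.
apply: le_trans (_ : 2 * Rintegral lebT setT (\1_A : R -> R) <= _); last first.
  by rewrite ler_pM2l// Eindic// lebT_overflow.
rewrite -EZl//.
have hgt : bmf (fun x : R => g (x + t)) by apply: bmf_comp => //; exact: measurable_funD.
have hgr : bmf (fun x : R => g (frac (x + t))) by apply: bmf_comp => //; exact: measurable_rot.
rewrite -(EB _ hgt hgr); apply: le_trans (Enorm _ (bmfB hgt hgr)) _.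
have h2A : bmf (fun x : R => 2 * (\1_A x : R)) by apply: bmfM => //; exact: bmf_cst.
apply: (Ele_unit (bmf_norm (bmfB hgt hgr)) h2A) => x /andP[x0 x1].
rewrite indicE; have [xA|xA] := boolP (x \in A).
  rewrite mulr1; apply: le_trans (ler_normB _ _) _.
  have := g1 (x + t); have := g1 (frac (x + t)); lra.
rewrite mulr0 frac_id ?subrr ?normr0//.
rewrite addr_ge0//= ltNge; apply/negP => xt; move/negP: xA; apply.
by rewrite inE /A /=; split => //; rewrite x0.
Qed.

Lemma half_dist {R : realType} (x y z eta : R) :
  `|x - z| <= eta / 2 -> `|y - z| <= eta / 2 -> `|x - y| <= eta.
Proof. by rewrite !ler_norml => /andP[? ?] /andP[? ?]; apply/andP; split; lra. Qed.

Section EssentialShift.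
Context {R : realType} dT dU dY (T : measurableType dT) (U : measurableType dU)
  (Y : measurableType dY).
Context (P : probability T R) (Q : probability U R) (nu : probability Y R).
Context (b : T -> U) (y1 y2 : T -> Y) (tau : R -> U -> U) (S : R -> Y -> Y) (V : T -> T).
Context (a0 : R) (psi1 psi2 : nat -> U -> R).
Hypothesis mb : measurable_fun setT b.
Hypothesis PQ : forall A, measurable A -> P (b @^-1` A) = Q A.
Hypothesis my1 : measurable_fun setT y1.
Hypothesis my2 : measurable_fun setT y2.
Hypothesis Py1 : forall A, measurable A -> P (y1 @^-1` A) = nu A.
Hypothesis Py2 : forall A, measurable A -> P (y2 @^-1` A) = nu A.
Hypothesis mtau : measurable_fun setT (fun p : R * U => tau p.1 p.2).
Hypothesis tauD : forall s t x, tau (s + t) x = tau s (tau t x).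
Hypothesis Qtau : forall t A, measurable A -> Q (tau t @^-1` A) = Q A.
Hypothesis mS : measurable_fun setT (fun p : R * Y => S p.1 p.2).
Hypothesis S0 : forall y, S 0 y = y.
Hypothesis SD : forall s t y, S (s + t) y = S s (S t y).
Hypothesis nuS : forall t A, measurable A -> nu (S t @^-1` A) = nu A.

Let mtau_t t : measurable_fun setT (tau t).
Proof. exact: (measurableT_comp mtau (pair1_measurable t)). Qed.

Let E_tau t (f : U -> R) : bmf f ->
  Rintegral Q setT (fun x => f (tau t x)) = Rintegral Q setT f.
Proof. by move=> hf; apply: E_comp => //; exact: Qtau. Qed.

Let E_b (f : U -> R) : bmf f ->
  Rintegral P setT (fun z => f (b z)) = Rintegral Q setT f.
Proof. by move=> hf; apply: E_comp. Qed.

Let mS_t t : measurable_fun setT (S t).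
Proof. exact: (measurable_flow_time mS). Qed.

Lemma bmf_flow (f : Y -> R) (y : T -> Y) (psi : T -> R) : bmf f -> measurable_fun setT y ->
  measurable_fun setT psi -> bmf (fun z => f (S (psi z) (y z))).
Proof.
move=> hf my mpsi; apply: (bmf_comp hf).
apply: (measurableT_comp mS (g := fun z => (psi z, y z))).
exact/measurable_fun_pairP.
Qed.

(** Lipschitz along orbits only: this controls the replacement of a flow time by a nearby grid
    point. *)
Definition flow_lipschitz (L : R) (w : Y -> R) :=
  [/\ bmf w, forall y, `|w y| <= 1 & forall t y, `|w (S t y) - w y| <= L * `|t|].

Lemma flow_lipschitz_dist L w s t y : flow_lipschitz L w ->
  `|w (S s y) - w (S t y)| <= L * `|s - t|.
Proof. by case=> _ _ /(_ (s - t) (S t y)); rewrite -SD subrK. Qed.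

(* p1 and p2 take values in [-C, C], so on a grid of step h only finitely many
   functions of (y1, y2) occur, each handled by [translation_stable]. *)
Lemma grid_stable (L C : R) w1 w2 : 0 <= L -> 0 < C ->
  flow_lipschitz L w1 -> flow_lipschitz L w2 -> forall eta, 0 < eta ->
  exists2 delta, 0 < delta & forall t (e p1 p2 : U -> R), `|t| < delta ->
    bmf e -> (forall x, `|e x| <= 1) ->
    measurable_fun setT p1 -> measurable_fun setT p2 ->
    (forall x, `|p1 x| <= C) -> (forall x, `|p2 x| <= C) ->
    `|Rintegral P setT (fun z => e (tau t (b z)) *
        (w1 (S (p1 (tau t (b z))) (y1 z)) * w2 (S (p2 (tau t (b z))) (y2 z)))) -
      Rintegral P setT (fun z => e (b z) *
        (w1 (S (p1 (b z)) (y1 z)) * w2 (S (p2 (b z)) (y2 z))))| <= eta.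
Proof.
move=> L0 C0 lw1 lw2 eta eta0; have [hw1 w11 _] := lw1; have [hw2 w21 _] := lw2.
(* The two Lipschitz errors amount to 2 L h <= eta / 3; the [+ 1] covers L = 0. *)
pose h := eta / 3 / (2 * L + 1).
have L1 : 0 < 2 * L + 1 by lra.
have h0 : 0 < h by rewrite divr_gt0//; lra.
have hL : L * h + L * h <= eta / 3.
  have : h * (2 * L + 1) = eta / 3 by rewrite /h divfK// gt_eqF.
  by lra.
pose n := (Num.truncn (2 * C / h)).+1.
pose g (k : nat) : R := k%:R * h - C.
pose W (k l : nat) z := w1 (S (g k) (y1 z)) * w2 (S (g l) (y2 z)).
have hW k l : bmf (W k l) by apply: bmfM; exact: bmf_flow.
have nn : 0 < n%:R ^+ 2 :> R by rewrite exprn_gt0// ltr0n.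
have e1 : 0 < eta / 3 / n%:R ^+ 2 by rewrite divr_gt0//; lra.
have [eta1 eta1E] : exists x, x = eta / 3 / n%:R ^+ 2 by eexists.
rewrite -eta1E in e1.
have st k l := translation_stable mb PQ mtau tauD Qtau (hW k l) e1.
have /choice[dl hdl] : forall k, exists delta, 0 < delta /\ forall l t (c : U -> R),
    (l < n)%N -> `|t| < delta -> bmf c -> (forall x, `|c x| <= 1) ->
    `|Rintegral P setT (fun z => c (tau t (b z)) * W k l z) -
      Rintegral P setT (fun z => c (b z) * W k l z)| <= eta1.
  move=> k; elim: (n) => [|m [D [D0 hD]]]; first by exists 1.
  have [D' D'0 hD'] := st k m; exists (Num.min D D'); split; first by rewrite lt_min D0.
  move=> l t c; rewrite ltnS leq_eqVlt lt_min => /predU1P[->|lm] /andP[t1 t2]; first exact: hD'.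
  exact: hD.
have [D D0 hD] : exists2 D, 0 < D & forall k, (k < n)%N -> D <= dl k.
  elim: (n) => [|m [D D0 hD]]; first by exists 1.
  exists (Num.min D (dl m)); first by rewrite lt_min D0; case: (hdl m).
  move=> k; rewrite ltnS leq_eqVlt => /predU1P[->|km]; first by rewrite ge_min lexx orbT.
  by rewrite ge_min hD.
exists D => // t e p1 p2 tD he e1' mp1 mp2 p1C p2C.
(* Cutting [e] along the cells of [p1] and [p2] leaves a fixed fibre weight [W k l] in each piece.
   The pieces depend on [e], [p1] and [p2], which is why [translation_stable] must be uniform in
   [c]. *)
pose c k l x := e x * \1_(cell p1 C h k) x * \1_(cell p2 C h l) x.
have hI (p : U -> R) k : measurable_fun setT p -> bmf (\1_(cell p C h k) : U -> R).
  by move=> mp; apply: bmf_indic; exact: measurable_cell.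
have hc k l : bmf (c k l) by apply: bmfM; [apply: bmfM|] => //; exact: hI.
have I1 (A : set U) x : `|\1_A x : R| <= 1.
  by rewrite indicE; case: (_ \in _); rewrite ?normr1 ?normr0.
have c1 k l x : `|c k l x| <= 1 by do 2 (apply: prod_norm_le1 => //).
pose F (f : T -> U) z := e (f z) *
  (w1 (S (p1 (f z)) (y1 z)) * w2 (S (p2 (f z)) (y2 z))).
pose G (f : T -> U) z := \sum_(k < n) \sum_(l < n) c k l (f z) * W k l z.
have hcf (f : T -> U) k l : measurable_fun setT f -> bmf (fun z => c k l (f z) * W k l z).
  by move=> mf; apply: bmfM => //; exact: bmf_comp.
have close (f : T -> U) : measurable_fun setT f ->
    `|Rintegral P setT (F f) - Rintegral P setT (G f)| <= eta / 3.
  move=> mf; rewrite -EB.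
  - apply: Enorm_le.
      apply: bmfB; last by do 2 apply: bmf_sum => ?; exact: hcf.
      by apply: bmfM; [exact: bmf_comp|apply: bmfM; apply: bmf_flow => //; exact: measurableT_comp].
    move=> z; set x := f z.
    have [l0 [_ l0x] l0E] := sum_cell (fun l => 0) h0 (p2C x).
    have [k0 [_ k0x] k0E] := sum_cell (fun k => \sum_(l < n) \1_(cell p2 C h l) x * (e x * W k l z)) h0 (p1C x).
    have [l1 [_ l1x] l1E] := sum_cell (fun l => e x * W k0 l z) h0 (p2C x).
    have -> : G f z = e x * W k0 l1 z.
      rewrite -l1E -k0E /G; apply: eq_bigr => k _; rewrite mulr_sumr.
      by apply: eq_bigr => l _; rewrite /c -/x; ring.
    rewrite /F -/x -mulrBr normrM; apply: le_trans hL.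
    apply: (@le_trans _ _ (`|w1 (S (p1 x) (y1 z)) * w2 (S (p2 x) (y2 z)) - W k0 l1 z|)).
      by rewrite ler_piMl.
    apply: le_trans (prod_dist_le _ _ _ _) _ => //.
    apply: lerD; apply: le_trans (flow_lipschitz_dist _ _ _ _) _; try eassumption; exact: ler_wpM2l.
  - by apply: bmfM; [exact: bmf_comp|apply: bmfM; apply: bmf_flow => //; exact: measurableT_comp].
  - by do 2 apply: bmf_sum => ?; exact: hcf.
have GE (f : T -> U) : measurable_fun setT f -> Rintegral P setT (G f) =
    \sum_(k < n) \sum_(l < n) Rintegral P setT (fun z => c k l (f z) * W k l z).
  move=> mf; rewrite Esum; last by move=> k; apply: bmf_sum => l; exact: hcf.
  by apply: eq_bigr => k _; rewrite Esum// => l; exact: hcf.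
have mtb : measurable_fun setT (fun z => tau t (b z)) by exact: (measurableT_comp (mtau_t t) mb).
have mid : `|Rintegral P setT (G (fun z => tau t (b z))) - Rintegral P setT (G b)| <= eta / 3.
  rewrite !GE// -sumrB; apply: le_trans (ler_norm_sum _ _ _) _.
  apply: (@le_trans _ _ (\sum_(k < n) \sum_(l < n) eta1)).
    apply: ler_sum => k _; rewrite -sumrB; apply: le_trans (ler_norm_sum _ _ _) _.
    apply: ler_sum => l _; have [_ hk] := hdl k; apply: hk => //.
    by apply: lt_le_trans tD _; exact: hD.
  by rewrite !sumr_const !card_ord -mulrnA -[eta1 *+ _]mulr_natr natrM -expr2 eta1E divfK// gt_eqF.
have n1 := close _ mtb; have n2 := close _ mb.
move: n1 n2 mid; rewrite /F !ler_norml => /andP[? ?] /andP[? ?] /andP[? ?].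
by apply/andP; split; lra.
Qed.

Hypothesis mV : measurable_fun setT V.
Hypothesis PV : forall A, measurable A -> P (V @^-1` A) = P A.
Hypothesis erg : forall B, measurable B -> V @^-1` B = B -> P B = 0%E \/ P B = 1%E.
Hypothesis bV : forall z, b (V z) = tau a0 (b z).
Hypothesis y1V : forall q z, (0 < q)%N -> y1 (iter q V z) = S (psi1 q (b z)) (y1 z).
Hypothesis y2V : forall q z, (0 < q)%N -> y2 (iter q V z) = S (psi2 q (b z)) (y2 z).
Hypothesis mpsi1 : forall q, measurable_fun setT (psi1 q).
Hypothesis mpsi2 : forall q, measurable_fun setT (psi2 q).

(** At q = 0 the right side would be [tau 0 (b z)], which may differ from [b z]. *)
Let b_iter q z : (0 < q)%N -> b (iter q V z) = tau (q%:R * a0) (b z).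
Proof.
case: q => // q _; elim: q => [|q IH]; first by rewrite mul1r.
by rewrite iterS bV IH -tauD -[q.+2%:R]natr1 mulrDl mul1r [a0 + _]addrC.
Qed.

(* On the set e <> 0 a translation by t of the base changes the cocycle at time q by
   exactly (v1, v2). *)
Definition shift_witness (C v1 v2 eps c : R) (q : nat) (t : R) (e : U -> R) :=
  [/\ (0 < q)%N /\ `|t| < eps,
      (forall x, `|psi1 q x| <= C) /\ (forall x, `|psi2 q x| <= C),
      bmf e /\ (forall x, 0 <= e x <= 1),
      (forall x, e (tau 0 x) = e x) /\ (forall x, e x != 0 ->
         psi1 q (tau t x) = v1 + psi1 q x /\ psi2 q (tau t x) = v2 + psi2 q x) &
      Rintegral Q setT (fun x => `|e (tau a0 x) - e x|) <= eps /\
      c <= Rintegral Q setT e].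

(** By mixing, E e * E wv is close to the integral of e (b z) wv (V^q z). On the support of [e] the
    shift (v1, v2) is the change of the cocycle under [tau t], so this integrand is a function of
    the translated base point and the untranslated fibres. [grid_stable] removes the translation,
    and what remains is close to E e * E w, again by mixing. *)
Lemma shift_lipschitz (L C v1 v2 c : R) (w1 w2 : Y -> R) (a : U -> R) :
  0 <= L -> 0 < C -> 0 < c ->
  (forall eps, 0 < eps -> exists q t e, shift_witness C v1 v2 eps c q t e) ->
  flow_lipschitz L w1 -> flow_lipschitz L w2 -> bmf a -> (forall x, `|a x| <= 1) ->
  Rintegral P setT (fun z => a (b z) * (w1 (S v1 (y1 z)) * w2 (S v2 (y2 z)))) =
  Rintegral P setT (fun z => a (b z) * (w1 (y1 z) * w2 (y2 z))).
Proof.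
move=> L0 C0 c0 wit lw1 lw2 ha a1.
have [hw1 w11 _] := lw1; have [hw2 w21 _] := lw2.
pose wv z := a (b z) * (w1 (S v1 (y1 z)) * w2 (S v2 (y2 z))).
pose w z := a (b z) * (w1 (y1 z) * w2 (y2 z)).
rewrite -/wv -/w.
have hab : bmf (fun z => a (b z)) by exact: bmf_comp.
have hwv : bmf wv by apply: bmfM => //; apply: bmfM; exact: bmf_flow.
have hw : bmf w by apply: bmfM => //; apply: bmfM; exact: bmf_comp.
apply/eqP; rewrite -subr_eq0 -normr_le0; apply/ler_addgt0Pr => eta' eta'0; rewrite add0r.
(* Four approximations [J1], [J12], [mid], [J2], each with error [eta], followed by division by the
   integral of [e], which is at least c. *)
pose eta := c * eta' / 4.
have eta0 : 0 < eta by rewrite /eta divr_gt0// mulr_gt0.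
have [d1 d10 mix1] := almost_invariant_mixing mV PV erg hwv eta0.
have [d2 d20 mix2] := almost_invariant_mixing mV PV erg hw eta0.
have [d3 d30 stab] := grid_stable L0 C0 lw1 lw2 eta0.
have [d4 d40 cont] := flow_continuous mtau tauD Qtau ha eta0.
pose eps := Num.min (Num.min d1 d2) (Num.min d3 d4).
have eps0 : 0 < eps by rewrite !lt_min d10 d20 d30 d40.
have [e1 e2 e3 e4] : [/\ eps <= d1, eps <= d2, eps <= d3 & eps <= d4].
  by split; rewrite !ge_min lexx ?orbT.
have [q [t [e [[q0 teps] [psC1 psC2] [he e01] [etau0 esh] [einv ec]]]]] := wit _ eps0.
have e1' x : `|e x| <= 1 by have /andP[? ?] := e01 x; rewrite ger0_norm.
have het s : bmf (fun x => e (tau s x)) by exact: bmf_comp.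
have hat s : bmf (fun x => a (tau s x)) by exact: bmf_comp.
have mtb s : measurable_fun setT (fun z => tau s (b z)).
  exact: (measurableT_comp (mtau_t s) mb).
have J1 : `|Rintegral P setT (fun z => e (b z) * wv (iter q V z)) -
    Rintegral Q setT e * Rintegral P setT wv| <= eta.
  rewrite -(E_b he); apply: mix1; [exact: bmf_comp|by []|].
  apply: le_trans e1; apply: le_trans einv.
  rewrite -(E_b (bmf_norm (bmfB (het a0) he))).
  by under eq_Rintegral do rewrite bV.
have J2 : `|Rintegral P setT (fun z => e (tau (- t) (b z)) * w (iter q V z)) -
    Rintegral Q setT e * Rintegral P setT w| <= eta.
  rewrite -(E_tau (- t) he) -(E_b (het (- t))); apply: mix2.
  - by apply: (bmf_comp he); exact: mtb.
  - by [].
  apply: le_trans e2; apply: le_trans einv.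
  rewrite -(E_tau (- t) (bmf_norm (bmfB (het a0) he))).
  have hN : bmf (fun x => `|e (tau a0 (tau (- t) x)) - e (tau (- t) x)|).
    by apply: bmf_norm; apply: bmfB => //; apply: (bmf_comp (het a0)).
  rewrite -(E_b hN).
  rewrite le_eqVlt; apply/orP; left; apply/eqP; apply: eq_Rintegral => z _.
  by rewrite bV -!tauD [- t + a0]addrC.
(* Pulling [e] back by - t makes its value at [tau t (b z)] equal to [e (b z)]; the factor [a] is
   evaluated after q steps, as in [w (iter q V z)]. *)
pose eh x := e (tau (- t) x) * a (tau (q%:R * a0) x).
have heh : bmf eh by exact: bmfM.
have t3 : `|t| < d3 by exact: lt_le_trans e3.
have t4 : `|t| < d4 by exact: lt_le_trans e4.
have mid := stab t eh _ _ t3 heh (fun x => prod_norm_le1 (e1' _) (a1 _))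
  (mpsi1 q) (mpsi2 q) psC1 psC2.
have J2E : Rintegral P setT (fun z => eh (b z) *
    (w1 (S (psi1 q (b z)) (y1 z)) * w2 (S (psi2 q (b z)) (y2 z)))) =
    Rintegral P setT (fun z => e (tau (- t) (b z)) * w (iter q V z)).
  by apply: eq_Rintegral => z _; rewrite /w /eh b_iter// y1V// y2V// -mulrA.
have J12 : `|Rintegral P setT (fun z => e (b z) * wv (iter q V z)) -
   Rintegral P setT (fun z => eh (tau t (b z)) *
    (w1 (S (psi1 q (tau t (b z))) (y1 z)) * w2 (S (psi2 q (tau t (b z))) (y2 z))))| <= eta.
  have hA : bmf (fun x => `|a (tau t x) - a (tau 0 x)|) by apply: bmf_norm; exact: bmfB.
  apply: le_trans (cont t t4); rewrite -(E_tau (q%:R * a0) hA).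
  have hA' : bmf (fun x => `|a (tau t (tau (q%:R * a0) x)) - a (tau 0 (tau (q%:R * a0) x))|).
    exact: (bmf_comp hA).
  rewrite -(E_b hA'); apply: Enorm_dist.
  - apply: bmfM; first exact: bmf_comp.
    by apply: (bmf_comp hwv); exact: measurable_iter.
  - apply: bmfM; first by apply: (bmf_comp heh); exact: mtb.
    by apply: bmfM; apply: bmf_flow => //; apply: measurableT_comp => //; exact: mtb.
  - exact: (bmf_comp hA').
  (* The translations by t and - t compose to [tau 0], under which [e] is invariant. Where [e]
     vanishes both integrands vanish; elsewhere they differ only through [a], by the translation
     t. *)
  - move=> z; rewrite /wv /eh b_iter// y1V// y2V// -!tauD addNr etau0 add0r.
    rewrite [q%:R * a0 + t]addrC.
    have [->|eN0] := eqVneq (e (b z)) 0; first by rewrite !mul0r subrr normr0.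
    have [-> ->] := esh _ eN0; rewrite !SD -mulrA -mulrBr -mulrBl !normrM.
    apply: le_trans (_ : 1 * (`|a (tau (q%:R * a0) (b z)) - a (tau (t + q%:R * a0) (b z))| * 1) <= _).
      apply: ler_pM => //; apply: ler_wpM2l => //.
      by rewrite -normrM; exact: prod_norm_le1.
    by rewrite mul1r mulr1 distrC.
rewrite J2E in mid.
have E0 : 0 < Rintegral Q setT e by exact: lt_le_trans ec.
rewrite -(ler_pM2l E0) -{1}(gtr0_norm E0) -normrM mulrBr.
have : c * eta' <= Rintegral Q setT e * eta' by rewrite ler_pM2r.
have : 4 * eta = c * eta' by rewrite /eta; field.
move: J1 J2 mid J12.
exact: quadrangle_dist.
Qed.

Definition smoothing (h : R) (f : Y -> R) (y : Y) :=
  Rintegral lebT setT (fun t : R => f (S (h * t) y)).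

Let bmf_orbit (f : Y -> R) (h : R) y : bmf f -> bmf (fun t : R => f (S (h * t) y)).
Proof.
move=> hf; apply: (bmf_comp hf); apply: (measurableT_comp (measurable_flow_orbit mS y)).
exact: measurable_funM.
Qed.

Let bmf_orbit2 (f : Y -> R) (h : R) : bmf f -> bmf (fun p : R * Y => f (S (h * p.1) p.2)).
Proof.
move=> hf; apply: (bmf_comp hf).
apply: (measurableT_comp mS (g := fun p : R * Y => (h * p.1, p.2))).
apply/measurable_fun_pairP; split; last exact: measurable_snd.
apply: (measurable_funM (f := cst h) (g := fst)); first exact: measurable_cst.
exact: measurable_fst.
Qed.

(** In the unit parameter of the averaging window, moving the starting point by time t is a
    translation by t / h. *)
Lemma smoothing_lipschitz h f : 0 < h -> bmf f -> (forall y, `|f y| <= 1) ->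
  flow_lipschitz (2 / h) (smoothing h f).
Proof.
move=> h0 hf f1; split.
- exact: (bmf_E1 lebT nu (bmf_orbit2 h hf)).
- by move=> y; apply: Enorm_le => //; exact: bmf_orbit.
- move=> t y; rewrite /smoothing.
  have := E_unit_translation (bmf_orbit h y hf) (fun x => f1 _) (t / h).
  rewrite normrM normfV (gtr0_norm h0) mulrA mulrAC; apply: le_trans.
  rewrite le_eqVlt; apply/orP; left; apply/eqP; congr (`|_ - _|).
  apply: eq_Rintegral => x _; rewrite -SD mulrDr; congr (f (S (_ + _) _)).
  by rewrite mulrC divfK// gt_eqF.
Qed.

Lemma smoothing_close f eta : bmf f -> 0 < eta ->
  exists2 h0, 0 < h0 & forall h, 0 < h < h0 ->
    Rintegral nu setT (fun y => `|f y - smoothing h f y|) <= eta.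
Proof.
move=> hf eta0; have [h0 h00 hh] := flow_continuous mS SD nuS hf eta0.
exists h0 => // h /andP[hp hlt].
have hff : bmf (fun p : R * Y => `|f (S (h * p.1) p.2) - f p.2|).
  apply: bmf_norm; apply: bmfB; first exact: bmf_orbit2.
  by apply: (bmf_comp hf); exact: measurable_snd.
have hs := bmf_E1 lebT nu (bmf_orbit2 h hf).
apply: le_trans (_ : Rintegral nu setT (fun y => Rintegral lebT setT (fun t : R =>
   `|f (S (h * t) y) - f y|)) <= _).
  apply: Ele.
  - by apply: bmf_norm; apply: bmfB.
  - exact: (bmf_E1 lebT nu hff).
  - move=> y; rewrite distrC -[X in _ - X](@Ecst _ _ _ (@lebT R)) -EB.
    + apply: Enorm; apply: bmfB; [exact: bmf_orbit|exact: bmf_cst].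
    + exact: bmf_orbit.
    + exact: bmf_cst.
rewrite -(E_fubini lebT nu hff)/= -[leRHS](@Ecst _ _ _ (@lebT R)).
apply: Ele_unit => [||t /andP[t0 t1]].
- exact: (bmf_E2 lebT nu hff).
- exact: bmf_cst.
- have th : `|h * t| < h0.
    rewrite ger0_norm; last by rewrite mulr_ge0// ltW.
    by apply: le_lt_trans hlt; rewrite ler_piMr// ltW.
  by have := hh _ th; under eq_Rintegral do rewrite S0.
Qed.

(** Smoothing along orbits reduces this to Lipschitz functions. Its error is measured under [nu],
    because [y1] and [y2] have law [nu] and the flow preserves it, so the same bound holds before
    and after the shift. *)
Lemma shift_equality (C v1 v2 c : R) (f1 f2 : Y -> R) (a : U -> R) :
  0 < C -> 0 < c ->
  (forall eps, 0 < eps -> exists q t e, shift_witness C v1 v2 eps c q t e) ->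
  bmf f1 -> (forall y, `|f1 y| <= 1) -> bmf f2 -> (forall y, `|f2 y| <= 1) ->
  bmf a -> (forall x, `|a x| <= 1) ->
  Rintegral P setT (fun z => a (b z) * (f1 (S v1 (y1 z)) * f2 (S v2 (y2 z)))) =
  Rintegral P setT (fun z => a (b z) * (f1 (y1 z) * f2 (y2 z))).
Proof.
move=> C0 c0 wit hf1 f11 hf2 f21 ha a1.
apply/eqP; rewrite -subr_eq0 -normr_le0; apply/ler_addgt0Pr => eta eta0; rewrite add0r.
have eta4 : 0 < eta / 4 by rewrite divr_gt0.
have [h1 h10 H1] := smoothing_close hf1 eta4.
have [h2 h20 H2] := smoothing_close hf2 eta4.
pose h := Num.min h1 h2 / 2.
have hm : 0 < Num.min h1 h2 by rewrite lt_min h10.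
have h0 : 0 < h by rewrite divr_gt0.
have hm1 : h < Num.min h1 h2 by rewrite /h; lra.
have hlt1 : 0 < h < h1 by rewrite h0 (lt_le_trans hm1)// ge_min lexx.
have hlt2 : 0 < h < h2 by rewrite h0 (lt_le_trans hm1)// ge_min lexx orbT.
have lw1 := smoothing_lipschitz h0 hf1 f11; have lw2 := smoothing_lipschitz h0 hf2 f21.
have [hw1 w11 _] := lw1; have [hw2 w21 _] := lw2.
have L0 : 0 <= 2 / h by rewrite divr_ge0// ltW.
have eqw := shift_lipschitz L0 C0 c0 wit lw1 lw2 ha a1.
have close u1 u2 : `|Rintegral P setT (fun z => a (b z) * (f1 (S u1 (y1 z)) * f2 (S u2 (y2 z)))) -
    Rintegral P setT (fun z => a (b z) *
      (smoothing h f1 (S u1 (y1 z)) * smoothing h f2 (S u2 (y2 z))))| <= eta / 2.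
  have hd1 : bmf (fun y => `|f1 y - smoothing h f1 y|) by apply/bmf_norm/bmfB.
  have hd2 : bmf (fun y => `|f2 y - smoothing h f2 y|) by apply/bmf_norm/bmfB.
  have hd1u : bmf (fun y => `|f1 (S u1 y) - smoothing h f1 (S u1 y)|) by exact: (bmf_comp hd1).
  have hd2u : bmf (fun y => `|f2 (S u2 y) - smoothing h f2 (S u2 y)|) by exact: (bmf_comp hd2).
  apply: le_trans (_ : eta / 4 + eta / 4 <= _); last by lra.
  apply: le_trans (lerD (H1 _ hlt1) (H2 _ hlt2)).
  rewrite -(E_comp (mS_t u1) (nuS u1) hd1) -(E_comp my1 Py1 hd1u).
  rewrite -(E_comp (mS_t u2) (nuS u2) hd2) -(E_comp my2 Py2 hd2u).
  have hab : bmf (fun z => a (b z)) by exact: bmf_comp.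
  rewrite -ED; last 2 first.
  - exact: (bmf_comp hd1u).
  - exact: (bmf_comp hd2u).
  apply: Enorm_dist.
  - by apply: bmfM => //; apply: bmfM; exact: bmf_flow.
  - by apply: bmfM => //; apply: bmfM; exact: bmf_flow.
  - by apply: bmfD; [exact: (bmf_comp hd1u)|exact: (bmf_comp hd2u)].
  - move=> z; rewrite -mulrBr normrM; apply: le_trans (prod_dist_le _ _ _ _) => //.
    by rewrite ler_piMl.
have c1 := close v1 v2; have := close 0 0.
rewrite eqw in c1.
under eq_Rintegral do rewrite !S0.
under [X in _ - X]eq_Rintegral do rewrite !S0.
exact: half_dist c1.
Qed.

End EssentialShift.

(** * Joinings of powers of the skew product *)

Lemma sum_zero_one {R : realType} (f : nat -> R) n : (forall j, f j = 0 \/ f j = 1) ->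
  (forall i j, (i < j < n)%N -> f i = 1 -> f j = 1 -> False) ->
  \sum_(j < n) f j = 0 \/ \sum_(j < n) f j = 1.
Proof.
move=> f01; elim: n => [|n IH] one; first by left; rewrite big_ord0.
rewrite big_ord_recr /=; have [fn|fn] := f01 n.
  by rewrite fn addr0; apply: IH => i j /andP[ij jn]; apply: one; rewrite ij ltnS ltnW.
right; rewrite fn big1 ?add0r// => i _; have [//|fi] := f01 i.
by case: (one i n _ fi fn); rewrite ltn_ord ltnS leqnn.
Qed.

(** * Discontinuities crossed by a translated orbit segment *)

Section Crossings.
Context {R : realType}.
Implicit Types (u x : R).

(* For 0 <= u < 1 this is 1 when the arc from x to x + u meets 0 and 0 otherwise. *)
Definition wrap u x := u - (sawtooth (x + u) - sawtooth x).

Lemma wrap_frac_add u x y : wrap u (frac x + y) = wrap u (x + y).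
Proof. by rewrite /wrap sawtooth_frac_add -[frac x + y + u]addrA sawtooth_frac_add addrA. Qed.

Lemma wrap_floor u x : wrap u x = (Num.floor (x + u) - Num.floor x)%:~R.
Proof. by rewrite /wrap /sawtooth /frac rmorphB /=; ring. Qed.

Lemma wrap_spec u x : 0 <= u < 1 ->
  wrap u x = 0 \/ wrap u x = 1 /\ exists m : int, 0 < m%:~R - x <= u.
Proof.
move=> /andP[u0 u1]; rewrite wrap_floor; set k := Num.floor x.
have kx : k%:~R <= x by exact: floor_le_tmp.
have xk : x < (k + 1)%:~R by exact: floorD1_gt.
have [h|h] := ltP (x + u) (k + 1)%:~R.
  left; have -> : Num.floor (x + u) = k; last by rewrite subrr.
  by apply: floor_def; rewrite h (le_trans kx)// lerDl.
right; have -> : Num.floor (x + u) = k + 1.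
  apply: floor_def; rewrite h /= intrD; rewrite intrD in xk; lra.
split; first by rewrite addrC addKr.
by exists (k + 1); rewrite subr_gt0 xk lerBlDl.
Qed.

Lemma wrap01 u x : 0 <= u < 1 -> wrap u x = 0 \/ wrap u x = 1.
Proof. by move=> /(wrap_spec x)[|[]]; [left|right]. Qed.

Lemma wrap_ge0 u x : 0 <= u < 1 -> 0 <= wrap u x.
Proof. by move=> /(wrap01 x)[] ->. Qed.

Lemma measurable_sawtooth : measurable_fun setT (@sawtooth R).
Proof. by apply: measurable_funB; [exact: measurable_frac|exact: measurable_cst]. Qed.

Lemma bmf_sawtooth : bmf (@sawtooth R).
Proof. by split; [exact: measurable_sawtooth|exists 1 => x; exact: sawtooth_bound]. Qed.

Lemma bmf_translate (f : R -> R) (t : R) : bmf f -> bmf (fun x : R => f (x + t)).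
Proof. by move=> hf; apply: bmf_comp => //; exact: measurable_funD. Qed.

Lemma bmf_wrap u : bmf (wrap u).
Proof.
apply: bmfB; first exact: bmf_cst.
by apply: bmfB; [exact/bmf_translate/bmf_sawtooth|exact: bmf_sawtooth].
Qed.

(** The two sawtooth terms have the same mean by rotation invariance and cancel. *)
Lemma E_wrap u y : Rintegral lebT setT (fun x : R => wrap u (x + y)) = u.
Proof.
have -> : Rintegral lebT setT (fun x : R => wrap u (x + y)) = Rintegral lebT setT (wrap u).
  rewrite -(E_rot y (bmf_wrap u)); apply: eq_Rintegral => x _.
  by rewrite -[frac _]addr0 wrap_frac_add addr0.
rewrite EB//; [|exact: bmf_cst|]; last first.
  by apply: bmfB; [exact/bmf_translate/bmf_sawtooth|exact: bmf_sawtooth].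
rewrite EB; [|exact/bmf_translate/bmf_sawtooth|exact: bmf_sawtooth].
rewrite (@Ecst _ _ _ (@lebT R)) -[X in _ - (_ - X)](E_rot u bmf_sawtooth).
under [X in _ - (_ - X)]eq_Rintegral do rewrite sawtooth_frac.
by rewrite subrr subr0.
Qed.

Context (alpha : R).

Lemma birk_frac n x y : birk alpha n (frac x + y) = birk alpha n (x + y).
Proof. by apply: eq_bigr => j _; rewrite -[frac x + y + _]addrA sawtooth_frac_add addrA. Qed.

Lemma birkD m n x : birk alpha (m + n) x = birk alpha m x + birk alpha n (x + m%:R * alpha).
Proof.
rewrite /birk big_split_ord /=; congr (_ + _); apply: eq_bigr => j _.
by rewrite natrD; congr sawtooth; ring.
Qed.

Lemma birk_block_bound (q r : nat) (p : int) : (0 < q)%N -> coprimez q p ->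
  `|q%:R * alpha - p%:~R| <= q%:R^-1 -> forall x, `|birk alpha (q * r) x| <= 3 * r%:R.
Proof.
move=> q0 qp hq; elim: r => [|r IH] x; first by rewrite muln0 /birk big_ord0 normr0 mulr0.
rewrite mulnS birkD (le_trans (ler_normD _ _))//.
have -> : 3 * r.+1%:R = 3 + 3 * r%:R :> R by rewrite -natr1; ring.
by rewrite lerD// (birk_bound q0 qp).
Qed.

Lemma bmf_birk n : bmf (birk alpha n).
Proof. by apply: bmf_sum => j; exact/bmf_translate/bmf_sawtooth. Qed.

Definition crossings n u x := \sum_(j < n) wrap u (x + j%:R * alpha).

Lemma crossings_birk n u x : crossings n u x = n%:R * u - (birk alpha n (x + u) - birk alpha n x).
Proof.
rewrite /crossings /birk /wrap sumrB sumr_const card_ord mulr_natl; congr (_ - _).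
by rewrite sumrB; congr (_ - _); apply: eq_bigr => j _; rewrite [x + _ + u]addrAC.
Qed.

Lemma crossings_frac_add n u x y : crossings n u (frac x + y) = crossings n u (x + y).
Proof. by apply: eq_bigr => j _; rewrite -[frac x + y + _]addrA wrap_frac_add addrA. Qed.

Lemma crossings_frac n u x : crossings n u (frac x) = crossings n u x.
Proof. by rewrite -[frac x]addr0 crossings_frac_add addr0. Qed.

Lemma bmf_crossings n u : bmf (crossings n u).
Proof. by apply: bmf_sum => j; exact/bmf_translate/bmf_wrap. Qed.

Lemma E_crossings n u : Rintegral lebT setT (crossings n u) = n%:R * u.
Proof.
rewrite Esum; last by move=> j; exact/bmf_translate/bmf_wrap.
by under eq_bigr do rewrite E_wrap; rewrite sumr_const card_ord mulr_natl.
Qed.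

(** Two crossings at times i < j < n would put (j - i) alpha at distance less than u from an
    integer, hence (j - i) times that distance below n u <= c, against bad approximability. *)
Lemma crossings01 (c : R) n u x :
  (forall (n : nat) (p : int), (0 < n)%N -> c <= n%:R * `|n%:R * alpha - p%:~R|) ->
  0 <= u < 1 -> n%:R * u <= c -> crossings n u x = 0 \/ crossings n u x = 1.
Proof.
move=> bad hu nuc; apply: (sum_zero_one (f := fun j => wrap u (x + j%:R * alpha))) => [j|i j].
  exact: wrap01.
move=> /andP[ij jn] wi wj.
have [/eqP|[_ [k /andP[k0 ku]]]] := wrap_spec (x + i%:R * alpha) hu.
  by rewrite wi oner_eq0.
have [/eqP|[_ [m /andP[m0 mu]]]] := wrap_spec (x + j%:R * alpha) hu.
  by rewrite wj oner_eq0.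
have ji : (0 < j - i)%N by rewrite subn_gt0.
have := bad (j - i)%N (m - k) ji; rewrite leNgt => /negP; apply.
apply: lt_le_trans nuc.
have u0 : 0 < u by apply: lt_le_trans ku.
have n0 : (0 < n)%N by apply: leq_ltn_trans jn.
apply: (@le_lt_trans _ _ (n%:R * `|(j - i)%:R * alpha - (m - k)%:~R|)).
  by rewrite ler_wpM2r// ler_nat (leq_trans (leq_subr _ _))// ltnW.
rewrite ltr_pM2l ?ltr0n// natrB ?(ltnW ij)// rmorphB /= mulrBl ltr_norml.
by apply/andP; split; lra.
Qed.

Lemma crossings_step n u x :
  crossings n u (x + alpha) - crossings n u x = wrap u (x + n%:R * alpha) - wrap u x.
Proof.
elim: n => [|n IH]; first by rewrite /crossings !big_ord0 mul0r addr0 !subrr.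
rewrite /crossings !big_ord_recr /= -/(crossings n u _) -/(crossings n u _).
have -> : x + alpha + n%:R * alpha = x + n.+1%:R * alpha by rewrite -natr1; ring.
by move: IH; lra.
Qed.

(** One rotation step drops the first term of the count and appends a new last one, each of mean u.
    The bound does not involve n, so u of order 1 / q makes the jump events almost invariant. *)
Lemma crossings_shift n u k : 0 <= u < 1 ->
  Rintegral lebT setT (fun x : R => `|crossings n u (x + k%:R * alpha) - crossings n u x|) <=
  2 * k%:R * u.
Proof.
move=> hu.
pose h x := \sum_(i < k) (wrap u (x + (i%:R * alpha + n%:R * alpha)) + wrap u (x + i%:R * alpha)).
have hh (i : nat) : bmf (fun x : R => wrap u (x + (i%:R * alpha + n%:R * alpha)) + wrap u (x + i%:R * alpha)).
  by apply: bmfD; exact/bmf_translate/bmf_wrap.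
apply: (@le_trans _ _ (Rintegral lebT setT h)); last first.
  rewrite Esum//; under eq_bigr do (rewrite ED ?E_wrap; [|exact/bmf_translate/bmf_wrap|exact/bmf_translate/bmf_wrap]).
  by rewrite sumr_const card_ord -[_ *+ k]mulr_natl le_eqVlt; apply/orP; left; apply/eqP; ring.
apply: Ele.
- apply/bmf_norm/bmfB; last exact: bmf_crossings.
  exact/bmf_translate/bmf_crossings.
- exact: bmf_sum.
move=> x; rewrite /h; elim: k {h hh} => [|k IH].
  by rewrite mul0r addr0 subrr normr0 big_ord0.
rewrite big_ord_recr /= addrC.
rewrite (_ : _ - crossings n u x =
  (crossings n u (x + k.+1%:R * alpha) - crossings n u (x + k%:R * alpha)) +
  (crossings n u (x + k%:R * alpha) - crossings n u x)); last by ring.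
apply: le_trans (ler_normD _ _) _; apply: lerD => //.
have -> : crossings n u (x + k.+1%:R * alpha) - crossings n u (x + k%:R * alpha) =
    wrap u (x + (k%:R * alpha + n%:R * alpha)) - wrap u (x + k%:R * alpha).
  have -> : x + k.+1%:R * alpha = x + k%:R * alpha + alpha by rewrite -natr1; ring.
  by rewrite crossings_step addrA.
have := wrap_ge0 (x + (k%:R * alpha + n%:R * alpha)) hu.
have := wrap_ge0 (x + k%:R * alpha) hu.
by move=> ? ?; rewrite ler_norml; apply/andP; split; lra.
Qed.

End Crossings.

(** Some [th = q alpha - p] is smaller than eps and nonzero, by bad approximability; its multiples
    advance in steps shorter than eps. *)
Lemma dense_multiples {R : realType} (alpha t eps : R) : badly_approximable alpha -> 0 < eps ->
  exists (n : nat) (m : int), (0 < n)%N /\ `|n%:R * alpha + m%:~R - t| < eps.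
Proof.
move=> [c c0 bad] eps0.
have [q [p [/andP[q0 _] _ hq]]] := dirichlet_coprime alpha (ltn0Sn (Num.truncn eps^-1)).
set th := q%:R * alpha - p%:~R in hq.
have the : `|th| < eps.
  apply: lt_trans hq _; rewrite invf_plt ?posrE ?ltr0n//.
  exact: truncnS_gt.
have th0 : th != 0.
  by apply/eqP => h; have := bad q p q0; rewrite -/th h normr0 mulr0 leNgt c0.
(* An integer moves t to the side of [th], at least one step away from 0, so that a positive
   multiple is used. *)
have [m hm] : exists m : int, 1 <= (t + m%:~R) / th.
  pose M : int := (Num.truncn (`|t| + `|th|)).+1%:Z.
  have hM : `|t| + `|th| < M%:~R := truncnS_gt _.
  move: hM; have := ler_norm t; have := ler_norm (- t); rewrite normrN => t1 t2 hM.
  have [h|h] := ltP 0 th.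
    exists M; rewrite ler_pdivlMr// mul1r; move: hM; rewrite (gtr0_norm h); lra.
  have {}h : th < 0 by rewrite lt_neqAle th0.
  exists (- M); rewrite ler_ndivlMr// mul1r rmorphN /=; move: hM; rewrite (ltr0_norm h); lra.
pose k := Num.truncn ((t + m%:~R) / th).
have k0 : (0 < k)%N by rewrite truncn_gt0.
have /andP[k1 k2] : k%:R <= (t + m%:~R) / th < k.+1%:R by apply: truncn_itv; apply: le_trans hm.
exists (k * q)%N, (- (k%:Z * p) - m); split; first by rewrite muln_gt0 k0.
have -> : (k * q)%:R * alpha + (- (k%:Z * p) - m)%:~R - t = - (((t + m%:~R) / th - k%:R) * th).
  rewrite mulrBl divfK// natrM rmorphB rmorphN rmorphM /= /th; ring.
rewrite normrN normrM; apply: le_lt_trans the; rewrite ler_piMl// ger0_norm ?subr_ge0//.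
by move: k2; rewrite -natr1; lra.
Qed.

(** From c <= q |q alpha - p| < q / Q it follows that q > c Q, so a large Dirichlet bound forces a
    large denominator. *)
Lemma dirichlet_large {R : realType} (alpha : R) (M : nat) : badly_approximable alpha ->
  exists (q : nat) (p : int), [/\ (0 < q)%N, (M <= q)%N, coprimez q p &
    `|q%:R * alpha - p%:~R| <= q%:R^-1].
Proof.
move=> [c c0 bad].
have [q [p [/andP[q0 qQ] qp hq]]] := dirichlet_coprime alpha (ltn0Sn (Num.truncn (M%:R / c))).
set Q := (Num.truncn _).+1 in qQ hq.
exists q, p; split => //; last first.
  by apply: le_trans (ltW hq) _; rewrite lef_pV2 ?posrE ?ltr0n// ler_nat.
rewrite -(ler_nat R).
have hQ : M%:R / c < Q%:R :> R := truncnS_gt _.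
have := bad q p q0 => h.
have h2 : c < q%:R / Q%:R by apply: le_lt_trans h _; rewrite ltr_pM2l ?ltr0n.
rewrite ltr_pdivlMr ?ltr0n// in h2; rewrite ltr_pdivrMr// in hQ.
by apply/ltW; apply: lt_trans h2; rewrite mulrC.
Qed.

(** Uniqueness on rectangles is applied twice: to base against fibres, then, restricted to a fixed
    base set, to the two fibres. *)
Lemma measure_eq_boxes {R : realType} d1 d2 d3 d4 (T : measurableType d1)
    (U : measurableType d2) (Y1 : measurableType d3) (Y2 : measurableType d4)
    (m1 m2 : {measure set T -> \bar R}) (b : T -> U) (y1 : T -> Y1) (y2 : T -> Y2) :
  measurable_fun setT b -> measurable_fun setT y1 -> measurable_fun setT y2 ->
  (m1 setT < +oo)%E ->
  (forall A B C, measurable A -> measurable B -> measurable C ->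
    m1 (b @^-1` A `&` (y1 @^-1` B `&` y2 @^-1` C)) =
    m2 (b @^-1` A `&` (y1 @^-1` B `&` y2 @^-1` C))) ->
  forall X, measurable X ->
    m1 ((fun z => (b z, (y1 z, y2 z))) @^-1` X) = m2 ((fun z => (b z, (y1 z, y2 z))) @^-1` X).
Proof.
move=> mb my1 my2 fin box.
have my : measurable_fun setT (fun z => (y1 z, y2 z)) by exact/measurable_fun_pairP.
have mby : measurable_fun setT (fun z => (b z, (y1 z, y2 z))) by exact/measurable_fun_pairP.
have [p1 p1E] := pushforward_measure_exists m1 mby.
have [p2 p2E] := pushforward_measure_exists m2 mby.
move=> X mX; rewrite -p1E -p2E; apply: measure_eq_rectangles mX.
  by rewrite p1E preimage_setT.
move=> A D mA mD; rewrite p1E p2E.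
have mbA : measurable (b @^-1` A) by exact: measurable_preimage.
pose n1 : {measure set T -> \bar R} := mrestr m1 mbA.
pose n2 : {measure set T -> \bar R} := mrestr m2 mbA.
have [q1 q1E] := pushforward_measure_exists n1 my.
have [q2 q2E] := pushforward_measure_exists n2 my.
have -> (m : {measure set T -> \bar R}) : m ((fun z => (b z, (y1 z, y2 z))) @^-1` (A `*` D)) =
    mrestr m mbA ((fun z => (y1 z, y2 z)) @^-1` D).
  by rewrite /mrestr; congr (m _); rewrite setIC.
have -> (m : {measure set T -> \bar R}) : m ((fun z => (b z, (y1 z, y2 z))) @^-1` (A `*` D)) =
    mrestr m mbA ((fun z => (y1 z, y2 z)) @^-1` D).
  by rewrite /mrestr; congr (m _); rewrite setIC.
transitivity (q1 D); first by rewrite q1E.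
transitivity (q2 D); last by rewrite q2E.
apply: measure_eq_rectangles mD.
  rewrite q1E preimage_setT /n1 /= /mrestr setTI.
  by apply: le_lt_trans fin; apply: le_measure; rewrite ?inE.
move=> B C mB mC; rewrite q1E q2E /n1 /n2 /= /mrestr.
rewrite (_ : _ `&` _ = b @^-1` A `&` (y1 @^-1` B `&` y2 @^-1` C)); first exact: box.
by rewrite setIC.
Qed.

Lemma rotation_continuous {R : realType} (f : R -> R) : bmf f -> forall eta, 0 < eta ->
  exists2 delta, 0 < delta & forall t u : R, `|t - u| < delta ->
    Rintegral lebT setT (fun x : R => `|f (frac (x + t)) - f (frac (x + u))|) <= eta.
Proof.
move=> hf eta eta0.
have mrot : measurable_fun setT (fun p : R * R => frac (p.2 + p.1)).
  apply: (measurableT_comp measurable_frac); apply: measurable_funD.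
    exact: measurable_snd.
  exact: measurable_fst.
have rotD (t u x : R) : frac (x + (t + u)) = frac (frac (x + u) + t).
  by rewrite frac_addl; congr frac; ring.
have [D D0 hD] := @flow_continuous R _ _ (@lebT R) (fun t x => frac (x + t)) f mrot rotD
  (fun t A mA => lebT_rot t mA) hf eta eta0.
exists D => // t u tu.
have hg : bmf (fun x : R => `|f (frac (x + (t - u))) - f (frac (x + 0))|).
  by apply/bmf_norm/bmfB; apply: (bmf_comp hf); exact: measurable_rot.
have := hD _ tu; rewrite -(E_rot u hg); apply: le_trans.
rewrite le_eqVlt; apply/orP; left; apply/eqP; apply: eq_Rintegral => x _.
by rewrite !frac_addl addr0 -[x + u + _]addrA subrKC.
Qed.

(** * Unit fibre shifts preserve an ergodic joining *)

Section Joining.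
Context {R : realType} (alpha : R) d (Y : measurableType d) (nu : probability Y R)
  (S : R -> Y -> Y) (r s : nat).
Let X := (R * Y)%type.
Context (kappa : probability (X * X)%type R).
Let Rm := @skew_flow R d Y alpha S.
Hypothesis bad : badly_approximable alpha.
Hypothesis mS : measurable_fun setT (fun p : R * Y => S p.1 p.2).
Hypothesis S0 : forall y, S 0 y = y.
Hypothesis SD : forall s t y, S (s + t) y = S s (S t y).
Hypothesis nuS : forall t A, measurable A -> nu (S t @^-1` A) = nu A.
Hypothesis r0 : (0 < r)%N.
Hypothesis s0 : (0 < s)%N.
Hypothesis rs : r <> s.
Hypothesis joins : is_joining (lebesgue_T \x nu)%E kappa (iter r Rm) (iter s Rm).
Hypothesis erg : ergodic_measure kappa (fun z : X * X => (iter r Rm z.1, iter s Rm z.2)).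

(** n = 0 is excluded because the identity does not reduce the first coordinate modulo 1. *)
Lemma iter_skew n p : (0 < n)%N ->
  iter n Rm p = (frac (p.1 + n%:R * alpha), S (birk alpha n p.1) p.2).
Proof.
case: n => // n _; elim: n => [|n IH].
  by rewrite /= /Rm /skew_flow /birk big_ord1 mul0r addr0 mul1r.
rewrite iterS IH /Rm /skew_flow /= frac_addl sawtooth_frac -SD.
congr (frac _, S _ _); first by rewrite -[n.+2%:R]natr1; ring.
by rewrite [birk _ n.+2 _]big_ord_recr /= addrC.
Qed.

Let b (z : X * X) : R * R := (z.1.1, z.2.1).
Let y1 (z : X * X) : Y := z.1.2.
Let y2 (z : X * X) : Y := z.2.2.
Let V (z : X * X) : X * X := (iter r Rm z.1, iter s Rm z.2).
(** The linear flow with velocity (r, s) on the torus; its time-[alpha] map is the projection of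
    [V]. *)
Definition base_shift (t : R) (x : R * R) : R * R :=
  (frac (x.1 + r%:R * t), frac (x.2 + s%:R * t)).
Let psi1 q (x : R * R) := birk alpha (q * r) x.1.
Let psi2 q (x : R * R) := birk alpha (q * s) x.2.

Let mb : measurable_fun setT b.
Proof.
apply/measurable_fun_pairP; split.
  exact: (measurableT_comp (@measurable_fst _ _ _ _) (@measurable_fst _ _ _ _)).
exact: (measurableT_comp (@measurable_fst _ _ _ _) (@measurable_snd _ _ _ _)).
Qed.

Let my1 : measurable_fun setT y1.
Proof. exact: (measurableT_comp (@measurable_snd _ _ _ _) (@measurable_fst _ _ _ _)). Qed.

Let my2 : measurable_fun setT y2.
Proof. exact: (measurableT_comp (@measurable_snd _ _ _ _) (@measurable_snd _ _ _ _)). Qed.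

Let mbase : measurable_fun setT (fun p : R * (R * R) => base_shift p.1 p.2).
Proof.
have m (n : nat) (f : R * (R * R) -> R) : measurable_fun setT f ->
    measurable_fun setT (fun p : R * (R * R) => frac (f p + n%:R * p.1)).
  move=> mf; apply: (measurableT_comp measurable_frac); apply: measurable_funD => //.
  by apply: measurable_funM; [exact: measurable_cst|exact: measurable_fst].
apply/measurable_fun_pairP; split; apply: m.
  exact: (measurableT_comp (@measurable_fst _ _ _ _) (@measurable_snd _ _ _ _)).
exact: (measurableT_comp (@measurable_snd _ _ _ _) (@measurable_snd _ _ _ _)).
Qed.

Lemma base_shiftD t u x : base_shift (t + u) x = base_shift t (base_shift u x).
Proof. by rewrite /base_shift /= !frac_addl !mulrDr; congr (frac _, frac _); ring. Qed.

Let mRm : measurable_fun setT Rm.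
Proof.
apply/measurable_fun_pairP; split.
  apply: (measurableT_comp measurable_frac); apply: measurable_funD.
    exact: measurable_fst.
  exact: measurable_cst.
apply: (measurableT_comp mS (g := fun p : X => (sawtooth p.1, p.2))).
apply/measurable_fun_pairP; split; last exact: measurable_snd.
exact: (measurableT_comp measurable_sawtooth (@measurable_fst _ _ _ _)).
Qed.

Let mV : measurable_fun setT V.
Proof.
apply/measurable_fun_pairP; split.
  exact: (measurableT_comp (measurable_iter r mRm) (@measurable_fst _ _ _ _)).
exact: (measurableT_comp (measurable_iter s mRm) (@measurable_snd _ _ _ _)).
Qed.

Let PV B : measurable B -> kappa (V @^-1` B) = kappa B.
Proof. by have [_ _ h] := joins; exact: h. Qed.

Let iterV q z : iter q V z = (iter (q * r) Rm z.1, iter (q * s) Rm z.2).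
Proof.
elim: q z => [[]//|q IH] z.
by rewrite iterS IH /V /= -!iterD !mulSn.
Qed.

Let bV z : b (V z) = base_shift alpha (b z).
Proof. by rewrite /b /V /base_shift /= !iter_skew. Qed.

Let y1V q z : (0 < q)%N -> y1 (iter q V z) = S (psi1 q (b z)) (y1 z).
Proof. by move=> q0; rewrite iterV /y1 /= iter_skew // muln_gt0 q0. Qed.

Let y2V q z : (0 < q)%N -> y2 (iter q V z) = S (psi2 q (b z)) (y2 z).
Proof. by move=> q0; rewrite iterV /y2 /= iter_skew // muln_gt0 q0. Qed.

Let marg1 A : measurable A -> kappa (fst @^-1` A) = (lebesgue_T \x nu)%E A.
Proof.
have [h _ _] := joins => mA; rewrite -(h A mA); congr (kappa _).
by apply/seteqP; split=> z //= [].
Qed.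

Let marg2 A : measurable A -> kappa (snd @^-1` A) = (lebesgue_T \x nu)%E A.
Proof.
have [_ h _] := joins => mA; rewrite -(h A mA); congr (kappa _).
by apply/seteqP; split=> z //= [].
Qed.

Let mu_rect A B : measurable A -> measurable B ->
  (lebesgue_T \x nu)%E (A `*` B) = (lebT A * nu B)%E.
Proof. by move=> mA mB; rewrite [LHS](product_measure1E (@lebT R) nu). Qed.

Let mu_base A : measurable A -> (lebesgue_T \x nu)%E (fst @^-1` A) = lebT A.
Proof.
move=> mA; rewrite (_ : fst @^-1` A = A `*` setT); last by apply/seteqP; split=> z //= [].
by rewrite mu_rect// probability_setT mule1.
Qed.

Let mu_fiber B : measurable B -> (lebesgue_T \x nu)%E (snd @^-1` B) = nu B.
Proof.
move=> mB; rewrite (_ : snd @^-1` B = setT `*` B); last by apply/seteqP; split=> z //= [].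
by rewrite mu_rect// probability_setT mul1e.
Qed.

Let Py1 A : measurable A -> kappa (y1 @^-1` A) = nu A.
Proof.
move=> mA; rewrite -mu_fiber// -marg1//.
by apply: measurable_preimage mA; exact: measurable_snd.
Qed.

Let Py2 A : measurable A -> kappa (y2 @^-1` A) = nu A.
Proof.
move=> mA; rewrite -mu_fiber// -marg2//.
by apply: measurable_preimage mA; exact: measurable_snd.
Qed.

Context (Q : probability (R * R)%type R).
Hypothesis QE : forall A, Q A = kappa ((fun z => (z.1.1, z.2.1)) @^-1` A).

Let Q1 A : measurable A -> Q (fst @^-1` A) = lebT A.
Proof.
move=> mA; rewrite QE -mu_base// -marg1//.
by apply: measurable_preimage mA; exact: measurable_fst.
Qed.

Let Q2 A : measurable A -> Q (snd @^-1` A) = lebT A.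
Proof.
move=> mA; rewrite QE -mu_base// -marg2//.
by apply: measurable_preimage mA; exact: measurable_fst.
Qed.

Let E1 (f : R -> R) : bmf f -> Rintegral Q setT (fun x => f x.1) = Rintegral lebT setT f.
Proof. by apply: E_comp; [exact: measurable_fst|exact: Q1]. Qed.

Let E2 (f : R -> R) : bmf f -> Rintegral Q setT (fun x => f x.2) = Rintegral lebT setT f.
Proof. by apply: E_comp; [exact: measurable_snd|exact: Q2]. Qed.

Let mbase_t t : measurable_fun setT (base_shift t).
Proof. exact: (measurableT_comp mbase (pair1_measurable t)). Qed.

Let Q_orbit n A : measurable A -> Q (base_shift (n.+1%:R * alpha) @^-1` A) = Q A.
Proof.
move=> mA; elim: n => [|n IH].
  rewrite mul1r !QE -(PV (B := b @^-1` A)); last exact: measurable_preimage.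
  by congr (kappa _); apply/seteqP; split => z /=; rewrite -/(b z) -/(b (V z)) bV.
have mA' : measurable (base_shift (n.+1%:R * alpha) @^-1` A) by exact: measurable_preimage.
rewrite -IH !QE -(PV (B := b @^-1` (base_shift (n.+1%:R * alpha) @^-1` A))); last exact: measurable_preimage.
congr (kappa _); apply/seteqP; split => z /=; rewrite -/(b z) -/(b (V z)) bV -base_shiftD;
  by rewrite (_ : n.+2%:R * alpha = n.+1%:R * alpha + alpha)// -[n.+2%:R]natr1; ring.
Qed.

Let base_shift_int (m : int) t x : base_shift (t + m%:~R) x = base_shift t x.
Proof.
rewrite /base_shift !mulrDr !addrA.
have e (n : nat) : n%:R * m%:~R = (n%:Z * m)%:~R :> R by rewrite rmorphM.
by rewrite !e !frac_add_int.
Qed.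

(** Invariance holds at positive multiples of [alpha], and integer times act trivially since r and s
    are integers. These times are dense, and the mass of a translated rectangle is continuous in t
    because both marginals of [Q] are Lebesgue. *)
Lemma base_shift_preserving t A : measurable A -> Q (base_shift t @^-1` A) = Q A.
Proof.
have [p pE] := pushforward_probability_exists Q (mbase_t t).
move=> mA; rewrite -pE; apply: measure_eq_rectangles mA.
  by rewrite (le_lt_trans (probability_le1 p measurableT))// ltry.
move=> {}A B mA mB; rewrite [LHS]pE.
have hA : bmf (\1_A : R -> R) by exact: bmf_indic.
have hB : bmf (\1_B : R -> R) by exact: bmf_indic.
have mAB : measurable (A `*` B) by exact: measurableX.
have QAB u : fine (Q (base_shift u @^-1` (A `*` B))) =
    Rintegral Q setT (fun x => \1_A (frac (x.1 + r%:R * u)) * \1_B (frac (x.2 + s%:R * u))).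
  rewrite -Eindic; last exact: measurable_preimage.
  apply: eq_Rintegral => x _; rewrite !indicE -natrM mulnb; congr (nat_of_bool _)%:R.
  by apply/idP/andP; rewrite !inE.
apply/eqP; rewrite -[eqbLHS]fineK ?fin_num_measure//; last exact: measurable_preimage.
rewrite -[eqbRHS]fineK ?fin_num_measure// eqe -subr_eq0 -normr_le0.
apply/ler_addgt0Pr => eta eta0; rewrite add0r.
have eta2 : 0 < eta / 2 by rewrite divr_gt0.
have [D1 D10 hD1] := rotation_continuous hA eta2.
have [D2 D20 hD2] := rotation_continuous hB eta2.
have rR : 0 < r%:R :> R by rewrite ltr0n.
have sR : 0 < s%:R :> R by rewrite ltr0n.
have eps0 : 0 < Num.min (D1 / r%:R) (D2 / s%:R) by rewrite lt_min !divr_gt0.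
have [k [m [k0]]] := dense_multiples t bad eps0; case: k k0 => // n _.
set t' := n.+1%:R * alpha + m%:~R; rewrite distrC lt_min !ltr_pdivlMr// => /andP[t1 t2].
rewrite [X in _ - fine X](_ : _ = Q (base_shift t' @^-1` (A `*` B))); last first.
  rewrite (_ : base_shift t' = base_shift (n.+1%:R * alpha)) ?Q_orbit//.
  by apply/funext => x; rewrite /t' base_shift_int.
rewrite !QAB.
have hf (C : set R) (f : R * R -> R) (u : R) : bmf (\1_C : R -> R) -> measurable_fun setT f ->
    bmf (fun x => \1_C (frac (f x + u)) : R).
  move=> hC mf; apply: (bmf_comp hC); exact: (measurableT_comp (measurable_rot u)).
have I1 (C : set R) x : `|\1_C x : R| <= 1.
  by rewrite indicE; case: (_ \in _); rewrite ?normr1 ?normr0.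
have h1 := hf _ _ _ hA (@measurable_fst _ _ R R).
have h2 := hf _ _ _ hB (@measurable_snd _ _ R R).
have hr (C : set R) (u w : R) : bmf (\1_C : R -> R) ->
    bmf (fun x : R => `|\1_C (frac (x + u)) - \1_C (frac (x + w)) : R|).
  by move=> hC; apply/bmf_norm/bmfB; apply: (bmf_comp hC); exact: measurable_rot.
apply: (@le_trans _ _ (Rintegral Q setT (fun x =>
   `|\1_A (frac (x.1 + r%:R * t)) - \1_A (frac (x.1 + r%:R * t'))| +
   `|\1_B (frac (x.2 + s%:R * t)) - \1_B (frac (x.2 + s%:R * t'))|))).
  apply: Enorm_dist; [exact: bmfM|exact: bmfM| |].
    by apply: bmfD; apply/bmf_norm/bmfB.
  by move=> x; exact: prod_dist_le.
rewrite ED; [|exact/bmf_norm/bmfB|exact/bmf_norm/bmfB].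
rewrite (E1 (hr _ _ _ hA)) (E2 (hr _ _ _ hB)) (splitr eta).
apply: lerD; [apply: hD1|apply: hD2].
  by rewrite -mulrBr normrM ger0_norm ?ltW// mulrC.
by rewrite -mulrBr normrM ger0_norm ?ltW// mulrC.
Qed.

Definition fiber_shift (v1 v2 : R) (z : X * X) : X * X :=
  ((z.1.1, S v1 z.1.2), (z.2.1, S v2 z.2.2)).

Lemma measurable_fiber_shift v1 v2 : measurable_fun setT (fiber_shift v1 v2).
Proof.
have m v (f : X * X -> X) : measurable_fun setT f ->
    measurable_fun setT (fun z => ((f z).1, S v (f z).2)).
  move=> mf; apply/measurable_fun_pairP; split; first exact: (measurableT_comp (@measurable_fst _ _ _ _) mf).
  apply: (measurableT_comp (measurable_flow_time mS v)).
  exact: (measurableT_comp (@measurable_snd _ _ _ _) mf).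
by apply/measurable_fun_pairP; split; apply: m; [exact: measurable_fst|exact: measurable_snd].
Qed.

Definition fiber_invariant v1 v2 :=
  forall B, measurable B -> kappa (fiber_shift v1 v2 @^-1` B) = kappa B.

Lemma fiber_invariantB v1 v2 w1 w2 : fiber_invariant v1 v2 -> fiber_invariant w1 w2 ->
  fiber_invariant (v1 - w1) (v2 - w2).
Proof.
move=> iv iw B mB.
have mB' : measurable (fiber_shift (v1 - w1) (v2 - w2) @^-1` B).
  by apply: measurable_preimage => //; exact: measurable_fiber_shift.
rewrite -(iw _ mB') -(iv _ mB); congr (kappa _).
by apply/seteqP; split => z; rewrite /fiber_shift /= -!SD !subrK.
Qed.

(** [shift_equality] for three indicators compares [kappa] with its shift on boxes; [glue] reorders
    the coordinates so that every measurable set of X * X is seen by such boxes. *)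
Lemma witness_invariant (C v1 v2 c : R) : 0 < C -> 0 < c ->
  (forall eps, 0 < eps -> exists q t e,
    shift_witness Q base_shift alpha psi1 psi2 C v1 v2 eps c q t e) ->
  fiber_invariant v1 v2.
Proof.
move=> C0 c0 wit.
have [m mE] := pushforward_probability_exists kappa (measurable_fiber_shift v1 v2).
move=> B mB; rewrite -mE.
pose glue (p : (R * R) * (Y * Y)) : X * X := ((p.1.1, p.2.1), (p.1.2, p.2.2)).
have mglue : measurable_fun setT glue.
  apply/measurable_fun_pairP; split; apply/measurable_fun_pairP; split.
  - exact: (measurableT_comp (@measurable_fst _ _ _ _) (@measurable_fst _ _ _ _)).
  - exact: (measurableT_comp (@measurable_fst _ _ _ _) (@measurable_snd _ _ _ _)).
  - exact: (measurableT_comp (@measurable_snd _ _ _ _) (@measurable_fst _ _ _ _)).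
  - exact: (measurableT_comp (@measurable_snd _ _ _ _) (@measurable_snd _ _ _ _)).
have mB' : measurable (glue @^-1` B) by exact: measurable_preimage.
have BE : B = (fun z => (b z, (y1 z, y2 z))) @^-1` (glue @^-1` B).
  by apply/seteqP; split => -[[? ?] [? ?]].
rewrite BE; apply: measure_eq_boxes mB' => //.
  by rewrite (le_lt_trans (probability_le1 m measurableT))// ltry.
move=> A D E mA mD mE'.
have I1 dT (T : measurableType dT) (F : set T) x : `|\1_F x : R| <= 1.
  by rewrite indicE; case: (_ \in _); rewrite ?normr1 ?normr0.
have hI dT (T : measurableType dT) (F : set T) : measurable F -> bmf (\1_F : T -> R).
  by move=> mF; exact: bmf_indic.
have PQ F : measurable F -> kappa (b @^-1` F) = Q F by rewrite QE.
have h := shift_equality mb PQ my1 my2 Py1 Py2 mbase base_shiftD base_shift_preserving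
  mS S0 SD nuS mV PV erg bV y1V y2V
  (fun q => measurableT_comp (bmf_birk alpha (q * r)).1 (@measurable_fst _ _ _ _))
  (fun q => measurableT_comp (bmf_birk alpha (q * s)).1 (@measurable_snd _ _ _ _))
  C0 c0 wit (hI _ _ _ mD) (I1 _ _ _) (hI _ _ _ mE') (I1 _ _ _) (hI _ _ _ mA) (I1 _ _ _).
have mbox : measurable (b @^-1` A `&` (y1 @^-1` D `&` y2 @^-1` E)).
  by do 2! (apply: measurableI; first exact: measurable_preimage); exact: measurable_preimage.
rewrite [LHS]mE; apply/eqP; rewrite -[eqbLHS]fineK ?fin_num_measure//; last first.
  by apply: measurable_preimage => //; exact: measurable_fiber_shift.
rewrite -[eqbRHS]fineK ?fin_num_measure// eqe -!Eindic//; last first.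
  by apply: measurable_preimage => //; exact: measurable_fiber_shift.
apply/eqP; move: h.
have -> : (fun z => \1_A (b z) * (\1_D (S v1 (y1 z)) * \1_E (S v2 (y2 z))) : R) =
   \1_(fiber_shift v1 v2 @^-1` (b @^-1` A `&` (y1 @^-1` D `&` y2 @^-1` E))).
  apply/funext => z; rewrite !indicE -!natrM !mulnb; congr (nat_of_bool _)%:R.
  by apply/and3P/idP; rewrite !inE; [move=> [? ? ?]|move=> [? [? ?]]].
have -> // : (fun z => \1_A (b z) * (\1_D (y1 z) * \1_E (y2 z)) : R) =
   \1_(b @^-1` A `&` (y1 @^-1` D `&` y2 @^-1` E)).
apply/funext => z; rewrite !indicE -!natrM !mulnb; congr (nat_of_bool _)%:R.
by apply/and3P/idP; rewrite !inE; [move=> [? ? ?]|move=> [? [? ?]]].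
Qed.

(* With t = delta / q the cocycle at time q changes by delta (r^2, s^2) minus the
   numbers of jumps, which are 0 or 1 and have means r^2 delta and s^2 delta. *)
Section Jumps.
Context (c delta : R).
Hypothesis c0 : 0 < c.
Hypothesis badc : forall (n : nat) (p : int), (0 < n)%N -> c <= n%:R * `|n%:R * alpha - p%:~R|.
Hypothesis delta0 : 0 < delta.
Hypothesis delta_half : (r%:R ^+ 2 + s%:R ^+ 2) * delta <= 2^-1.
Hypothesis delta_c : (r%:R ^+ 2 + s%:R ^+ 2) * delta <= c.

Let rR : 1 <= r%:R :> R. Proof. by rewrite ler1n. Qed.
Let sR : 1 <= s%:R :> R. Proof. by rewrite ler1n. Qed.

Let jumps (n q : nat) (x : R) := crossings alpha (q * n) (n%:R * (delta / q%:R)) x.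

Let step_lt1 n q : (0 < q)%N -> n%:R ^+ 2 * delta <= 2^-1 -> 
  0 <= n%:R * (delta / q%:R) < 1.
Proof.
move=> q0 h; have qR : 1 <= q%:R :> R by rewrite ler1n.
rewrite !mulr_ge0 ?invr_ge0 ?ler0n ?(ltW delta0)//=.
apply: (@le_lt_trans _ _ (n%:R ^+ 2 * delta)); last by lra.
rewrite mulrA ler_pdivrMr ?(lt_le_trans _ qR)//.
apply: (@le_trans _ _ (n%:R ^+ 2 * delta)).
  by rewrite ler_wpM2r ?(ltW delta0)// -natrX ler_nat; case: (n) => // m; rewrite -mulnn leq_pmull.
by rewrite ler_peMr// mulr_ge0 ?exprn_ge0 ?ler0n ?(ltW delta0).
Qed.

(** The translation delta / q is chosen to make this mean number of jumps independent of q. *)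
Let total n q : (0 < q)%N -> (q * n)%:R * (n%:R * (delta / q%:R)) = n%:R ^+ 2 * delta.
Proof. by move=> q0; rewrite natrM; field; rewrite pnatr_eq0 -lt0n. Qed.

Let half_r : r%:R ^+ 2 * delta <= 2^-1.
Proof. by have := mulr_ge0 (sqr_ge0 s%:R) (ltW delta0); move: delta_half; lra. Qed.
Let half_s : s%:R ^+ 2 * delta <= 2^-1.
Proof. by have := mulr_ge0 (sqr_ge0 r%:R) (ltW delta0); move: delta_half; lra. Qed.
Let c_r : r%:R ^+ 2 * delta <= c.
Proof. by have := mulr_ge0 (sqr_ge0 s%:R) (ltW delta0); move: delta_c; lra. Qed.
Let c_s : s%:R ^+ 2 * delta <= c.
Proof. by have := mulr_ge0 (sqr_ge0 r%:R) (ltW delta0); move: delta_c; lra. Qed.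

Let jumps01 n q x : (0 < q)%N -> n%:R ^+ 2 * delta <= 2^-1 -> n%:R ^+ 2 * delta <= c ->
  jumps n q x = 0 \/ jumps n q x = 1.
Proof. by move=> q0 h hc; apply: (crossings01 _ badc); [exact: step_lt1|rewrite total]. Qed.

(** For x in {0, 1} this is the indicator of x = a, written so that it is affine in x. *)
Let pick (a : bool) (x : R) : R := if a then x else 1 - x.

Let pick01 a x : x = 0 \/ x = 1 -> 0 <= pick a x <= 1.
Proof. by case: a => -[] ->; rewrite /pick ?subr0 ?subrr ?lexx ?ler01. Qed.

Let pick_neq0 a x : x = 0 \/ x = 1 -> pick a x != 0 -> x = a%:R.
Proof. by case: a => -[] ->; rewrite /pick ?subr0 ?subrr ?eqxx. Qed.

Let pick_dist a x y : `|pick a x - pick a y| = `|x - y|.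
Proof. by case: a; rewrite /pick // distrC; congr (`|_|); ring. Qed.

Let bmf_pick a f : bmf f -> bmf (fun x : R * R => pick a (f x)).
Proof. by case: a => // hf; apply: bmfB => //; exact: bmf_cst. Qed.

Let event q a1 a2 (x : R * R) := pick a1 (jumps r q x.1) * pick a2 (jumps s q x.2).
Let mass q a1 a2 := Rintegral Q setT (event q a1 a2).

Let bmf_j1 q : bmf (fun x : R * R => jumps r q x.1).
Proof. by apply: bmf_comp; [exact: bmf_crossings|exact: measurable_fst]. Qed.
Let bmf_j2 q : bmf (fun x : R * R => jumps s q x.2).
Proof. by apply: bmf_comp; [exact: bmf_crossings|exact: measurable_snd]. Qed.
Let bmf_event q a1 a2 : bmf (event q a1 a2).
Proof. by apply: bmfM; exact: bmf_pick. Qed.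

Let mass_r q : (0 < q)%N -> mass q true true + mass q true false = r%:R ^+ 2 * delta.
Proof.
move=> q0; rewrite /mass -ED// -(total r q0) -(E_crossings alpha) -(E1 (bmf_crossings _ _ _)).
by apply: eq_Rintegral => x _; rewrite /event /pick /jumps; ring.
Qed.

Let mass_s q : (0 < q)%N -> mass q true true + mass q false true = s%:R ^+ 2 * delta.
Proof.
move=> q0; rewrite /mass -ED// -(total s q0) -(E_crossings alpha) -(E2 (bmf_crossings _ _ _)).
by apply: eq_Rintegral => x _; rewrite /event /pick /jumps; ring.
Qed.

(** Union bound: the two jump counts have means adding up to at most 1/2, by [delta_half]. *)
Let mass_none q : (0 < q)%N -> 2^-1 <= mass q false false.
Proof.
move=> q0; have hD := bmfD (bmf_j1 q) (bmf_j2 q).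
apply: (@le_trans _ _ (Rintegral Q setT (fun x => 1 - (jumps r q x.1 + jumps s q x.2)))).
  rewrite EB//; last exact: bmf_cst.
  rewrite Ecst ED// (E1 (bmf_crossings _ _ _)) (E2 (bmf_crossings _ _ _)) !E_crossings !total//.
  by move: delta_half; rewrite mulrDl; lra.
apply: Ele => // [|x]; first by apply: bmfB => //; exact: bmf_cst.
rewrite /event /pick.
have [->|->] := jumps01 x.1 q0 half_r c_r; have [->|->] := jumps01 x.2 q0 half_s c_s; lra.
Qed.

Let good (M q : nat) := [/\ (0 < q)%N, (M <= q)%N & exists2 p : int, coprimez q p &
    `|q%:R * alpha - p%:~R| <= q%:R^-1].

Let good_exists M : exists q, good M q.
Proof.
have [q [p [q0 Mq qp hq]]] := dirichlet_large M bad.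
by exists q; split => //; exists p.
Qed.

Let mass_invariant a1 a2 c' : 0 < c' ->
  (forall M, exists2 q, good M q & c' <= mass q a1 a2) ->
  fiber_invariant (r%:R ^+ 2 * delta - a1%:R) (s%:R ^+ 2 * delta - a2%:R).
Proof.
(* Denjoy-Koksma on r and on s blocks of length q gives the bounds 3 r and 3 s; their sum serves
   both. *)
move=> c'0 often; apply: (@witness_invariant (3 * (r%:R + s%:R)) _ _ c') => //.
  by rewrite mulr_gt0//; move: rR sR; lra.
move=> eps eps0.
(* [K / q] dominates both the translation delta / q and the defect of invariance 2 (r^2 + s^2) delta
   / q of the event. *)
pose K := (2 * (r%:R ^+ 2 + s%:R ^+ 2) + 1) * delta.
have K0 : 0 < K.
  by rewrite mulr_gt0// ltr_wpDl// mulr_ge0// addr_ge0// sqr_ge0.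
have [q [q0 Mq [p qp hq]] hmass] := often (Num.truncn (K / eps)).+1.
have qR : 0 < q%:R :> R by rewrite ltr0n.
have Kq : K / q%:R < eps.
  rewrite ltr_pdivrMr// mulrC -ltr_pdivrMr//; apply: lt_le_trans (truncnS_gt _) _.
  by rewrite ler_nat.
exists q, (delta / q%:R), (event q a1 a2).
have j1 x := jumps01 x q0 half_r c_r; have j2 x := jumps01 x q0 half_s c_s.
split.
- split=> //; rewrite ger0_norm; last by rewrite divr_ge0// ltW.
  apply: le_lt_trans Kq; rewrite ler_pM2r ?invr_gt0// /K ler_peMl ?(ltW delta0)//.
  by rewrite lerDr mulr_ge0// addr_ge0// sqr_ge0.
- split=> x.
    apply: le_trans (birk_block_bound r q0 qp hq _) _.
    by rewrite ler_pM2l// lerDl ler0n.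
  apply: le_trans (birk_block_bound s q0 qp hq _) _.
  by rewrite ler_pM2l// lerDr ler0n.
- split=> // x; have /andP[? ?] := pick01 a1 (j1 x.1); have /andP[? ?] := pick01 a2 (j2 x.2).
  by rewrite /event mulr_ge0// mulr_ile1.
- split=> x.
    by rewrite /event /base_shift /= !mulr0 !addr0 /jumps !crossings_frac.
  rewrite /event mulf_eq0 negb_or => /andP[e1 e2].
  have := pick_neq0 (j1 x.1) e1; have := pick_neq0 (j2 x.2) e2.
  rewrite /jumps !crossings_birk !total// => h2 h1.
  rewrite /psi1 /psi2 /base_shift /=.
  have bf n y : birk alpha n (frac y) = birk alpha n y.
    by rewrite -[frac y]addr0 birk_frac addr0.
  by rewrite !bf -h1 -h2; split; ring.
- split => //.
  have d1 : bmf (fun x : R => `|jumps r q (frac (x + r%:R * alpha)) - jumps r q x|).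
    apply/bmf_norm/bmfB; last exact: bmf_crossings.
    by apply: (bmf_comp (bmf_crossings _ _ _)); exact: measurable_rot.
  have d2 : bmf (fun x : R => `|jumps s q (frac (x + s%:R * alpha)) - jumps s q x|).
    apply/bmf_norm/bmfB; last exact: bmf_crossings.
    by apply: (bmf_comp (bmf_crossings _ _ _)); exact: measurable_rot.
  have d1' := bmf_comp d1 (@measurable_fst _ _ R R).
  have d2' := bmf_comp d2 (@measurable_snd _ _ R R).
  apply: (@le_trans _ _ (Rintegral Q setT (fun x =>
    `|jumps r q (frac (x.1 + r%:R * alpha)) - jumps r q x.1| +
    `|jumps s q (frac (x.2 + s%:R * alpha)) - jumps s q x.2|))).
    apply: Ele.
    + by apply/bmf_norm/bmfB => //; apply: (bmf_comp (bmf_event q a1 a2)).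
    + exact: bmfD.
    move=> x; rewrite -[X in _ <= X + _](pick_dist a1) -[X in _ <= _ + X](pick_dist a2).
    apply: prod_dist_le.
      by have /andP[? ?] := pick01 a2 (j2 (frac (x.2 + s%:R * alpha))); rewrite ger0_norm.
    by have /andP[? ?] := pick01 a1 (j1 x.1); rewrite ger0_norm.
  rewrite ED// (E1 d1) (E2 d2).
  apply: le_trans (ltW Kq).
  (* One step of [V] rotates the coordinate n times, hence the second factor n beside that of the
     jump length. *)
  have sh n : n%:R ^+ 2 * delta <= 2^-1 ->
      Rintegral lebT setT (fun x : R => `|jumps n q (frac (x + n%:R * alpha)) - jumps n q x|) <=
      2 * n%:R * (n%:R * (delta / q%:R)).
    move=> h; apply: le_trans (crossings_shift alpha (q * n) n (step_lt1 q0 h)).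
    rewrite le_eqVlt; apply/orP; left; apply/eqP; apply: eq_Rintegral => x _.
    by rewrite /jumps crossings_frac.
  apply: le_trans (lerD (sh _ half_r) (sh _ half_s)) _.
  rewrite (_ : _ + _ = 2 * (r%:R ^+ 2 + s%:R ^+ 2) * delta / q%:R); last by ring.
  by rewrite ler_pM2r ?invr_gt0// ler_pM2r// lerDl.
Qed.

Lemma unit_shifts_jumps : fiber_invariant 1 0 /\ fiber_invariant 0 1.
Proof.
have i00 : fiber_invariant (r%:R ^+ 2 * delta - false%:R) (s%:R ^+ 2 * delta - false%:R).
  apply: (@mass_invariant false false 2^-1) => // M.
  by have [q gq] := good_exists M; exists q => //; apply: mass_none; case: gq.
have iB a1 a2 : fiber_invariant (r%:R ^+ 2 * delta - a1%:R) (s%:R ^+ 2 * delta - a2%:R) ->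
    fiber_invariant a1%:R a2%:R.
  by move=> /(fiber_invariantB i00); rewrite !subr0 !subKr.
(* Contrapositive form: if [kappa] is not invariant under an integer shift, the mass of its event
   tends to 0 along the good q. *)
have small (a1 a2 : bool) c' : ~ fiber_invariant a1%:R a2%:R -> 0 < c' ->
    exists M, forall q, good M q -> mass q a1 a2 < c'.
  move=> ninv c'0; apply: contrapT => /forallNP h; apply: ninv; apply: iB.
  apply: (mass_invariant c'0) => M; have /existsNP[q /not_implyP[gq /negP]] := h M.
  by rewrite -leNgt; exists q.
have rd : 0 < r%:R ^+ 2 * delta by rewrite mulr_gt0// exprn_gt0// ltr0n.
have sd : 0 < s%:R ^+ 2 * delta by rewrite mulr_gt0// exprn_gt0// ltr0n.
have good_mono M M' q : (M <= M')%N -> good M' q -> good M q.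
  by move=> MM' [? ? ?]; split => //; apply: leq_trans MM' _.
have [i11|n11] := pselect (fiber_invariant true%:R true%:R); last first.
  (* The event (1, 1) becomes negligible, so (1, 0) and (0, 1) inherit the fixed positive masses r^2
     delta and s^2 delta. *)
  have inv (a1 a2 : bool) w : 0 < w ->
      (forall q, (0 < q)%N -> mass q true true + mass q a1 a2 = w) -> fiber_invariant a1%:R a2%:R.
    move=> w0 hw; apply: contrapT => ninv; have w2 : 0 < w / 2 by rewrite divr_gt0.
    have [M1 h1] := small _ _ _ n11 w2; have [M2 h2] := small _ _ _ ninv w2.
    have [q gq] := good_exists (maxn M1 M2).
    have := h1 q (good_mono _ _ _ (leq_maxl _ _) gq).
    have := h2 q (good_mono _ _ _ (leq_maxr _ _) gq).
    by have [q0 _ _] := gq; have := hw q q0; lra.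
  split; first exact: (inv true false _ rd mass_r).
  exact: (inv false true _ sd mass_s).
have [i10|n10] := pselect (fiber_invariant true%:R false%:R).
  by split => //; have := fiber_invariantB i11 i10; rewrite /= subrr subr0.
have [i01|n01] := pselect (fiber_invariant false%:R true%:R).
  by split => //; have := fiber_invariantB i11 i01; rewrite /= subrr subr0.
(* In the last case (1, 0) and (0, 1) would both become negligible, although their masses always
   differ by (r^2 - s^2) delta. *)
have rsd : r%:R ^+ 2 * delta != s%:R ^+ 2 * delta :> R.
  rewrite (inj_eq (mulIf (lt0r_neq0 delta0))) eqrXn2 ?ler0n// eqr_nat.
  exact/eqP.
pose w := `|r%:R ^+ 2 * delta - s%:R ^+ 2 * delta| / 2.
have w0 : 0 < w by rewrite divr_gt0// normr_gt0 subr_eq0.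
have [M1 h1] := small true false _ n10 w0; have [M2 h2] := small false true _ n01 w0.
have [q gq] := good_exists (maxn M1 M2).
have := h1 q (good_mono _ _ _ (leq_maxl _ _) gq).
have := h2 q (good_mono _ _ _ (leq_maxr _ _) gq).
have [q0 _ _] := gq.
have nonneg a1 a2 : 0 <= mass q a1 a2.
  apply: Ege0 => x.
  have /andP[? _] := pick01 a1 (jumps01 x.1 q0 half_r c_r).
  have /andP[? _] := pick01 a2 (jumps01 x.2 q0 half_s c_s).
  exact: mulr_ge0.
have p1 := nonneg true false; have p2 := nonneg false true.
have e1 := mass_r q0; have e2 := mass_s q0.
have : `|r%:R ^+ 2 * delta - s%:R ^+ 2 * delta| = w * 2 by rewrite /w divfK.
rewrite -e1 -e2 opprD addrACA subrr add0r => ew m2 m1; exfalso.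
have : `|mass q true false - mass q false true| < w * 2.
  by rewrite ltr_norml; apply/andP; split; lra.
by rewrite ew ltxx.
Qed.

End Jumps.

Lemma unit_shifts_invariant : fiber_invariant 1 0 /\ fiber_invariant 0 1.
Proof.
have [c c0 badc] := bad.
have rs0 : 0 < r%:R ^+ 2 + s%:R ^+ 2 :> R by rewrite addr_gt0// exprn_gt0// ltr0n.
(* The bound 1/2 keeps the event of no jump heavy; the bound c excludes a second jump. *)
pose delta : R := Num.min 2^-1 c / (r%:R ^+ 2 + s%:R ^+ 2).
have dE : (r%:R ^+ 2 + s%:R ^+ 2) * delta = Num.min 2^-1 c by rewrite mulrC divfK// gt_eqF.
apply: (@unit_shifts_jumps c delta) => //.
- by rewrite divr_gt0// lt_min c0 andbT invr_gt0.
- by rewrite dE ge_min lexx.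
- by rewrite dE ge_min lexx orbT.
Qed.

End Joining.

(** * Disjointness *)

(** Time n / r of the base flow fixes the first circle and rotates the second by s n / r; for this n
    the rotation is j / r modulo 1. *)
Lemma bezout_residue (r s j : nat) : (0 < s)%N -> coprime r s ->
  exists n m : nat, (s * n = j + m * r)%N.
Proof.
move=> s0 co; case: (egcdnP r s0) => km kn e _.
exists (km * j)%N, (kn * j)%N; rewrite mulnA [(s * km)%N]mulnC e.
by rewrite gcdnC (eqP co) mulnDl mul1n addnC mulnAC.
Qed.

Section Averaging.
Context {R : realType} d (Y : measurableType d) (nu : probability Y R) (W : Y -> Y).
Hypothesis mW : measurable_fun setT W.
Hypothesis nuW : forall A, measurable A -> nu (W @^-1` A) = nu A.
Hypothesis ergW : forall A, measurable A -> W @^-1` A = A -> nu A = 0%E \/ nu A = 1%E.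

Lemma product_law dT (T : measurableType dT) (P : probability T R) (h : T -> R * Y) (f : R * Y -> R) :
  measurable_fun setT h ->
  (forall A, measurable A -> P (h @^-1` A) = product_measure1 (@lebT R) nu A) -> bmf f ->
  Rintegral P setT (fun z => f (h z)) =
  Rintegral lebT setT (fun x => Rintegral nu setT (fun y => f (x, y))).
Proof.
move=> mh hE hf; rewrite (E_comp (Q := product_measure1 (@lebT R) nu) mh hE hf).
exact: (E_prod12 (@lebT R) nu hf).
Qed.

(* By the ergodic theorem on almost every fibre, an integral that is invariant under
   the fibre map W only sees the fibre averages. *)
Lemma fiber_average dT (T : measurableType dT) (P : probability T R) (h : T -> R * Y)
    (g : T -> R) (f : R * Y -> R) :
  measurable_fun setT h ->
  (forall A, measurable A -> P (h @^-1` A) = product_measure1 (@lebT R) nu A) ->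
  bmf g ->
  (forall f : R * Y -> R, bmf f -> Rintegral P setT (fun z => f ((h z).1, W (h z).2) * g z) =
     Rintegral P setT (fun z => f (h z) * g z)) ->
  bmf f ->
  Rintegral P setT (fun z => f (h z) * g z) =
  Rintegral P setT (fun z => Rintegral nu setT (fun y => f ((h z).1, y)) * g z).
Proof.
move=> mh hE hg inv hf.
have miter n : measurable_fun setT (fun p : R * Y => (p.1, iter n W p.2)).
  apply/measurable_fun_pairP; split; first exact: measurable_fst.
  exact: (measurableT_comp (measurable_iter n mW) (@measurable_snd _ _ _ _)).
have hfi n : bmf (fun p : R * Y => f (p.1, iter n W p.2)) by exact: (bmf_comp hf).
have inv_iter n : Rintegral P setT (fun z => f ((h z).1, iter n W (h z).2) * g z) =
    Rintegral P setT (fun z => f (h z) * g z).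
  elim: n => [|n <-]; first by apply: eq_Rintegral => z _; case: (h z).
  rewrite -(inv _ (hfi n)) /=; apply: eq_Rintegral => z _.
  by rewrite -iterSr.
pose f0 (p : R * Y) := Rintegral nu setT (fun y => f (p.1, y)).
have hf0 : bmf f0.
  by apply: (bmf_comp (bmf_E2 (@lebT R) nu hf)); exact: measurable_fst.
pose D n (x : R) := Rintegral nu setT (fun y =>
  `|n.+1%:R^-1 * bsum W (fun y => f (x, y)) n.+1 y - Rintegral nu setT (fun y => f (x, y))|).
pose A n (p : R * Y) := n.+1%:R^-1 * \sum_(i < n.+1) f (p.1, iter i W p.2).
have hA n : bmf (A n) by apply: bmfM; [exact: bmf_cst|exact: bmf_sum].
have hAf n : bmf (fun p => `|A n p - f0 p|) by apply/bmf_norm/bmfB.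
have [M M0 hM] := bmf_bound hg; have [K K0 hK] := bmf_bound hf.
have hgh (k : R * Y -> R) : bmf k -> bmf (fun z => k (h z) * g z).
  by move=> hk; apply: bmfM => //; exact: bmf_comp.
have key n : `|Rintegral P setT (fun z => f (h z) * g z) -
    Rintegral P setT (fun z => f0 (h z) * g z)| <= M * Rintegral lebT setT (D n).
  have -> : Rintegral P setT (fun z => f (h z) * g z) =
      Rintegral P setT (fun z => A n (h z) * g z).
    transitivity (n.+1%:R^-1 * \sum_(i < n.+1)
        Rintegral P setT (fun z => f ((h z).1, iter i W (h z).2) * g z)).
      rewrite (eq_bigr (fun=> Rintegral P setT (fun z => f (h z) * g z))) => [|i _].
        by rewrite sumr_const card_ord -[X in _ = _ * X]mulr_natl mulKf// pnatr_eq0.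
      exact: inv_iter.
    rewrite -Esum; last by move=> i; exact: (hgh _ (hfi i)).
    rewrite -EZl; last by apply: bmf_sum => i; exact: (hgh _ (hfi i)).
    by apply: eq_Rintegral => z _; rewrite /A -mulrA mulr_suml.
  have -> : Rintegral lebT setT (D n) = Rintegral P setT (fun z => `|A n (h z) - f0 (h z)|).
    by rewrite (product_law mh hE (hAf n)).
  rewrite -EZl; last exact: (bmf_comp (hAf n)).
  apply: Enorm_dist; [exact: hgh|exact: hgh| |].
    by apply: bmfM; [exact: bmf_cst|exact: (bmf_comp (hAf n))].
  by move=> z; rewrite -mulrBl normrM mulrC ler_wpM2r.
have cD : (fun n => Rintegral lebT setT (D n)) @ \oo --> (0 : R).
  rewrite -[X in _ --> X](@Ecst _ _ _ (@lebT R) 0).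
  apply: (@E_cvg _ _ _ (@lebT R) D (fun=> 0) (2 * K)).
  - by move=> n; exact: (bmf_E2 (@lebT R) nu (hAf n)).
  - exact: bmf_cst.
  - move=> n x; apply: Enorm_le; first exact: (bmf_pair1 x (hAf n)).
    have f0K : `|Rintegral nu setT (fun y => f (x, y))| <= K.
      by apply: Enorm_le => //; exact: bmf_pair1.
    move=> y; rewrite normr_id; apply: le_trans (ler_normB _ _) _.
    rewrite mulrDl mul1r lerD// normrM ger0_norm ?invr_ge0// mulrC ler_pdivrMr ?ltr0n//.
    apply: le_trans (ler_norm_sum _ _ _) _.
    by apply: le_trans (ler_sum _ (fun i _ => hK _)) _; rewrite sumr_const card_ord mulr_natr.
  - by apply: filterE => x; apply: (birkhoff mW nuW ergW); exact: bmf_pair1.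
apply/eqP; rewrite -subr_eq0 -normr_le0; apply/ler_addgt0Pr => eta eta0; rewrite add0r.
have /cvgr0Pnorm_lt/(_ _ (divr_gt0 eta0 M0)) [n _ /(_ n (leqnn n)) hn] := cD.
apply: le_trans (key n) _; rewrite mulrC -ler_pdivlMr//.
by apply: le_trans (ltW hn); exact: ler_norm.
Qed.

End Averaging.

(** * Correlations of bounded functions *)

Section BoundedFunctions.
Context {R : realType} (alpha : R) d (Y : measurableType d) (nu : probability Y R)
  (S : R -> Y -> Y).
Let X := (R * Y)%type.
Let Rm := @skew_flow R d Y alpha S.
Hypothesis bad : badly_approximable alpha.
Hypothesis mS : measurable_fun setT (fun p : R * Y => S p.1 p.2).
Hypothesis S0 : forall y, S 0 y = y.
Hypothesis SD : forall s t y, S (s + t) y = S s (S t y).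
Hypothesis nuS : forall t A, measurable A -> nu (S t @^-1` A) = nu A.
Hypothesis noev : forall k : nat, ~ flow_eigenvalue nu S k%:R.

Let mean (f : X -> R) := Rintegral lebT setT (fun x => Rintegral nu setT (fun y => f (x, y))).

(** Once both functions are replaced by fibre averages, rotating the second circle by any tau
    changes the correlation little; averaging over tau produces the product of the means. *)
Lemma bounded_aop (f g : X -> R) : bmf f -> bmf g -> forall eta, 0 < eta ->
  exists N : nat, forall r s : nat, coprime r s -> (0 < r)%N -> (0 < s)%N -> r <> s -> (N <= r)%N ->
  forall kappa : probability (X * X)%type R,
    is_joining (lebesgue_T \x nu)%E kappa (iter r Rm) (iter s Rm) ->
    ergodic_measure kappa (fun z : X * X => (iter r Rm z.1, iter s Rm z.2)) ->
    `|Rintegral kappa setT (fun z => f z.1 * g z.2) - mean f * mean g| <= eta.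
Proof.
move=> hf hg eta eta0.
pose f0 x := Rintegral nu setT (fun y => f (x, y)).
pose g0 x := Rintegral nu setT (fun y => g (x, y)).
have hf0 : bmf f0 by exact: (bmf_E2 (@lebT R) nu hf).
have hg0 : bmf g0 by exact: (bmf_E2 (@lebT R) nu hg).
have [M M0 hM] := bmf_bound hf0.
have [D D0 hD] := rotation_continuous hg0 (divr_gt0 eta0 M0).
(* For r beyond this bound 1 / r <= D, so a rotation by less than 1 / r hardly changes [g0] in
   L1. *)
exists (Num.truncn D^-1).+1 => r s co r0 s0 rs Nr kappa joins erg.
have mb : measurable_fun setT (fun z : X * X => (z.1.1, z.2.1)).
  apply/measurable_fun_pairP; split.
    exact: (measurableT_comp (@measurable_fst _ _ _ _) (@measurable_fst _ _ _ _)).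
  exact: (measurableT_comp (@measurable_fst _ _ _ _) (@measurable_snd _ _ _ _)).
have [Q QE] := pushforward_probability_exists kappa mb.
have [inv1 inv2] := unit_shifts_invariant bad mS S0 SD nuS r0 s0 rs joins erg QE.
have Qbase := base_shift_preserving bad SD r0 s0 joins QE.
have [marg1 marg2 _] := joins.
have law1 A : measurable A -> kappa (fst @^-1` A) = product_measure1 (@lebT R) nu A.
  by move=> mA; rewrite -[RHS](marg1 _ mA); congr (kappa _); apply/seteqP; split=> z //= [].
have law2 A : measurable A -> kappa (snd @^-1` A) = product_measure1 (@lebT R) nu A.
  by move=> mA; rewrite -[RHS](marg2 _ mA); congr (kappa _); apply/seteqP; split=> z //= [].
have mS1 := measurable_flow_time mS 1.
have ergS := time_one_ergodic mS S0 SD nuS noev.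
have hfst (k : X -> R) : bmf k -> bmf (fun z : X * X => k z.1) by move=> hk; apply: (bmf_comp hk); exact: measurable_fst.
have hsnd (k : X -> R) : bmf k -> bmf (fun z : X * X => k z.2) by move=> hk; apply: (bmf_comp hk); exact: measurable_snd.
have mx1 : measurable_fun setT (fun z : X * X => z.1.1).
  exact: (measurableT_comp (@measurable_fst _ _ _ _) (@measurable_fst _ _ _ _)).
have e1 : Rintegral kappa setT (fun z => f z.1 * g z.2) =
    Rintegral kappa setT (fun z => f0 z.1.1 * g z.2).
  apply: (fiber_average mS1 (nuS 1) ergS (@measurable_fst _ _ _ _) law1 (hsnd _ hg) _ hf) => k hk.
  have hkg : bmf (fun z : X * X => k z.1 * g z.2) by apply: bmfM; [exact: hfst|exact: hsnd].
  rewrite -[RHS](E_comp (measurable_fiber_shift mS 1 0) inv1 hkg).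
  by apply: eq_Rintegral => -[[? ?] [? ?]] _; rewrite /= S0.
have e2 : Rintegral kappa setT (fun z => f0 z.1.1 * g z.2) =
    Rintegral kappa setT (fun z => f0 z.1.1 * g0 z.2.1).
  under eq_Rintegral do rewrite mulrC.
  under [RHS]eq_Rintegral do rewrite mulrC.
  apply: (fiber_average mS1 (nuS 1) ergS (@measurable_snd _ _ _ _) law2 (bmf_comp hf0 mx1) _ hg) => k hk.
  have hkg : bmf (fun z : X * X => k z.2 * f0 z.1.1).
    by apply: bmfM; [exact: hsnd|exact: (bmf_comp hf0)].
  rewrite -[RHS](E_comp (measurable_fiber_shift mS 0 1) inv2 hkg).
  by apply: eq_Rintegral => -[[? ?] [? ?]] _.
(* [frac] makes the identities for [base_shift] hold at every point; the integral does not change,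
   by invariance under [base_shift] at time 0. *)
pose H (w : R) (x : R * R) := f0 (frac x.1) * g0 (frac (x.2 + w)).
have mrot (h : R * R -> R) (w : R) : measurable_fun setT h ->
    measurable_fun setT (fun x => frac (h x + w)).
  by move=> mh; exact: (measurableT_comp (measurable_rot w) mh).
have hH w : bmf (H w).
  apply: bmfM; last by apply: (bmf_comp hg0); apply: mrot; exact: measurable_snd.
  apply: (bmf_comp hf0); exact: (measurableT_comp measurable_frac (@measurable_fst _ _ _ _)).
have mbase t : measurable_fun setT (base_shift (R := R) r s t).
  by apply/measurable_fun_pairP; split; apply: mrot; [exact: measurable_fst|exact: measurable_snd].
have PQ A : measurable A -> kappa ((fun z : X * X => (z.1.1, z.2.1)) @^-1` A) = Q A by rewrite QE.
have e3 : Rintegral kappa setT (fun z => f0 z.1.1 * g0 z.2.1) = Rintegral Q setT (H 0).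
  have hfg : bmf (fun x : R * R => f0 x.1 * g0 x.2).
    by apply: bmfM; [apply: (bmf_comp hf0); exact: measurable_fst|apply: (bmf_comp hg0); exact: measurable_snd].
  rewrite (E_comp mb PQ hfg) -(E_comp (mbase 0) (Qbase 0) hfg).
  by apply: eq_Rintegral => x _; rewrite /H /base_shift /= !mulr0 !addr0.
have Q1 A : measurable A -> Q (fst @^-1` A) = lebT A.
  move=> mA; rewrite QE; transitivity (product_measure1 (@lebT R) nu (A `*` setT)).
    rewrite -law1; last exact: measurableX.
    by congr (kappa _); apply/seteqP; split=> z //= [].
  by rewrite [LHS](product_measure1E (@lebT R) nu)// [X in (_ * X)%E]probability_setT mule1.
have Q2 A : measurable A -> Q (snd @^-1` A) = lebT A.
  move=> mA; rewrite QE; transitivity (product_measure1 (@lebT R) nu (A `*` setT)).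
    rewrite -law2; last exact: measurableX.
    by congr (kappa _); apply/seteqP; split=> z //= [].
  by rewrite [LHS](product_measure1E (@lebT R) nu)// [X in (_ * X)%E]probability_setT mule1.
have rR : 0 < r%:R :> R by rewrite ltr0n.
have close tau : 0 <= tau < 1 -> `|Rintegral Q setT (H 0) - Rintegral Q setT (H tau)| <= eta.
  move=> /andP[tau0 tau1]; pose j := Num.truncn (r%:R * tau).
  have /andP[j1 j2] : j%:R <= r%:R * tau < j.+1%:R by apply: truncn_itv; rewrite mulr_ge0// ltW.
  have [n [m nm]] := bezout_residue j s0 co.
  (* Split tau into a multiple of 1 / r, which acts through an invariant translation of the base,
     and a remainder w in [0, 1 / r). *)
  pose w := tau - j%:R / r%:R.
  have w0 : 0 <= w by rewrite subr_ge0 ler_pdivrMr// mulrC.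
  have wD : `|w - 0| < D.
    rewrite subr0 ger0_norm//; apply: (@lt_le_trans _ _ r%:R^-1).
      by rewrite /w ltrBlDr -[X in X + _]mul1r -mulrDl addrC natr1 ltr_pdivlMr// mulrC.
    rewrite invf_ple ?posrE//; apply: (@le_trans _ _ (Num.truncn D^-1).+1%:R).
      exact/ltW/truncnS_gt.
    by rewrite ler_nat.
  have -> : Rintegral Q setT (H tau) = Rintegral Q setT (H w).
    rewrite -(E_comp (mbase (n%:R / r%:R)) (Qbase (n%:R / r%:R)) (hH w)).
    apply: eq_Rintegral => x _; rewrite /H /base_shift /=.
    have -> : frac (frac (x.1 + r%:R * (n%:R / r%:R))) = frac x.1.
      rewrite [LHS]frac_id ?frac_ge0 ?frac_lt1// -(frac_add_int x.1 n%:Z); congr frac.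
      by rewrite mulrC divfK// gt_eqF.
    congr (_ * g0 _).
    rewrite frac_addl -(frac_add_int (x.2 + tau) (m%:Z)); congr frac.
    have -> : s%:R * (n%:R / r%:R) = j%:R / r%:R + m%:R :> R.
      by rewrite mulrA -natrM nm natrD natrM mulrDl mulfK// gt_eqF.
    by rewrite /w; ring.
  have hgw : bmf (fun x : R => `|g0 (frac (x + w)) - g0 (frac (x + 0))|).
    by apply/bmf_norm/bmfB; apply: (bmf_comp hg0); exact: measurable_rot.
  rewrite distrC; apply: (@le_trans _ _ (M * Rintegral lebT setT (fun x : R => `|g0 (frac (x + w)) - g0 (frac (x + 0))|))); last first.
    by rewrite mulrC -ler_pdivlMr//; exact: hD.
  rewrite -(E_comp (@measurable_snd _ _ R R) Q2 hgw) -EZl; last first.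
    by apply: (bmf_comp hgw); exact: measurable_snd.
  apply: Enorm_dist => //.
    by apply: bmfM; [exact: bmf_cst|apply: (bmf_comp hgw); exact: measurable_snd].
  by move=> x; rewrite -mulrBr normrM ler_wpM2r.
have hHH : bmf (fun p : R * (R * R) => H p.1 p.2).
  apply: bmfM.
    apply: (bmf_comp hf0); apply: (measurableT_comp measurable_frac).
    exact: (measurableT_comp (@measurable_fst _ _ _ _) (@measurable_snd _ _ _ _)).
  apply: (bmf_comp hg0); apply: (measurableT_comp measurable_frac); apply: measurable_funD.
    exact: (measurableT_comp (@measurable_snd _ _ _ _) (@measurable_snd _ _ _ _)).
  exact: measurable_fst.
have avg : mean f * mean g = Rintegral lebT setT (fun tau => Rintegral Q setT (H tau)).
  rewrite (E_fubini (@lebT R) Q hHH) /=.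
  have hff : bmf (fun x : R => f0 (frac x)) by apply: (bmf_comp hf0); exact: measurable_frac.
  rewrite -/f0 -/g0 /mean -/f0 -/g0 -(E_rot 0 hf0).
  have -> : Rintegral lebT setT (fun x : R => f0 (frac (x + 0))) = Rintegral Q setT (fun x => f0 (frac x.1)).
    rewrite (E_comp (@measurable_fst _ _ R R) Q1 hff).
    by apply: eq_Rintegral => x _; rewrite addr0.
  rewrite -EZr; last by apply: (bmf_comp hff); exact: measurable_fst.
  apply: eq_Rintegral => x _; rewrite /H EZl.
    congr (_ * _); rewrite -(E_rot x.2 hg0).
    by apply: eq_Rintegral => t _; rewrite addrC.
  apply: (bmf_comp hg0); apply: (measurableT_comp measurable_frac).
  by apply: measurable_funD; [exact: measurable_cst|].
rewrite e1 e2 e3 avg -[X in X - _](@Ecst _ _ _ (@lebT R)).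
have hHt : bmf (fun tau => Rintegral Q setT (H tau)) by exact: (bmf_E2 (@lebT R) Q hHH).
have hc : bmf (fun _ : R => Rintegral Q setT (H 0)) by exact: bmf_cst.
have hB := bmfB hc hHt.
rewrite -(EB _ hc hHt).
apply: le_trans (Enorm _ hB) _; rewrite -[leRHS](@Ecst _ _ _ (@lebT R)).
by apply: Ele_unit; [exact: bmf_norm|exact: bmf_cst|exact: close].
Qed.

End BoundedFunctions.

(** * From bounded to square-integrable functions *)

Lemma Rintegral_comp {R : realType} d d' (T : measurableType d) (U : measurableType d')
    (P : probability T R) (Q : probability U R) (h : T -> U) (f : U -> R) :
  measurable_fun setT h -> (forall A, measurable A -> P (h @^-1` A) = Q A) ->
  Q.-integrable setT (EFin \o f) ->
  P.-integrable setT (EFin \o (f \o h)) /\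
  Rintegral P setT (fun x => f (h x)) = Rintegral Q setT f.
Proof.
move=> mh PQ intf.
have mf : measurable_fun setT (EFin \o f) by exact: measurable_int intf.
have intfh : P.-integrable setT (EFin \o (f \o h)).
  apply/integrableP; split; first exact: (measurableT_comp mf mh).
  have /integrableP[_] := intf; apply: le_lt_trans.
  rewrite le_eqVlt; apply/orP; left; apply/eqP.
  transitivity (\int[pushforward P h]_y `|(EFin \o f) y|)%E.
    by rewrite ge0_integral_pushforward//; exact: measurableT_comp.
  by apply: eq_measure_integral => A mA _ /=; rewrite /pushforward PQ.
split => //; congr fine.
transitivity (\int[pushforward P h]_y (EFin \o f) y)%E; first by rewrite integral_pushforward.
by apply: eq_measure_integral => A mA _ /=; rewrite /pushforward PQ.
Qed.

Lemma AMGM2_sum {R : realType} (a b : R) : `|a| * `|b| <= `|a| ^+ 2 + `|b| ^+ 2.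
Proof.
by have := sqr_ge0 (`|a| - `|b|); have := normr_ge0 a; have := normr_ge0 b; nra.
Qed.

Lemma scaled_AMGM {R : realType} (K a b : R) : 0 < K ->
  a * b <= (K * a ^+ 2 + K^-1 * b ^+ 2) / 2.
Proof.
move=> K0; rewrite ler_pdivlMr// -subr_ge0.
rewrite (_ : _ - _ = K^-1 * (K * a - b) ^+ 2); last by field; rewrite gt_eqF.
by rewrite mulr_ge0 ?invr_ge0 ?sqr_ge0// ltW.
Qed.

(** Young's inequality in place of Cauchy-Schwarz: the bound separates the variables, so it can be
    integrated from the marginals alone. A large K multiplies the small truncation errors and its
    inverse the fixed norms. *)
Lemma young_split {R : realType} (K a a' b b' : R) : 0 < K -> `|a'| <= `|a| ->
  `|a * b - a' * b'| <= (K * (a - a') ^+ 2 + K^-1 * a ^+ 2) / 2 +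
                        (K * (b - b') ^+ 2 + K^-1 * b ^+ 2) / 2.
Proof.
move=> K0 ha; rewrite (_ : a * b - _ = (a - a') * b + a' * (b - b')); last by ring.
apply: le_trans (ler_normD _ _) _; rewrite !normrM.
have h1 := scaled_AMGM `|a - a'| `|b| K0.
have h2 : `|a'| * `|b - b'| <= (K * `|b - b'| ^+ 2 + K^-1 * `|a| ^+ 2) / 2.
  by apply: le_trans (scaled_AMGM _ _ K0); rewrite mulrC ler_wpM2l.
move: h1 h2; rewrite !real_normK ?num_real//.
by move=> h1 h2; apply: le_trans (lerD h1 h2) _; rewrite -subr_ge0 le_eqVlt; apply/orP; left; apply/eqP; ring.
Qed.

Section Truncation.
Context {R : realType} d (X : measurableType d) (mu : probability X R).

Let integrable_dom (f g : X -> R) : measurable_fun setT f ->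
  mu.-integrable setT (EFin \o g) -> (forall x, `|f x| <= g x) -> mu.-integrable setT (EFin \o f).
Proof.
move=> mf ig fg; apply: le_integrable ig => //; first exact/measurable_EFinP.
by move=> x _ /=; rewrite lee_fin (le_trans (fg x))// ler_norm.
Qed.

Definition truncation (n : nat) (F : X -> R) (x : X) := \1_[set x | `|F x| <= n%:R] x * F x.

Lemma truncation_cases n F x :
  `|F x| <= n%:R /\ truncation n F x = F x \/ n%:R < `|F x| /\ truncation n F x = 0.
Proof.
rewrite /truncation indicE; have [h|h] := leP (`|F x|) n%:R; [left|right]; split => //.
  by rewrite mem_set// mul1r.
by rewrite memNset ?mul0r//=; apply/negP; rewrite -ltNge.
Qed.

Lemma bmf_truncation n F : measurable_fun setT F -> bmf (truncation n F).
Proof.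
move=> mF; split.
  apply: measurable_funM => //; apply: measurable_indic.
  rewrite (_ : [set x | _] = ~` [set x | n%:R < `|F x|]).
    by apply: measurableC; apply: measurable_gt_set; exact: measurableT_comp.
  by apply/seteqP; split => x /=; rewrite leNgt => /negP.
exists n%:R => x; have [[h ->]|[_ ->]] := truncation_cases n F x => //.
by rewrite normr0.
Qed.

Lemma truncation_approx F e : L2_0 mu F -> 0 < e -> exists f : X -> R,
  [/\ bmf f, forall x, `|f x| <= `|F x|,
      mu.-integrable setT (fun x => ((F x - f x) ^+ 2)%:E),
      Rintegral mu setT (fun x => (F x - f x) ^+ 2) <= e &
      `|Rintegral mu setT f| <= e].
Proof.
move=> [mF iF2 iF] e0.
have int1 : mu.-integrable setT (EFin \o (fun=> 1 : R)) by exact: (bmf_integrable mu (bmf_cst X 1)).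
have intF : mu.-integrable setT (EFin \o F).
  apply: (@integrable_dom F (fun x => F x ^+ 2 + 1)) => //.
    exact: (integrableD measurableT iF2 int1).
  move=> x; rewrite -[F x ^+ 2]real_normK ?num_real//.
  by have := sqr_ge0 (`|F x| - 1); have := normr_ge0 (F x); nra.
have mT n := bmf_truncation n mF.
have sq_le n x : (F x - truncation n F x) ^+ 2 <= F x ^+ 2.
  by have [[_ ->]|[_ ->]] := truncation_cases n F x; rewrite ?subrr ?subr0 ?expr0n ?sqr_ge0.
have msq n : measurable_fun setT (fun x => (F x - truncation n F x) ^+ 2).
  by apply: (measurable_funX 2); apply: measurable_funB => //; case: (mT n).
have isq n : mu.-integrable setT (fun x => ((F x - truncation n F x) ^+ 2)%:E).
  apply: (@integrable_dom _ (fun x => F x ^+ 2)) => // x.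
  by rewrite ger0_norm ?sqr_ge0.
have cv : (fun n => Rintegral mu setT (fun x => (F x - truncation n F x) ^+ 2)) @ \oo --> (0 : R).
  have [] := @dominated_convergence _ _ _ mu setT measurableT
    (fun n x => ((F x - truncation n F x) ^+ 2)%:E) (cst 0%E) (fun x => (F x ^+ 2)%:E).
  - by move=> n; apply/measurable_EFinP.
  - exact: measurable_cst.
  - apply: aeW => x _; apply: cvg_near_cst; exists (Num.truncn `|F x|).+1 => // n /= hn.
    have [[_ ->]|[h _]] := truncation_cases n F x; first by rewrite subrr expr0n.
    exfalso; move: h; apply/negP; rewrite -leNgt.
    by apply: le_trans (ltW (truncnS_gt _)) _; rewrite ler_nat.
  - exact: iF2.
  - by apply: aeW => x n _; rewrite /= lee_fin ger0_norm ?sqr_ge0.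
  move=> _ _; rewrite [X in _ --> X -> _]integral0_eq// => h.
  exact: (fine_cvg h).
have /cvgr0Pnorm_lt/(_ _ e0) [n _ hn] := cv.
(* Level n + 1 is at least 1, so |F - f| <= (F - f)^2 pointwise; as [F] has mean 0, the same bound
   then controls the mean of f. *)
have {hn} := hn n.+1 (leqnSn n); set I := Rintegral mu setT _ => hI.
exists (truncation n.+1 F).
have Ile : I <= e by apply: le_trans (ltW hI); exact: ler_norm.
split => //.
- by move=> x; have [[_ ->]|[_ ->]] := truncation_cases n.+1 F x; rewrite ?normr0.
- apply: le_trans Ile.
  have intT := bmf_integrable mu (mT n.+1).
  have intB : mu.-integrable setT (EFin \o (fun x => F x - truncation n.+1 F x)).
    exact: (integrableB measurableT intF intT).
  have F0 : Rintegral mu setT F = 0 by rewrite /Rintegral iF.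
  rewrite -[X in `|X|]opprK normrN -[- _]add0r -F0 -RintegralB//.
  apply: le_trans (le_normr_Rintegral _ intB) _ => //.
  apply: le_Rintegral => //; [exact: (integrable_norm intB)|exact: isq|].
  move=> x _ /=; have [[_ ->]|[h ->]] := truncation_cases n.+1 F x.
    by rewrite subrr normr0 expr0n.
  rewrite subr0 -[F x ^+ 2]real_normK ?num_real// expr2 ler_peMl//.
  by apply: le_trans (ltW h); rewrite ler1n.
Qed.

(** f and g are chosen before [kappa]: the error depends on its marginals only, which keeps the
    final bound uniform over joinings. *)
Lemma cross_approx F G eta : L2_0 mu F -> L2_0 mu G -> 0 < eta -> exists f g : X -> R,
  [/\ bmf f, bmf g, `|Rintegral mu setT f * Rintegral mu setT g| <= eta &
    forall kappa : probability (X * X)%type R,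
    (forall A, measurable A -> kappa (fst @^-1` A) = mu A) ->
    (forall A, measurable A -> kappa (snd @^-1` A) = mu A) ->
    kappa.-integrable setT (EFin \o (fun z => F z.1 * G z.2)) /\
    `|Rintegral kappa setT (fun z => F z.1 * G z.2) -
      Rintegral kappa setT (fun z => f z.1 * g z.2)| <= eta].
Proof.
move=> LF LG eta0; have [mF iF2 _] := LF; have [mG iG2 _] := LG.
pose nF := Rintegral mu setT (fun x => F x ^+ 2); pose nG := Rintegral mu setT (fun x => G x ^+ 2).
have nF0 : 0 <= nF by apply: Rintegral_ge0 => x _; exact: sqr_ge0.
have nG0 : 0 <= nG by apply: Rintegral_ge0 => x _; exact: sqr_ge0.
pose K := (nF + nG + 1) / eta.
have K0 : 0 < K by rewrite divr_gt0//; lra.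
(* [K] makes [K^-1 * (nF + nG) <= eta], and the first bound makes [K * e <= eta / 2]; halved and
   added they give eta. The bounds eta and 1 are for the product of the two means. *)
pose e := Num.min (eta / K / 2) (Num.min eta 1).
have e0 : 0 < e by rewrite lt_min lt_min eta0 ltr01 !andbT divr_gt0// divr_gt0.
have e1 : e <= eta / K / 2 by rewrite ge_min lexx.
have e2 : e <= eta by rewrite !ge_min lexx orbT.
have e3 : e <= 1 by rewrite !ge_min lexx !orbT.
have [f [hf fF if2 lf Ef]] := truncation_approx LF e0.
have [g [hg gG ig2 lg Eg]] := truncation_approx LG e0.
exists f, g; split => //.
  by rewrite normrM -[leRHS]mulr1 ler_pM// (le_trans Ef, le_trans Eg).
move=> kappa k1 k2.
pose u x := (K * (F x - f x) ^+ 2 + K^-1 * F x ^+ 2) / 2.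
pose v x := (K * (G x - g x) ^+ 2 + K^-1 * G x ^+ 2) / 2.
have comb (F' f' : X -> R) : mu.-integrable setT (fun x => (F' x ^+ 2)%:E) ->
    mu.-integrable setT (fun x => ((F' x - f' x) ^+ 2)%:E) ->
    mu.-integrable setT (EFin \o (fun x => (K * (F' x - f' x) ^+ 2 + K^-1 * F' x ^+ 2) / 2)) /\
    Rintegral mu setT (fun x => (K * (F' x - f' x) ^+ 2 + K^-1 * F' x ^+ 2) / 2) =
    (K * Rintegral mu setT (fun x => (F' x - f' x) ^+ 2) + K^-1 * Rintegral mu setT (fun x => F' x ^+ 2)) / 2.
  move=> i1 i2.
  have j2 : mu.-integrable setT (EFin \o (fun x => K * (F' x - f' x) ^+ 2)).
    exact: (integrableZl measurableT K i2).
  have j1 : mu.-integrable setT (EFin \o (fun x => K^-1 * F' x ^+ 2)).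
    exact: (integrableZl measurableT K^-1 i1).
  have j12 : mu.-integrable setT (EFin \o (fun x => K * (F' x - f' x) ^+ 2 + K^-1 * F' x ^+ 2)).
    exact: (integrableD measurableT j2 j1).
  split; first exact: (integrableZr measurableT 2^-1 j12).
  by rewrite RintegralZr// RintegralD// !RintegralZl.
have [iu Eu] := comb F f iF2 if2; have [iv Ev] := comb G g iG2 ig2.
have [iu1 Eu1] := Rintegral_comp (@measurable_fst _ _ X X) k1 iu.
have [iv2 Ev2] := Rintegral_comp (@measurable_snd _ _ X X) k2 iv.
have [iF1 _] := Rintegral_comp (@measurable_fst _ _ X X) k1 iF2.
have [iG1 _] := Rintegral_comp (@measurable_snd _ _ X X) k2 iG2.
have mFG : measurable_fun setT (fun z : X * X => F z.1 * G z.2).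
  apply: measurable_funM.
    exact: (measurableT_comp mF (@measurable_fst _ _ X X)).
  exact: (measurableT_comp mG (@measurable_snd _ _ X X)).
have iFG : kappa.-integrable setT (EFin \o (fun z : X * X => F z.1 * G z.2)).
  apply: le_integrable (integrableD measurableT iF1 iG1) => //; first exact/measurable_EFinP.
  move=> z _ /=; rewrite lee_fin normrM [leRHS]ger0_norm ?addr_ge0 ?sqr_ge0//.
  rewrite -[F z.1 ^+ 2]real_normK ?num_real// -[G z.2 ^+ 2]real_normK ?num_real//.
  exact: AMGM2_sum.
split => //.
have hfg : bmf (fun z : X * X => f z.1 * g z.2).
  by apply: bmfM; [apply: (bmf_comp hf); exact: measurable_fst|apply: (bmf_comp hg); exact: measurable_snd].
have ifg := bmf_integrable kappa hfg.
have iD : kappa.-integrable setT (EFin \o (fun z : X * X => F z.1 * G z.2 - f z.1 * g z.2)).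
  exact: (integrableB measurableT iFG ifg).
have iuv : kappa.-integrable setT (EFin \o (fun z : X * X => u z.1 + v z.2)).
  exact: (integrableD measurableT iu1 iv2).
rewrite -RintegralB//; apply: le_trans (le_normr_Rintegral _ iD) _ => //.
apply: (@le_trans _ _ (Rintegral kappa setT (fun z : X * X => u z.1 + v z.2))).
  apply: le_Rintegral => //; first exact: (integrable_norm iD).
  move=> z _; exact: young_split.
rewrite RintegralD//.
rewrite Eu1 Ev2 Eu Ev -/nF -/nG.
have Ke : K * e <= eta / 2.
  by rewrite mulrC -ler_pdivlMr// -mulrA [2^-1 / K]mulrC mulrA.
have KF := le_trans (ler_wpM2l (ltW K0) lf) Ke.
have KG := le_trans (ler_wpM2l (ltW K0) lg) Ke.
have Kn : K^-1 * nF + K^-1 * nG <= eta.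
  by rewrite -mulrDr mulrC ler_pdivrMr// /K mulrC divfK ?gt_eqF// lerDl.
move: KF KG Kn; lra.
Qed.

End Truncation.

Lemma sqrt_sum_le {R : realType} (a b eps : R) : 0 <= eps -> `|a| <= eps / 2 -> `|b| <= eps / 2 ->
  Num.sqrt (a ^+ 2 + b ^+ 2) <= eps.
Proof.
move=> eps0 ha hb; rewrite -[leRHS](ger0_norm eps0) -sqrtr_sqr ler_wsqrtr//.
rewrite -[a ^+ 2]real_normK ?num_real// -[b ^+ 2]real_normK ?num_real//.
have := normr_ge0 a; have := normr_ge0 b; nra.
Qed.

Lemma three_thirds {R : realType} (x y z eta : R) :
  `|x - y| <= eta / 3 -> `|y - z| <= eta / 3 -> `|z| <= eta / 3 -> `|x| <= eta.
Proof.
rewrite !ler_norml => /andP[? ?] /andP[? ?] /andP[? ?]; apply/andP; split; lra.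
Qed.

Section AOP.
Context {R : realType} (alpha : R) d (Y : measurableType d) (nu : probability Y R)
  (S : R -> Y -> Y).
Let X := (R * Y)%type.
Let Rm := @skew_flow R d Y alpha S.
Hypothesis bad : badly_approximable alpha.
Hypothesis flowS : measure_preserving_flow nu S.
Hypothesis noev : forall k : nat, ~ flow_eigenvalue nu S k%:R.
Let mu : probability X R := product_measure1 (@lebT R) nu.

Lemma cross_small (F G : X -> R) eta : L2_0 mu F -> L2_0 mu G -> 0 < eta ->
  exists N : nat, forall r s : nat, prime r -> prime s -> r <> s -> (N <= r)%N ->
  forall kappa : probability (X * X)%type R,
    is_joining mu kappa (iter r Rm) (iter s Rm) ->
    ergodic_measure kappa (fun z : X * X => (iter r Rm z.1, iter s Rm z.2)) ->
    kappa.-integrable setT (EFin \o (fun z => F z.1 * G z.2)) /\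
    `|Rintegral kappa setT (fun z => F z.1 * G z.2)| <= eta.
Proof.
move=> LF LG eta0; have eta3 : 0 < eta / 3 by rewrite divr_gt0.
have [mS S0 SD nuS] := flowS.
have [f [g [hf hg fg h]]] := cross_approx LF LG eta3.
have [N hN] := bounded_aop bad mS S0 SD nuS noev hf hg eta3.
exists N => r s pr ps rs Nr kappa joins erg.
have co : coprime r s by rewrite prime_coprime// dvdn_prime2//; exact/eqP.
have := hN r s co (prime_gt0 pr) (prime_gt0 ps) rs Nr kappa joins erg.
rewrite -!(E_prod12 (@lebT R) nu)// => hb.
have [marg1 marg2 _] := joins.
have m1 A : measurable A -> kappa (fst @^-1` A) = mu A.
  by move=> mA; rewrite -(marg1 _ mA); congr (kappa _); apply/seteqP; split=> z //= [].
have m2 A : measurable A -> kappa (snd @^-1` A) = mu A.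
  by move=> mA; rewrite -(marg2 _ mA); congr (kappa _); apply/seteqP; split=> z //= [].
have [iFG close] := h kappa m1 m2.
split => //; exact: three_thirds close hb fg.
Qed.

Lemma aop_skew : AOP mu Rm.
Proof.
move=> F1 F2 G1 G2 LF1 LF2 LG1 LG2 eps eps0.
(* Real and imaginary part consist of two real correlations each, so each part is at most eps /
   2. *)
have e4 : 0 < eps / 4 by rewrite divr_gt0.
have [N1 h1] := cross_small LF1 LG1 e4; have [N2 h2] := cross_small LF2 LG2 e4.
have [N3 h3] := cross_small LF1 LG2 e4; have [N4 h4] := cross_small LF2 LG1 e4.
exists (maxn (maxn N1 N2) (maxn N3 N4)) => r s pr ps rs.
rewrite !geq_max => /andP[/andP[r1 r2] /andP[r3 r4]] _ kappa joins erg.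
have [i11 b11] := h1 r s pr ps rs r1 kappa joins erg.
have [i22 b22] := h2 r s pr ps rs r2 kappa joins erg.
have [i12 b12] := h3 r s pr ps rs r3 kappa joins erg.
have [i21 b21] := h4 r s pr ps rs r4 kappa joins erg.
rewrite /cplx_cross_abs; apply: sqrt_sum_le; first exact: ltW.
  rewrite RintegralB//; apply: le_trans (ler_normB _ _) _.
  by apply: le_trans (lerD b11 b22) _; lra.
rewrite RintegralD//; apply: le_trans (ler_normD _ _) _.
by apply: le_trans (lerD b12 b21) _; lra.
Qed.

End AOP.

Theorem theorem7 (R : realType) (alpha : R) (d : measure_display)
    (Y : measurableType d) (nu : probability Y R) (S : R -> Y -> Y) :
  irrational alpha ->
  bounded_partial_quotients alpha ->
  @standard_borel R d Y ->
  measure_preserving_flow nu S ->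
  ergodic_flow nu S ->
  (forall q : rat, ~ flow_eigenvalue nu S (ratr q)) ->
  AOP (lebesgue_T \x nu)%E (skew_flow alpha S).
Proof.
move=> irr bpq _ flowS _ noev.
apply: aop_skew => //; first exact: badly_approximable_bpq.
by move=> k; have := noev k%:R; rewrite ratr_nat.
Qed.
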